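(* Let $X^x$ be an $\mathbb{R}^d$-valued continuous Markov process started at $x$, with semigroup $\mathscr T_s f(x)=\mathbb{E} f(X^x(s))$ and generator $\mathscr A$, and let $B$ be an independent one-dimensional Brownian motion started at $0$. Let $f$ be a bounded measurable function in the domain of $\mathscr A$ such that all second partial derivatives $D_{ij}f$, $1\le i,j\le d$, are bounded and Hölder continuous. Suppose either $u(t,x)=\mathbb{E} f(\mathbb{X}^{x,k}_{B,e}(t))$ for some $k\in\mathbb{N}$ (with $\mathbb{X}^{x,1}_{B,e}=\mathbb{X}^x_B$), or $u(t,x)=\mathbb{E} f(\mathbb{X}^x_{B,e}(t))$. Then $u$ solves $$\frac{\partial}{\partial t}u(t,x)=\frac{\mathscr A f(x)}{\sqrt{2\pi t}}+\frac12\mathscr A^2u(t,x),\quad t>0,\ x\in\mathbb{R}^d;\qquad u(0,x)=f(x),\ x\in\mathbb{R}^d,$$ where $\mathscr A$ acts on $u(t,x)$ as a function of $x$ with $t$ fixed. In particular, if $X^x$ is a standard $d$-dimensional Brownian motion started at $x$ (so $\mathscr A=\frac12\Delta$), then $u(t,x)=\mathbb{E} f(\mathbb{X}^x_B(t))$ solves $$\frac{\partial}{\partial t}u(t,x)=\frac{\Delta f(x)}{\sqrt{8\pi t}}+\frac18\Delta^2u(t,x),\quad t>0,\ x\in\mathbb{R}^d;\qquad u(0,x)=f(x).$$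
   Context: All processes are defined on a probability space $(\Omega,\mathscr F,\{\mathscr F_t\},\mathbb{P})$; $B$ is a one-dimensional Brownian motion with $B(0)=0$, independent of the Markov process(es) $X^x$. The Brownian-time process (BTP) is $\mathbb{X}^x_B(t)=X^x(|B(t)|)$; when $X^x$ is a Brownian motion it is called a Brownian-time Brownian motion (BTBM). An excursion interval of $|B|$ is a maximal open time interval on which $|B(t)|>0$. For $k\in\mathbb{N}$, let $X^{x,1},\dots,X^{x,k}$ be independent copies of $X^x$ started at $x$ (independent of $B$); the $k$EBTP $\mathbb{X}^{x,k}_{B,e}(t)$ is obtained by choosing, on each excursion interval of $|B|$, one of the $k$ copies uniformly at random (independently across excursions and of everything else) and setting $\mathbb{X}^{x,k}_{B,e}(t)=X^{x,i}(|B(t)|)$ where $i$ is the copy chosen for the excursion containing $t$. The excursion-based Brownian-time process (EBTP) $\mathbb{X}^x_{B,e}(t)$ is obtained by using an independent copy of $X^x$ on each excursion interval of $|B|$. *)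

(* Defs.v *)
From HB Require Import structures.
From Stdlib Require List.
From mathcomp Require Import all_boot all_order all_algebra.
From mathcomp Require Import all_classical all_reals all_analysis.
Set Implicit Arguments. Unset Strict Implicit. Unset Printing Implicit Defensive.
Import Order.TTheory GRing.Theory Num.Theory.
Import numFieldNormedType.Exports.
Local Open Scope classical_set_scope.
Local Open Scope ring_scope.

Definition Rd_borel {R : realType} {d : nat} (A : set 'rV[R]_d) : Prop :=
  <<s [set U : set 'rV[R]_d | open U] >> A.

Definition Rd_mfun {R : realType} {d : nat} (g : 'rV[R]_d -> R) : Prop :=
  forall A : set R, measurable A -> Rd_borel (g @^-1` A).

Definition bddf {T : Type} {R : realType} (g : T -> R) : Prop :=
  exists M : R, forall x, `|g x| <= M.

Definition Ex {d0 : measure_display} {Om : measurableType d0} {R : realType}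
  (P : probability Om R) (Z : Om -> R) : R :=
  fine (\int[P]_w (Z w)%:E).

Definition cyl_event {Om : Type} {R : realType} {K I : Type}
  (Y : K -> I -> Om -> R) (s : K -> seq I) (A : K -> I -> set R) (k : K) :
  set Om := [set w | forall i, Stdlib.Lists.List.In i (s k) -> A k i (Y k i w)].

(* Mutual independence of a family (indexed by K) of groups of real random
   variables: the sigma-algebras sigma(Y k i, i : I) are mutually independent.
   Stated through the generating pi-systems of finite-dimensional cylinder
   events (equivalent by the pi-lambda theorem). *)
Definition indep_groups {d0 : measure_display} {Om : measurableType d0}
  {R : realType} (P : probability Om R) {K : eqType} {I : Type}
  (Y : K -> I -> Om -> R) : Prop :=
  (forall k i, measurable_fun setT (Y k i)) /\
  forall (ks : seq K), uniq ks ->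
  forall (s : K -> seq I) (A : K -> I -> set R),
    (forall k i, measurable (A k i)) ->
    P (\bigcap_(k in [set` ks]) cyl_event Y s A k)
    = (\prod_(k <- ks) P (cyl_event Y s A k))%E.

Definition same_law {d0 : measure_display} {Om : measurableType d0}
  {R : realType} (P : probability Om R) {I : Type} (Y Z : I -> Om -> R) : Prop :=
  forall (s : seq I) (A : I -> set R), (forall i, measurable (A i)) ->
    P [set w | forall i, Stdlib.Lists.List.In i s -> A i (Y i w)]
    = P [set w | forall i, Stdlib.Lists.List.In i s -> A i (Z i w)].

Definition coords {Om : Type} {R : realType} {d : nat}
  (X : R -> Om -> 'rV[R]_d) : (R * 'I_d) -> Om -> R :=
  fun p w => X p.1 w 0 p.2.

Section Markov.
Context {d0 : measure_display} {Om : measurableType d0} {R : realType} {d : nat}.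
Variable P : probability Om R.
Variable X : 'rV[R]_d -> R -> Om -> 'rV[R]_d.

Definition semig (s : R) (g : 'rV[R]_d -> R) (x : 'rV[R]_d) : R :=
  Ex P (fun w => g (X x s w)).

Fixpoint chain (l : seq (R * ('rV[R]_d -> R))) (x : 'rV[R]_d) : R :=
  match l with
  | [::] => 1
  | (h, g) :: l' => semig h (fun y => g y * chain l' y) x
  end.

Fixpoint prod_along (x : 'rV[R]_d) (l : seq (R * ('rV[R]_d -> R))) (t0 : R)
  (w : Om) : R :=
  match l with
  | [::] => 1
  | (h, g) :: l' => g (X x (t0 + h) w) * prod_along x l' (t0 + h) w
  end.

(* X is a continuous (time-homogeneous) Markov family started at x, with
   measurable transition semigroup semig: the Markov property is expressed
   through the finite-dimensional distributions. *)
Definition markov_family : Prop :=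
  [/\ (forall x w, X x 0 w = x),
      (forall x w, {within `[0, +oo[, continuous (fun s => X x s w)}),
      (forall x t (i : 'I_d), measurable_fun setT (fun w => X x t w 0 i)),
      (forall s g, 0 <= s -> bddf g -> Rd_mfun g -> Rd_mfun (semig s g)) &
      (forall x (l : seq (R * ('rV[R]_d -> R))),
         (forall p, p \in l -> [/\ 0 <= p.1, bddf p.2 & Rd_mfun p.2]) ->
         Ex P (prod_along x l 0) = chain l x)].

(* gen g h : g is in the domain of the generator A (on the Banach space of
   bounded Borel functions with the sup norm) and A g = h. *)
Definition gen (g h : 'rV[R]_d -> R) : Prop :=
  [/\ bddf g, Rd_mfun g, bddf h, Rd_mfun h &
      forall e : R, 0 < e -> exists2 del : R, 0 < del &
        forall s : R, 0 < s < del -> forall x,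
          `|(semig s g x - g x) / s - h x| < e].

End Markov.

Definition gauss_law {d0 : measure_display} {Om : measurableType d0}
  {R : realType} (P : probability Om R) (Y : Om -> R) (v : R) : Prop :=
  forall A : set R, measurable A -> P (Y @^-1` A) = normal_prob 0 (Num.sqrt v) A.

Definition brownian {d0 : measure_display} {Om : measurableType d0}
  {R : realType} (P : probability Om R) (B : R -> Om -> R) : Prop :=
  [/\ (forall w, B 0 w = 0),
      (forall w, {within `[0, +oo[, continuous (fun s => B s w)}),
      (forall t, measurable_fun setT (B t)) &
      (forall s t : R, 0 <= s -> s < t ->
        gauss_law P (fun w => B t w - B s w) (t - s) /\
        indep_groups P (fun (b : bool) (r : R) =>
          if b then (fun w => B t w - B s w)
          else B (if (0 <= r) && (r <= s) then r else 0)))].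

Definition bm_family {d0 : measure_display} {Om : measurableType d0}
  {R : realType} {d : nat} (P : probability Om R)
  (X : 'rV[R]_d -> R -> Om -> 'rV[R]_d) : Prop :=
  forall x,
    indep_groups P (fun (i : 'I_d) (t : R) w => X x t w 0 i - x 0 i) /\
    forall i : 'I_d, brownian P (fun t w => X x t w 0 i - x 0 i).

(* an enumeration n |-> r_n of the rationals (with junk value -1) *)
Definition ratpt {R : realType} (n : nat) : R :=
  match @pickle_inv rat n with Some q => ratr q | None => -1 end.

(* s lies in the excursion interval of |B(.,w)| containing t *)
Definition in_exc {Om : Type} {R : realType} (B : R -> Om -> R) (w : Om)
  (t s : R) : Prop :=
  forall r, Num.min s t <= r <= Num.max s t -> B r w <> 0.

(* label of the excursion containing t: the least n with r_n in it
   (every excursion interval is open and nonempty, so contains rationals);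
   irrelevant when B t w = 0 *)
Definition exc_label {Om : Type} {R : realType} (B : R -> Om -> R) (w : Om)
  (t : R) : nat :=
  match pselect (exists n, `[< in_exc B w t (ratpt n) >]) with
  | left h => ex_minn h
  | right _ => 0%N
  end.

Definition ebtp {Om : Type} {R : realType} {d : nat}
  (Xc : nat -> 'rV[R]_d -> R -> Om -> 'rV[R]_d) (B : R -> Om -> R)
  (sel : nat -> Om -> nat) (x : 'rV[R]_d) (t : R) (w : Om) : 'rV[R]_d :=
  Xc (sel (exc_label B w t) w) x `|B t w| w.

Inductive ebtp_mode := kEBTP of nat | EBTP.

Definition sel_ok {d0 : measure_display} {Om : measurableType d0}
  {R : realType} (P : probability Om R) (m : ebtp_mode)
  (sel : nat -> Om -> nat) : Prop :=
  match m with
  | kEBTP k => (0 < k)%N /\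
      forall n i, (i < k)%N -> P [set w | sel n w = i] = (k%:R^-1)%:E
  | EBTP => forall n w, sel n w = n
  end.

Definition ebtp_indep {d0 : measure_display} {Om : measurableType d0}
  {R : realType} {d : nat} (P : probability Om R)
  (Xc : nat -> 'rV[R]_d -> R -> Om -> 'rV[R]_d) (B : R -> Om -> R)
  (sel : nat -> Om -> nat) (x : 'rV[R]_d) : Prop :=
  indep_groups P (fun (k : (nat + option nat)%type) (p : R * option 'I_d) =>
    match k with
    | inl i => fun w => match p.2 with Some j => Xc i x p.1 w 0 j | None => 0 end
    | inr None => B p.1
    | inr (Some n) => fun w => (sel n w)%:R
    end).

Definition ei {R : realType} {d : nat} (i : 'I_d) : 'rV[R]_d := delta_mx 0 i.

Definition D2 {R : realType} {d : nat} (g : 'rV[R]_d -> R) (i j : 'I_d) :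
  'rV[R]_d -> R := 'D_(ei i) ('D_(ei j) g).

Definition holder {R : realType} {d : nat} (g : 'rV[R]_d -> R) : Prop :=
  exists (C a : R), 0 < a <= 1 /\
    forall x y, `|g x - g y| <= C * `|x - y| `^ a.

Definition lap {R : realType} {d : nat} (g : 'rV[R]_d -> R) : 'rV[R]_d -> R :=
  fun x => \sum_(i < d) 'D_(ei i) ('D_(ei i) g) x.

(* Main.v *)
Require Import Defs.
From HB Require Import structures.
From mathcomp Require Import all_boot all_order all_algebra.
From mathcomp Require Import all_classical all_reals all_analysis.
From mathcomp Require Import measurable_realfun ring lra.
Set Implicit Arguments. Unset Strict Implicit. Unset Printing Implicit Defensive.
Import Order.TTheory GRing.Theory Num.Theory.
Import numFieldNormedType.Exports.
Local Open Scope classical_set_scope.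
Local Open Scope ring_scope.

(** Conditioning on [B] and on the selection of the copies, the label of the
    excursion straddling [t] is a measurable functional of [B], hence independent
    of every copy; whatever copy is used, [u t x = E T_{|B t|} f x], and by the
    symmetry and scaling of the normal law this is [2 E(T_{sqrt t Z} f x ; Z > 0)]
    with [Z] standard normal.  Differentiating in [t] under the integral produces
    [T A f] with weight [z]; integrating by parts against the normal density [phi],
    which satisfies [phi' z = - z phi z], turns that weight into the generator and
    leaves the boundary term [A f x / sqrt (2 pi t)].

    For a Brownian motion, [T_s g x = E g (x + sqrt s Z)].  Derivatives of [f] pass
    through both averages, so [lap (u t)] is the average of [lap f].  The latter is only
    Hölder continuous, but shifting [x] along a coordinate is a change of Gaussian
    measure (Cameron-Martin), so [T_s (lap f)] is twice differentiable with Hessian of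
    order [s ^ (a / 2 - 1)], an integrable singularity after averaging over
    [s = |B t|].  A symmetrised second order Taylor expansion identifies [A] with
    [lap / 2] on all the functions involved. *)

(** * Integration and the standard normal law *)

(** Three obstacles shape the proof. The copy in use is indexed by a random label, and its clock is
    random too, so independence does not apply to the composed process as it stands. Membership in
    an excursion is given a countable description, which places the label in the sigma-algebra
    generated by [B]; the clock is discretised before conditioning, and path continuity removes the
    discretisation. No Feller property is assumed, so norm continuity in time is at hand only for
    functions in the domain of the generator and for their images. This suffices, because the
    semigroup commutes with the averages over Brownian time. [A f] need not lie in the domain of
    [A], yet [A] acts twice on [u t]. The integration by parts writes the average of [A f] as a
    combination of [f] and of a weighted average of [f], both in the domain; this is what gives a
    meaning to [A ^ 2 u]. In the Brownian case only derivatives along the coordinate axes are given.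
    Increments are therefore split coordinate by coordinate, and only pure second derivatives
    enter. *)

Lemma bounded_integrable {d : measure_display} {T : measurableType d} {R : realType}
    (mu : {finite_measure set T -> \bar R}) (D : set T) (f : T -> R) (M : R) :
  measurable D -> measurable_fun D f -> (forall x, `|f x| <= M) ->
  mu.-integrable D (EFin \o f).
Proof.
move=> mD mf fM; apply: measurable_bounded_integrable => //.
  by rewrite -ge0_fin_numE// fin_num_measure.
exists M; split; first by rewrite num_real.
by move=> x Mx y _; rewrite /= (le_trans (fM y))// ltW.
Qed.

Lemma Rintegral_dominated_cvg {d : measure_display} {T : measurableType d} {R : realType}
    (mu : {measure set T -> \bar R}) (D : set T) (F : nat -> T -> R) (f g : T -> R) :
  measurable D -> (forall n, measurable_fun D (F n)) ->
  (forall x, D x -> F n x @[n --> \oo] --> f x) ->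
  mu.-integrable D (EFin \o g) ->
  (forall n x, D x -> `|F n x| <= g x) ->
  \int[mu]_(x in D) F n x @[n --> \oo] --> \int[mu]_(x in D) f x.
Proof.
move=> mD mF Ff ig Fg.
have mf : measurable_fun D f by apply: (measurable_fun_cvg mF) => x /Ff.
have Ff' x : D x -> (F n x)%:E @[n --> \oo] --> (EFin \o f) x.
  by move=> Dx; apply: cvg_EFin; [exact: nearW|exact: Ff].
have [If _ C] := @dominated_convergence _ _ _ mu D mD
  (fun n x => (F n x)%:E) (EFin \o f) (EFin \o g)
  (fun n => (measurable_EFinP _ _).2 (mF n)) ((measurable_EFinP _ _).2 mf)
  (aeW _ Ff') ig (aeW _ (fun x n Dx => Fg n x Dx)).
apply: fine_cvg; rewrite fineK//; exact: integrable_fin_num.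
Qed.

Lemma le_normr_Rintegral_dominated {d : measure_display} {T : measurableType d} {R : realType}
    (mu : {measure set T -> \bar R}) (D : set T) (f g : T -> R) :
  measurable D -> measurable_fun D f -> mu.-integrable D (EFin \o g) ->
  (forall x, D x -> `|f x| <= g x) ->
  mu.-integrable D (EFin \o f) /\
  `|\int[mu]_(x in D) f x| <= \int[mu]_(x in D) g x.
Proof.
move=> mD mf ig fg.
have i : mu.-integrable D (EFin \o f).
  apply: le_integrable ig => //; first exact/measurable_EFinP.
  by move=> x Dx; rewrite /= lee_fin (le_trans (fg x Dx))// ler_norm.
split => //; apply: (le_trans (le_normr_Rintegral mD i)).
by apply: le_Rintegral => //; exact: integrable_norm.
Qed.

(** * Integrals against a normal law through its density *)

Section normal_density.
Context {R : realType}.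
Notation mu := (@lebesgue_measure R).

(** Both functions integrate to the normal probability over every measurable subset of [D], and
    these integrals determine a density almost everywhere. *)
Lemma ae_eq_normal_density (m s : R) (D : set R) : measurable D ->
  ae_eq mu D (Radon_Nikodym_SigmaFinite.f (normal_prob m s) mu)
    (EFin \o normal_pdf m s).
Proof.
move=> mD; have dom := normal_prob_dominates m s.
apply: integral_ae_eq => //.
- by apply: (integrableS measurableT) => //; exact: Radon_Nikodym_SigmaFinite.f_integrable.
- by apply/measurable_EFinP/measurable_funTS; exact: measurable_normal_pdf.
- by move=> A AD mA; rewrite -Radon_Nikodym_SigmaFinite.f_integral.
Qed.

(** The change of variables for a dominated measure yields the abstract Radon-Nikodym derivative,
    which is then traded almost everywhere for the explicit density. *)
Lemma ge0_integral_normal_prob (m s : R) (f : R -> R) (D : set R) : measurable D ->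
  measurable_fun D f -> (forall x, 0 <= f x) ->
  (\int[normal_prob m s]_(x in D) (f x)%:E =
   \int[mu]_(x in D) (f x * normal_pdf m s x)%:E)%E.
Proof.
move=> mD mf f0; have dom := normal_prob_dominates m s.
rewrite -(Radon_Nikodym_SigmaFinite.change_of_variables dom)//; last exact/measurable_EFinP.
under [RHS]eq_integral do rewrite EFinM.
apply: ae_eq_integral => //.
- apply: emeasurable_funM; first exact/measurable_EFinP.
  apply: (measurable_int mu); apply: (integrableS measurableT) => //.
  exact: Radon_Nikodym_SigmaFinite.f_integrable.
- apply: emeasurable_funM; first exact/measurable_EFinP.
  by apply/measurable_EFinP/measurable_funTS; exact: measurable_normal_pdf.
- by apply: ae_eqe_mul2l; exact: ae_eq_normal_density.
Qed.

Lemma integral_normal_prob (m s : R) (f : R -> R) (D : set R) : measurable D ->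
  (normal_prob m s).-integrable D (EFin \o f) ->
  mu.-integrable D (EFin \o (fun x => f x * normal_pdf m s x)) /\
  \int[normal_prob m s]_(x in D) f x = \int[mu]_(x in D) (f x * normal_pdf m s x).
Proof.
move=> mD fi; have dom := normal_prob_dominates m s.
have mf : measurable_fun D f by apply/measurable_EFinP; exact: measurable_int fi.
have mp := measurable_funS measurableT (subsetT D) (measurable_normal_pdf m s).
split.
  apply/integrableP; split; first by apply/measurable_EFinP/measurable_funM.
  move: fi => /integrableP[_]; under eq_integral do rewrite /=.
  rewrite ge0_integral_normal_prob//; last exact: measurableT_comp.
  apply: le_lt_trans; rewrite le_eqVlt; apply/orP; left; apply/eqP.
  by apply: eq_integral => x _; rewrite /= normrM (ger0_norm (normal_pdf_ge0 _ _ _)).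
rewrite /Rintegral -(Radon_Nikodym_change_of_variables dom mD fi).
congr fine; under [RHS]eq_integral do rewrite EFinM.
apply: ae_eq_integral => //.
- apply: emeasurable_funM; first exact/measurable_EFinP.
  exact: measurable_funTS.
- by apply: emeasurable_funM; exact/measurable_EFinP.
- apply: ae_eqe_mul2l; apply: (ae_eq_trans (ae_eq_sym (ae_eq_Radon_Nikodym_SigmaFinite dom mD))).
  exact: ae_eq_normal_density.
Qed.

End normal_density.

(** The measurability proof is an argument, so that the image measure comes bundled as a measure and
    can be compared with others by uniqueness theorems. *)
Definition law {d d' : measure_display} {T : measurableType d} {U : measurableType d'}
  {R : realType} (mu : {measure set T -> \bar R}) (phi : T -> U)
  (mphi : measurable_fun setT phi) : {measure set U -> \bar R}.
Proof. by refine (pushforward mu phi : {measure set U -> \bar R}). Defined.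

Lemma lawE {d d' : measure_display} {T : measurableType d} {U : measurableType d'}
    {R : realType} (mu : {measure set T -> \bar R}) (phi : T -> U)
    (mphi : measurable_fun setT phi) (A : set U) : law mu mphi A = mu (phi @^-1` A).
Proof. by []. Qed.

Lemma ge0_integral_law {d d' : measure_display} {T : measurableType d} {U : measurableType d'}
    {R : realType} (mu : {measure set T -> \bar R}) (phi : T -> U)
    (mphi : measurable_fun setT phi) (f : U -> \bar R) : measurable_fun setT f ->
  (forall x, 0 <= f x)%E -> (\int[law mu mphi]_x f x = \int[mu]_x f (phi x))%E.
Proof. by move=> mf f0; exact: (@ge0_integral_pushforward _ _ _ _ _ _ mphi mu setT f). Qed.

Lemma Rintegral_law {d d' : measure_display} {T : measurableType d} {U : measurableType d'}
    {R : realType} (mu : {measure set T -> \bar R}) (phi : T -> U)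
    (mphi : measurable_fun setT phi) (f : U -> R) : measurable_fun setT f ->
  \int[law mu mphi]_x f x = \int[mu]_x f (phi x).
Proof.
move=> mf; rewrite /Rintegral; congr fine; rewrite [LHS]integralE [RHS]integralE; congr (_ - _)%E.
  rewrite ge0_integral_law//; first by apply: eq_integral => x _; rewrite !funeposE.
  exact/measurable_funepos/measurable_EFinP.
rewrite ge0_integral_law//; first by apply: eq_integral => x _; rewrite !funenegE.
exact/measurable_funeneg/measurable_EFinP.
Qed.

(** * Affine changes of variable for Lebesgue measure *)

Section lebesgue_affine.
Context {R : realType}.
Notation mu := (@lebesgue_measure R).

Lemma measurable_fun_affine (a b : R) : @measurable_fun _ _ (measurableTypeR R) (measurableTypeR R) setT (fun z : R => a * z + b).
Proof. by apply: measurable_funD => //; exact: mulrl_measurable. Qed.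

(** Lebesgue measure is determined by its values on the intervals []x, y]], and the preimage of such
    an interval has length [(y - x) / a]. *)
Lemma lebesgue_measure_affine (a b : R) (A : set R) : 0 < a -> measurable A ->
  (a%:E * law mu (measurable_fun_affine a b) A)%E = mu A.
Proof.
move=> a0 mA.
pose m1 : {measure set (measurableTypeR R) -> \bar R} :=
  mscale (NngNum (ltW a0)) (law mu (measurable_fun_affine a b)).
apply/esym; rewrite (@lebesgue_measure_unique _ m1)// => _ [[x y]] _ <-.
rewrite /m1 /= /mscale/= /law /= /pushforward.
rewrite (_ : _ @^-1` _ = `](x - b) / a, (y - b) / a]%classic); last first.
  apply/seteqP; split => z /=; rewrite !in_itv/= ltr_pdivrMr// ler_pdivlMr//;
  rewrite ltrBlDr lerBrDr mulrC//.
rewrite !lebesgue_measure_itv/= !lte_fin ltr_pM2r ?invr_gt0// ltrD2r.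
case: ifPn => _; last by rewrite mule0.
rewrite -!EFinB -EFinM; congr EFin; field; exact: lt0r_neq0.
Qed.

Lemma ge0_integral_affine (a b : R) (f : R -> R) : 0 < a -> measurable_fun setT f ->
  (forall x, 0 <= f x) ->
  (\int[mu]_x (f x)%:E = a%:E * \int[mu]_x (f (a * x + b))%:E)%E.
Proof.
move=> a0 mf f0.
pose m1 : {measure set (measurableTypeR R) -> \bar R} :=
  mscale (NngNum (ltW a0)) (law mu (measurable_fun_affine a b)).
rewrite (@eq_measure_integral _ _ _ _ m1)/=; last first.
  by move=> A mA _; rewrite -(lebesgue_measure_affine b a0)//.
have mfe : @measurable_fun _ _ (measurableTypeR R) _ setT (fun x => (f x)%:E).
  exact/measurable_EFinP.
rewrite (ge0_integral_mscale (law mu (measurable_fun_affine a b)) measurableT _ mfe)//.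
  by rewrite ge0_integral_law.
by move=> x _; rewrite lee_fin.
Qed.

End lebesgue_affine.

(** * Scaling, shifts, symmetry and exponential moments of the standard normal law *)

Section standard_normal.
Context {R : realType}.
Notation mu := (@lebesgue_measure R).
Notation N := (@normal_prob R 0 1).
Notation phi := (@normal_pdf R 0 1).

Lemma normal_pdf01E (z : R) : phi z = normal_peak 1 * expR (- z ^+ 2 / 2).
Proof. by rewrite normal_pdfE ?oner_eq0// /normal_fun subr0 expr1n. Qed.

(** The argument is written [s * z + 0] to match the affine substitution with [b = 0]. *)
Lemma normal_pdf_scale (s z : R) : 0 < s -> s * normal_pdf 0 s (s * z + 0) = phi z.
Proof.
move=> s0; have sn0 : s != 0 by rewrite gt_eqF.
rewrite normal_pdf01E normal_pdfE// /normal_fun addr0 subr0 /normal_peak.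
rewrite expr1n mul1r -mulrnAr sqrtrM ?sqr_ge0// sqrtr_sqr gtr0_norm//.
have q0 : Num.sqrt (pi *+ 2) != 0 :> R by rewrite gt_eqF// sqrtr_gt0 mulrn_wgt0// pi_gt0.
rewrite mulrA; congr (_ * expR _); first by field; rewrite q0 sn0.
by rewrite -[in LHS]mulr_natl; field; rewrite sn0.
Qed.

Lemma normal_prob_indic (m s : R) (A : set R) : measurable A ->
  normal_prob m s A = (\int[mu]_x (\1_A x * normal_pdf m s x)%:E)%E.
Proof.
move=> mA; rewrite -ge0_integral_normal_prob//.
by rewrite integral_indic// setIT.
Qed.

Lemma normal_prob_scale (s : R) (A : set R) : 0 < s -> measurable A ->
  normal_prob 0 s A = N ((fun z => s * z) @^-1` A).
Proof.
move=> s0 mA; have msA : measurable ((fun z : R => s * z) @^-1` A).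
  by rewrite -[X in measurable X]setTI; exact: mulrl_measurable.
rewrite !normal_prob_indic// (@ge0_integral_affine _ s 0)//; last first.
  by move=> x; rewrite mulr_ge0// normal_pdf_ge0.
- by apply: measurable_funM; [exact: measurable_indic|exact: measurable_normal_pdf].
- rewrite -ge0_integralZl_EFin//; first last.
  + exact: ltW.
  + apply/measurable_EFinP; apply: measurable_funM.
      apply: (measurableT_comp (measurable_indic mA)).
      exact: measurable_fun_affine.
    apply: (measurableT_comp (measurable_normal_pdf _ _)).
    exact: measurable_fun_affine.
  + by move=> x _; rewrite lee_fin mulr_ge0// normal_pdf_ge0.
  apply: eq_integral => x _; rewrite -EFinM mulrCA normal_pdf_scale//; congr (_ * _)%:E.
  by rewrite addr0.
Qed.

(** Completing the square; the exponential factor is the one-dimensional Cameron-Martin density. *)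
Lemma normal_pdf_shift (a z : R) : phi (z - a) = phi z * expR (a * z - a ^+ 2 / 2).
Proof. by rewrite !normal_pdf01E -mulrA -expRD; congr (_ * expR _); field. Qed.

Lemma ge0_integral_normal_shift (a : R) (f : R -> R) : measurable_fun setT f ->
  (forall x, 0 <= f x) ->
  (\int[N]_z (f (z + a))%:E = \int[N]_z (f z * expR (a * z - a ^+ 2 / 2))%:E)%E.
Proof.
move=> mf f0.
have mfa : measurable_fun setT (fun z : R => f (z + a)).
  by apply: (measurableT_comp mf); exact: measurable_funD.
have me : measurable_fun setT (fun z : R => expR (a * z - a ^+ 2 / 2)).
  apply: (measurableT_comp (@measurable_expR R)).
  by apply: measurable_funB => //; exact: mulrl_measurable.
rewrite !ge0_integral_normal_prob//; first last.
- by move=> z; rewrite mulr_ge0// expR_ge0.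
- exact: measurable_funM.
rewrite [RHS](@ge0_integral_affine _ 1 a)//; first last.
- by move=> z; rewrite !mulr_ge0// ?expR_ge0// normal_pdf_ge0.
- by apply: measurable_funM; [exact: measurable_funM|exact: measurable_normal_pdf].
rewrite mul1e; apply: eq_integral => z _.
by rewrite mul1r -mulrA (mulrC (expR _)) -normal_pdf_shift addrK.
Qed.

(** The shift formula applied to the constant [expR (c ^+ 2 / 2)] evaluates the moment generating
    function: its left side is a finite constant, its right side the integral of [expR (c * z)]. *)
Lemma integrable_normal_expR (c : R) : N.-integrable setT (fun z : R => (expR (c * z))%:E).
Proof.
have me : measurable_fun setT (fun z : R => expR (c * z)).
  by apply: (measurableT_comp (@measurable_expR R)); exact: mulrl_measurable.
apply/integrableP; split; first exact/measurable_EFinP.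
have := @ge0_integral_normal_shift c (fun=> expR (c ^+ 2 / 2)) (measurable_cst _) (fun=> expR_ge0 _).
rewrite integral_cst// => H.
under eq_integral => z _.
  rewrite gee0_abs ?lee_fin ?expR_ge0// -[c * z](subrK (c ^+ 2 / 2)) addrC expRD; over.
by move: H => /= <-; rewrite (@probability_setT _ _ _ N) mule1 ltry.
Qed.

Lemma integrable_normal_expR_norm (c : R) :
  N.-integrable setT (fun z : R => (expR (c * `|z|))%:E).
Proof.
have := integrableD measurableT (integrable_normal_expR c) (integrable_normal_expR (- c)).
apply: le_integrable => //.
  apply/measurable_EFinP; apply: (measurableT_comp (@measurable_expR R)).
  by apply: measurable_funM => //; exact: measurableT_comp.
move=> z _; rewrite /= lee_fin (ger0_norm (expR_ge0 _)) (ger0_norm (addr_ge0 (expR_ge0 _) (expR_ge0 _))).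
by case: (lerP 0 z) => z0; [rewrite ger0_norm// lerDl expR_ge0|rewrite ltr0_norm// mulrN mulNr lerDr expR_ge0].
Qed.

(** Since [y <= expR y] at [y = |z| / 4], raising to the fourth power gives the constant
    [256 = 4 ^ 4]. *)
Lemma expr4_le_expR (z : R) : z ^+ 4 <= 256 * expR `|z|.
Proof.
have -> : z ^+ 4 = `|z| ^+ 4 by rewrite -normrX ger0_norm// exprn_even_ge0.
have -> : `|z| = `|z| / 4 *+ 4 by rewrite -[RHS]mulr_natr; field.
rewrite -[X in expR X]mulr_natr expRM_natr -mulr_natl exprMn.
rewrite ler_pM// ?exprn_ge0// ?ler_nat// ?divr_ge0//; first by rewrite -natrX.
rewrite lerXn2r ?nnegrE ?expR_ge0 ?divr_ge0//.
by apply: le_trans (expR_ge1Dx _); rewrite lerDr.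
Qed.

Lemma normal_probN (A : set R) : measurable A -> N ((-%R) @^-1` A) = N A.
Proof.
move=> mA.
have mN : @measurable_fun _ _ (measurableTypeR R) (measurableTypeR R) setT (-%R : R -> R).
  exact: oppr_measurable.
have mNA : measurable ((-%R : R -> R) @^-1` A).
  by rewrite -[X in measurable X]setTI; exact: oppr_measurable.
rewrite !normal_prob_indic//.
rewrite [RHS](@eq_measure_integral _ _ _ _ (law mu mN)); last first.
  by move=> B mB _; rewrite -[LHS]lebesgue_measureN.
rewrite ge0_integral_law.
- apply: eq_integral => x _; rewrite !normal_pdf01E sqrrN //.
- apply/measurable_EFinP; apply: measurable_funM; first exact: measurable_indic.
  exact: measurable_normal_pdf.
- by move=> x; rewrite lee_fin mulr_ge0// normal_pdf_ge0.
Qed.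

(** The two open half-lines contribute equally by symmetry, and the point [0] between them is null.
    The bound [M] only provides integrability. *)
Lemma integral_normal_norm (g : R -> R) (M : R) : measurable_fun setT g ->
  (forall z, `|g z| <= M) ->
  \int[N]_z g `|z| = 2 * \int[N]_(z in `]0, +oo[) g z.
Proof.
move=> mg gM.
have mgn : measurable_fun setT (fun z : R => g `|z|).
  by apply: (measurableT_comp mg); exact: normr_measurable.
have ign (D : set R) : measurable D -> N.-integrable D (EFin \o (fun z : R => g `|z|)).
  by move=> mD; apply: (@bounded_integrable _ _ _ _ _ _ M) => //; exact: measurable_funTS.
have N0 : N [set 0] = 0%E.
  have /null_content_dominatesP := @normal_prob_dominates R 0 1; apply => //.
  exact: lebesgue_measure_set1.
have E : setT = `]-oo, 0[ `|` ([set 0] `|` `]0, +oo[) :> set R.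
  apply/seteqP; split => // z _; rewrite /= !in_itv/= andbT.
  by case: (ltgtP z 0) => [||->]; [left|right; right|right; left].
rewrite {1}E Rintegral_setU//; first last.
- apply/disj_set2P; rewrite -subset0 => z [] /=; rewrite !in_itv/= andbT.
  by move=> z0 [z00|]; [move: z0; rewrite z00 ltxx|move=> /(lt_trans z0); rewrite ltxx].
- by rewrite -E; exact: ign.
- exact: measurableU.
rewrite Rintegral_setU//; first last.
- apply/disj_set2P; rewrite -subset0 => z [] /= ->.
  by rewrite in_itv/= ltxx.
- by apply: ign; exact: measurableU.
have -> : \int[N]_(x in [set 0]) g `|x| = 0.
  rewrite /Rintegral null_set_integral//.
  by apply: (measurable_int N); apply: ign.
rewrite add0r mulr_natl mulr2n; congr (_ + _); last first.
  by apply: eq_Rintegral => z; rewrite inE/= in_itv/= andbT => z0; rewrite gtr0_norm.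
have mN : @measurable_fun _ _ (measurableTypeR R) (measurableTypeR R) setT (-%R : R -> R).
  exact: oppr_measurable.
rewrite Rintegral_mkcond [RHS]Rintegral_mkcond.
transitivity (\int[law N mN]_x ((fun x => g `|x|) \_ `]-oo, 0[) x).
  congr fine; apply: eq_measure_integral => A mA _.
  exact: (esym (normal_probN mA)).
rewrite Rintegral_law; last by apply/(measurable_restrictT _ _).1 => //; exact: measurable_funTS.
apply: eq_Rintegral => z _; rewrite !patchE !mem_setE !in_itv/= andbT oppr_lt0 normrN.
by case: ifPn => // z0; rewrite gtr0_norm.
Qed.

End standard_normal.

(** * Integration by parts and power singularities under the normal law *)

Section standard_normal_calculus.
Context {R : realType}.
Notation mu := (@lebesgue_measure R).
Notation N := (@normal_prob R 0 1).
Notation phi := (@normal_pdf R 0 1).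
Notation Rpos := (`]0%R, +oo[%classic : set R).
Notation Rnneg := (`[0%R, +oo[%classic : set R).

Lemma is_derive_normal_pdf (z : R) : is_derive z 1 phi (- (z * phi z)).
Proof.
rewrite (_ : phi = (fun z => normal_peak 1 * expR (- z ^+ 2 / 2))); last first.
  by apply/funext => y; rewrite normal_pdf01E.
have -> : - (z * (normal_peak 1 * expR (- z ^+ 2 / 2))) =
  normal_peak 1 * (expR (- z ^+ 2 / 2) * (- (2 * z) / 2)) by field.
apply: is_deriveZ; apply: is_derive_eq.
by rewrite /GRing.scale/=; field.
Qed.

(** Lets the integration by parts be carried out on compact intervals: the truncations of [h] are
    dominated by [|h|]. *)
Lemma Rintegral_itv0n_cvg (h : R -> R) : mu.-integrable Rnneg (EFin \o h) ->
  \int[mu]_(z in `[0, n%:R]) h z @[n --> \oo] --> \int[mu]_(z in Rnneg) h z.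
Proof.
move=> ih.
have E n : \int[mu]_(z in `[0, n%:R]) h z = \int[mu]_(z in Rnneg) (h \_ `[0, n%:R]) z.
  rewrite -Rintegral_mkcondr; congr (Rintegral _ _ _); apply/seteqP; split => z /=; rewrite !in_itv/=.
    by move=> /andP[-> ->].
  by rewrite andbT => -[_].
under eq_fun do rewrite E.
have mh : @measurable_fun _ _ (measurableTypeR R) _ Rnneg h.
  by apply/measurable_EFinP; exact: measurable_int ih.
apply: (@Rintegral_dominated_cvg _ (measurableTypeR R) R mu Rnneg
  (fun n => h \_ `[0, n%:R]) h (fun z => `|h z|)) => //.
- move=> n; apply/measurable_restrict => //; apply: measurable_funS mh => //.
- move=> z; rewrite /= in_itv/= andbT => z0; apply: cvg_near_cst.
  near=> n; rewrite patchE mem_set//= in_itv/= z0/=.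
  by near: n; exact: nbhs_infty_ger.
- exact: integrable_norm.
- by move=> n z _; rewrite patchE; case: ifPn => //= _; rewrite normr0.
Unshelve. all: by end_near. Qed.

Lemma integrable_normal_id : N.-integrable Rpos (EFin \o (@idfun R)).
Proof.
have : N.-integrable Rpos (fun z : R => (expR (1 * `|z|))%:E).
  by apply: (integrableS measurableT) => //; exact: integrable_normal_expR_norm.
apply: le_integrable => //; first by apply/measurable_EFinP; exact: measurable_id.
move=> z z0; rewrite /= lee_fin mul1r (ger0_norm (expR_ge0 _)).
by apply: le_trans (expR_ge1Dx _); rewrite lerDr.
Qed.

(** From [expR (n ^+ 2 / 2) >= 1 + n ^+ 2 / 2 >= (n + 1) / 2] the density at [n] is at most a
    multiple of the harmonic sequence. This is the boundary term at infinity. *)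
Lemma normal_pdf_cvg0 (F : R -> R) (M : R) : (forall z, `|F z| <= M) ->
  phi n%:R * F n%:R @[n --> \oo] --> (0 : R).
Proof.
move=> FM; have M0 : 0 <= M by exact: le_trans (FM 0).
apply/norm_cvg0P; apply: (@squeeze_cvgr _ _ _ _ (cst 0) (fun n => normal_peak 1 * M * 2 * n.+1%:R^-1)).
- apply: nearW => n; rewrite /= normr_ge0/= normrM ger0_norm ?normal_pdf_ge0// normal_pdf01E.
  rewrite -!mulrA; apply: ler_wpM2l; first exact: normal_peak_ge0.
  rewrite mulrC ler_pM ?expR_ge0//.
  rewrite mulNr expRN -[X in X <= _]mulr1 ler_pdivrMl ?expR_gt0//.
  rewrite mulrA ler_pdivlMr ?ltr0Sn// mul1r.
  apply: (@le_trans _ _ ((1 + n%:R ^+ 2 / 2) * 2)); last by rewrite ler_wpM2r// expR_ge1Dx.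
  rewrite mulrDl mul1r divfK ?pnatr_eq0// -natr1.
  have := sqr_ge0 (n%:R - 1 / 2 : R); nra.
- exact: cvg_cst.
- rewrite -[X in _ --> X](mulr0 (normal_peak 1 * M * 2)); apply: cvgM; first exact: cvg_cst.
  exact: cvg_harmonic.
Qed.

(** One integrates by parts on [[0, n]] against Lebesgue measure and lets [n] grow; the boundary
    term at [n] vanishes and the one at [0] stays. Differentiability is asked only on the open
    half-line, since the function will be a semigroup in its time variable, which starts at [0]. *)
Lemma normal_integration_by_parts (F dF : R -> R) (M : R) :
  (forall z : R, 0 < z -> is_derive z 1 F (dF z)) -> F z @[z --> 0^'+] --> F 0 ->
  {within `[0, +oo[, continuous dF} ->
  (forall z, `|F z| <= M) -> (forall z, `|dF z| <= M) ->
  \int[N]_(z in Rpos) dF z = - (phi 0 * F 0) + \int[N]_(z in Rpos) (z * F z).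
Proof.
move=> dFF F0 cdF FM dFM.
have cFz (z : R) : 0 < z -> {for z, continuous F}.
  move=> z0; have /derivable1_diffP := @ex_derive _ _ _ _ _ _ _ (dFF _ z0).
  exact: differentiable_continuous.
have cF : {within `[0, +oo[, continuous F}.
  apply/continuous_within_itvcyP; split => // z; rewrite in_itv/= andbT => z0.
  exact: cFz.
have mF : measurable_fun Rnneg F by apply: subspace_continuous_measurable_fun.
have mdF : measurable_fun Rnneg dF by apply: subspace_continuous_measurable_fun.
have sub : Rpos `<=` Rnneg by apply: subset_itvr; rewrite bnd_simp.
have idF (D : set R) : measurable D -> D `<=` Rnneg -> N.-integrable D (EFin \o dF).
  by move=> mD DR; apply: (@bounded_integrable _ _ _ _ _ _ M) => //; exact: measurable_funS mdF.
have izF (D : set R) : measurable D -> D `<=` Rnneg -> N.-integrable D (EFin \o (fun z => z * F z)).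
  move=> mD DR.
  have iD : N.-integrable D (fun z : R => (expR (1 * `|z|))%:E).
    by apply: (integrableS measurableT) => //; exact: integrable_normal_expR_norm.
  have : N.-integrable D (fun z : R => (M%:E * (expR (1 * `|z|))%:E)%E).
    by apply: integrableZl => //.
  apply: le_integrable => //.
    by apply/measurable_EFinP; apply: measurable_funM => //; exact: measurable_funS mF.
  move=> z z0; rewrite /= lee_fin !normrM mulrC ler_pM//.
    by rewrite (le_trans (FM z))// ler_norm.
  by rewrite mul1r (ger0_norm (expR_ge0 _)); apply: le_trans (expR_ge1Dx _); rewrite lerDr.
have [i1 ->] := integral_normal_prob (measurable_itv _) (idF _ (measurable_itv _) sub).
have [i2 ->] := integral_normal_prob (measurable_itv _) (izF _ (measurable_itv _) sub).
rewrite (Rintegral_itv_obnd_cbnd i1) (Rintegral_itv_obnd_cbnd i2).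
have [j1 _] := integral_normal_prob (measurable_itv _) (idF _ (measurable_itv _) (@subset_refl _ Rnneg)).
have [j2 _] := integral_normal_prob (measurable_itv _) (izF _ (measurable_itv _) (@subset_refl _ Rnneg)).
have c1 := Rintegral_itv0n_cvg j1.
have c2 := Rintegral_itv0n_cvg j2.
have c3 := normal_pdf_cvg0 FM.
suff c4 : \int[mu]_(z in `[0, n%:R]) (dF z * phi z) @[n --> \oo] -->
    - (phi 0 * F 0) + \int[mu]_(z in Rnneg) (z * F z * phi z).
  exact: (cvg_unique _ c1 c4).
have -> : - (phi 0 * F 0) + \int[mu]_(z in Rnneg) (z * F z * phi z) =
  0 - phi 0 * F 0 + \int[mu]_(z in Rnneg) (z * F z * phi z) by rewrite sub0r.
apply: cvg_trans (cvgD (cvgB c3 (cvg_cst _)) c2).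
apply: near_eq_cvg; near=> n.
have n0 : (0 : R) < n%:R by rewrite ltr0n; near: n; exact: nbhs_infty_gt.
have sub2 : `[0, n%:R] `<=` Rnneg by apply: subset_itvl.
have cphi : continuous phi by apply: continuous_normal_pdf; rewrite oner_eq0.
have := @Rintegration_by_parts R phi F (fun z => - (z * phi z)) dF 0 n%:R n0.
rewrite (_ : \int[mu]_(x in `[0, n%:R]) (phi x * dF x) = \int[mu]_(x in `[0, n%:R]) (dF x * phi x)); last first.
  by apply: eq_Rintegral => z _; rewrite mulrC.
move=> ->.
- rewrite !fctE /=; congr (_ + _).
  rewrite (_ : \int[mu]_(x in `[0, n%:R]) (- (x * phi x) * F x) =
      - \int[mu]_(x in `[0, n%:R]) (x * F x * phi x)) ?opprK//.
  rewrite -[RHS]mulN1r -RintegralZl//; first by apply: eq_Rintegral => z _; rewrite mulN1r mulNr mulrAC.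
  exact: integrableS j2.
- by apply: continuous_subspaceT => y; apply: cvgN; apply: cvgM; [exact: cvg_id|exact: cphi].
- split.
  + by move=> z _; apply: (@ex_derive _ _ _ _ _ _ _ (is_derive_normal_pdf z)).
  + by apply: cvg_at_right_filter; exact: cphi.
  + by apply: cvg_at_left_filter; exact: cphi.
- by move=> z _; rewrite derive1E (@derive_val _ _ _ _ _ _ _ (is_derive_normal_pdf z)).
- exact: continuous_subspaceW sub2 cdF.
- split.
  + by move=> z; rewrite in_itv/= => /andP[z0 _]; apply: (@ex_derive _ _ _ _ _ _ _ (dFF z z0)).
  + exact: F0.
  + by apply: cvg_at_left_filter; exact: cFz.
- by move=> z; rewrite in_itv/= => /andP[z0 _]; rewrite derive1E (@derive_val _ _ _ _ _ _ _ (dFF z z0)).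
Unshelve. all: by end_near. Qed.

(** The primitive [z ^ b / b] bounds the integral by [1 / b] on each compact interval that stays
    away from [0]; monotone convergence does the rest. *)
Lemma integrable_powR01 (b : R) : 0 < b ->
  mu.-integrable (`]0, 1]%classic : set R) (fun z => (z `^ (b - 1))%:E).
Proof.
move=> b0; have cp (c z : R) : 0 < z -> {for z, continuous (@powR R ^~ c)}.
  move=> z0; apply: differentiable_continuous; apply/derivable1_diffP.
  by apply: derivable_powR; rewrite in_itv/= z0.
have mp : measurable_fun (`]0, 1]%classic : set R) (fun z : R => z `^ (b - 1)).
  exact: (measurable_funTS (measurable_powR _)).
apply/integrableP; split; first exact/measurable_EFinP.
under eq_integral do rewrite gee0_abs ?lee_fin ?powR_ge0//.
(* The offset [2] keeps the left endpoint strictly below [1], as the fundamental theorem of calculus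
   requires. *)
pose Fn (n : nat) : set R := `[n.+2%:R^-1, 1]%classic.
have Fn0 n z : Fn n z -> 0 < z.
  by rewrite /Fn/= in_itv/= => /andP[+ _]; apply: lt_le_trans; rewrite invr_gt0.
have UF : (`]0, 1]%classic : set R) = \bigcup_n Fn n.
  apply/seteqP; split => z /=; last first.
    by move=> [n _ Fz]; rewrite in_itv/= (Fn0 _ _ Fz)/=; move: Fz; rewrite /Fn/= in_itv/= => /andP[].
  rewrite in_itv/= => /andP[z0 z1].
  have [n nz] : exists n, n.+2%:R^-1 <= z.
    exists (Num.truncn z^-1); rewrite -[leRHS]invrK lef_pV2 ?posrE ?invr_gt0//.
    by rewrite ltW// (lt_trans (truncnS_gt _))// ltr_nat.
  by exists n => //; rewrite /Fn/= in_itv/= nz.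
have mf n : measurable_fun (Fn n) (fun z : R => (z `^ (b - 1))%:E).
  by apply/measurable_EFinP; exact: (measurable_funTS (measurable_powR _)).
have C : (\int[mu]_(z in Fn n) (z `^ (b - 1))%:E @[n --> \oo] -->
  \int[mu]_(z in \bigcup_n Fn n) (z `^ (b - 1))%:E)%E.
  apply: ge0_nondecreasing_set_cvg_integral => //.
  - move=> m n mn; apply/subsetPset; apply: subset_itvr; rewrite bnd_simp.
    by rewrite lef_pV2 ?posrE// ler_nat !ltnS.
  - by move=> n; exact: measurable_itv.
  - by move=> n z _; rewrite lee_fin powR_ge0.
have B n : (\int[mu]_(z in Fn n) (z `^ (b - 1))%:E <= (b^-1)%:E)%E.
  have a1 : n.+2%:R^-1 < 1 :> R by rewrite invf_lt1// ltr1n.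
  have a0 : 0 < n.+2%:R^-1 :> R by rewrite invr_gt0.
  rewrite (@continuous_FTC2 R _ (fun z => b^-1 * z `^ b))//.
  - by rewrite powR1 mulr1 -EFinB lee_fin gerBl mulr_ge0 ?powR_ge0// invr_ge0 ltW.
  - apply: continuous_in_subspaceT => z; rewrite inE => /Fn0 z0; exact: cp.
  - split.
    + move=> z; rewrite in_itv/= => /andP[z0 _]; apply: derivableZ.
      by apply: derivable_powR; rewrite in_itv/= (lt_trans a0).
    + by apply: cvg_at_right_filter; apply: cvgM; [exact: cvg_cst|exact: cp].
    + by apply: cvg_at_left_filter; apply: cvgM; [exact: cvg_cst|apply: cp].
  - move=> z; rewrite in_itv/= => /andP[z0 _]; have z00 := lt_trans a0 z0.
    have dz : derivable (@powR R ^~ b) z 1 by apply: derivable_powR; rewrite in_itv/= z00.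
    rewrite derive1E deriveZ// -derive1E powR_derive1 ?in_itv/= ?z00//.
    by rewrite /GRing.scale/= mulKf// gt_eqF.
rewrite UF -(cvg_lim _ C)//; apply: (@le_lt_trans _ _ (b^-1)%:E); last exact: ltry.
apply: lime_le; first by apply/cvg_ex; eexists; exact: C.
exact: nearW.
Qed.

(** Up to [1] the density is bounded by its peak and the power is integrable; beyond [1] the power
    is at most [1], because [b <= 1], and the density is integrable. *)
Lemma integrable_normal_powR (b : R) : 0 < b <= 1 ->
  N.-integrable Rpos (fun z => (z `^ (b - 1))%:E).
Proof.
move=> /andP[b0 b1].
have mp D : measurable_fun D (fun z : R => z `^ (b - 1)) by exact: (measurable_funTS (measurable_powR _)).
apply/integrableP; split; first by apply/measurable_EFinP; exact: mp.
under eq_integral do rewrite gee0_abs ?lee_fin ?powR_ge0//.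
rewrite ge0_integral_normal_prob//; last by move=> z; exact: powR_ge0.
have mpp D : measurable_fun D (fun z : R => (z `^ (b - 1) * phi z)%:E).
  by apply/measurable_EFinP; apply: measurable_funM => //; apply: measurable_funTS; exact: measurable_normal_pdf.
have mphi D : measurable_fun D phi by apply: measurable_funTS; exact: measurable_normal_pdf.
have -> : Rpos = `]0, 1] `|` `]1, +oo[.
  apply/seteqP; split => z /=; rewrite !in_itv/= !andbT.
    by move=> z0; case: (lerP z 1) => z1; [left; rewrite z0|right].
  by case=> [/andP[]//|]; exact: lt_trans.
rewrite ge0_integral_setU//; first last.
- apply/disj_set2P; rewrite -subset0 => z [] /=; rewrite !in_itv/= andbT => /andP[_ z1].
  by rewrite ltNge z1.
- by move=> z _; rewrite lee_fin mulr_ge0 ?powR_ge0// normal_pdf_ge0.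
- exact: mpp.
apply: lte_add_pinfty.
  have /integrableP[_] : mu.-integrable `]0, 1] (fun z : R => ((normal_peak 1)%:E * (z `^ (b - 1))%:E)%E).
    by apply: integrableZl => //; exact: integrable_powR01.
  apply: le_lt_trans; apply: ge0_le_integral => //.
  - by move=> z _; rewrite lee_fin mulr_ge0 ?powR_ge0// normal_pdf_ge0.
  - exact: mpp.
  - by apply: measurableT_comp => //; apply/measurable_EFinP; apply: measurable_funM => //; exact: mp.
  - move=> z _; rewrite /= lee_fin ger0_norm ?mulr_ge0 ?powR_ge0 ?normal_peak_ge0//.
    by rewrite mulrC ler_wpM2r ?powR_ge0// normal_pdf_ub// oner_eq0.
apply: (@le_lt_trans _ _ (\int[mu]_x (phi x)%:E)%E); last by rewrite integral_normal_pdf ltry.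
apply: (@le_trans _ _ (\int[mu]_(x in `]1%R, +oo[) (phi x)%:E)%E).
  apply: ge0_le_integral => //.
  - by move=> z _; rewrite lee_fin mulr_ge0 ?powR_ge0// normal_pdf_ge0.
  - exact: mpp.
  - by apply/measurable_EFinP; exact: mphi.
  - move=> z /=; rewrite in_itv/= andbT => z1; rewrite lee_fin ler_piMl ?normal_pdf_ge0//.
    have z0 := lt_trans ltr01 z1.
    rewrite /powR gt_eqF// -[leRHS]expR0 ler_expR; apply: mulr_le0_ge0; first by rewrite subr_le0.
    by apply: ln_ge0; exact: ltW.
apply: ge0_subset_integral => //.
- by apply/measurable_EFinP; exact: mphi.
- by move=> z _; rewrite lee_fin normal_pdf_ge0.
Qed.

End standard_normal_calculus.

(** * Borel sets of Euclidean space *)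

Lemma law_setT {d d' : measure_display} {T : measurableType d} {U : measurableType d'}
    {R : realType} (P : probability T R) (phi : T -> U)
    (mphi : measurable_fun setT phi) : law P mphi setT = 1%E.
Proof. exact: (probability_setT P). Qed.

Section euclidean_borel.
Context {R : realType} {d : nat}.

(** A copy of the space whose measurable sets are exactly those of [Rd_borel], so that measure
    theory applies to [Rd_mfun]. *)
Definition borelRd := g_sigma_algebraType [set U : set 'rV[R]_d | open U].

Definition box (A : 'I_d -> set R) : set 'rV[R]_d := [set v | forall i, A i (v 0 i)].

Lemma Rd_mfunP (g : 'rV[R]_d -> R) :
  Rd_mfun g <-> measurable_fun [set: borelRd] (g : borelRd -> R).
Proof.
split=> [mg _ A mA|mg A mA]; first by rewrite setTI; exact: mg.
by have := mg measurableT A mA; rewrite setTI.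
Qed.

Lemma continuous_Rd_mfun (g : 'rV[R]_d -> R) : continuous g -> Rd_mfun g.
Proof.
move=> /continuousP cg; apply/Rd_mfunP; apply: (measurability _ (RGenOpens.measurableE R)).
move=> _ [_ [a [b ->] <-]]; rewrite setTI; apply: sub_sigma_algebra => /=.
exact/cg/interval_open.
Qed.

(** Rational centres and radii [1 / (n + 1)] form a countable family of cubes. Countability is the
    point: it turns coordinatewise measurability into Borel measurability. *)
Lemma open_bigcup_box (U : set 'rV[R]_d) : open U ->
  U = \bigcup_(q in [set q : {ffun 'I_d -> rat} * nat |
        box (fun i => ball (ratr (q.1 i) : R) q.2.+1%:R^-1) `<=` U])
      box (fun i => ball (ratr (q.1 i) : R) q.2.+1%:R^-1).
Proof.
move=> oU; apply/seteqP; split => [v Uv|v [q /= qU qv]]; last exact: qU.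
have [e /= e0 eU] : nbhs_ball v U by apply/nbhs_ballP; move: oU => /(_ v Uv).
(* The distance from [v] to a point of the cube is bounded through the centre, hence by twice the
   radius. *)
pose n := Num.truncn (2 / e).
have ne : 2 * n.+1%:R^-1 < e.
  rewrite ltr_pdivrMr// mulrC -ltr_pdivrMr//; exact: truncnS_gt.
have n0 : 0 < n.+1%:R^-1 :> R by rewrite invr_gt0.
set h : R := n.+1%:R^-1 in n0 ne *.
have ex i : exists q : rat, ball (ratr q : R) h (v 0 i).
  have := @rat_in_itvoo R (v 0 i - h) (v 0 i + h).
  case; first by lra.
  move=> q; by rewrite in_itv/= => /andP[q1 q2]; exists q; rewrite /ball/= ltr_distl; apply/andP; split; lra.
have [q qv] := choice ex.
exists ([ffun i => q i], n); last by move=> i /=; rewrite ffunE; exact: qv.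
move=> y yq; apply: eU; split => // i j; rewrite ord1.
have := yq j; have := qv j; rewrite /= ffunE /ball/= !ltr_distl => /andP[a1 a2] /andP[b1 b2].
by rewrite -/h in b1 b2; apply/andP; split; lra.
Qed.

(** An open set is a countable union of boxes, and the preimage of a box is a finite intersection of
    coordinate events. *)
Lemma measurable_fun_borelRd {d0 : measure_display} {T : measurableType d0}
    (Y : T -> 'rV[R]_d) : (forall i, measurable_fun setT (fun w => Y w 0 i)) ->
  measurable_fun setT (Y : T -> borelRd).
Proof.
move=> mY; apply: (@measurability _ _ T borelRd setT Y [set U : set 'rV[R]_d | open U]) => //.
move=> _ [U oU <-]; rewrite setTI (open_bigcup_box oU) preimage_bigcup.
rewrite bigcup_mkcond; apply: countable_bigcupT_measurable => // q; case: ifPn => // _.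
rewrite (_ : _ @^-1` _ = \bigcap_(i in [set: 'I_d])
   ((fun w => Y w 0 i) @^-1` ball (ratr (q.1 i) : R) q.2.+1%:R^-1)); last first.
  by apply/seteqP; split => w /= H i; [move=> _|]; exact: H.
apply: fin_bigcap_measurable => // i _; rewrite -[X in measurable X]setTI.
by apply: mY => //; exact: measurable_ball.
Qed.

Lemma measurable_box (A : 'I_d -> set R) : (forall i, measurable (A i)) ->
  @measurable _ borelRd (box A).
Proof.
move=> mA; rewrite (_ : box A = \bigcap_(i in [set: 'I_d]) ((fun v : 'rV[R]_d => v 0 i) @^-1` A i)).
  apply: fin_bigcap_measurable => // i _.
  apply: (@continuous_Rd_mfun (fun v : 'rV[R]_d => v 0 i)) => //; exact: coord_continuous.
by apply/seteqP; split => w /= H i; [move=> _|]; exact: H.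
Qed.

(** Boxes with Borel sides form a pi-system. They generate the Borel sets because the identity, from
    the sigma-algebra of boxes to the Borel one, has measurable coordinates. *)
Lemma borelRd_measure_unique (m1 m2 : {measure set borelRd -> \bar R}) :
  (m1 setT < +oo)%E ->
  (forall A, (forall i, measurable (A i)) -> m1 (box A) = m2 (box A)) ->
  forall C, measurable C -> m1 C = m2 C.
Proof.
move=> m1T m12 C mC.
pose G : set (set borelRd) := [set box A | A in [set A | forall i, measurable (A i)]].
apply: (@g_sigma_algebra_measure_unique _ R borelRd G _ (fun=> setT)) => //.
- by move=> _ [A mA <-]; exact: measurable_box.
- by move=> _; exists (fun=> setT) => //; apply/seteqP; split.
- by rewrite bigcup_const.
- move=> _ _ [A mA <-] [B mB <-]; exists (fun i => A i `&` B i); first by move=> i; exact: measurableI.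
  by apply/seteqP; split => [v /= H|v /= [H1 H2] i]; [split => i; have [] := H i|split].
- by move=> _ [A mA <-]; exact: m12.
have : @measurable_fun _ _ (g_sigma_algebraType G) borelRd setT idfun.
  apply: measurable_fun_borelRd => i _ B mB; rewrite setTI; apply: sub_sigma_algebra.
  exists (fun j => if j == i then B else setT); first by move=> j; case: ifP.
  apply/seteqP; split => v /=.
    by move=> /(_ i); rewrite eqxx.
  by move=> Bv j; case: ifPn => // /eqP ->.
by move=> /(_ measurableT C mC); rewrite setTI.
Qed.

Lemma integral_same_law {d1 d2 : measure_display} {T1 : measurableType d1} {T2 : measurableType d2}
    (P1 : probability T1 R) (P2 : probability T2 R) (Y1 : T1 -> 'rV[R]_d) (Y2 : T2 -> 'rV[R]_d)
    (g : 'rV[R]_d -> R) :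
  (forall i, measurable_fun setT (fun w => Y1 w 0 i)) ->
  (forall i, measurable_fun setT (fun w => Y2 w 0 i)) ->
  (forall A, (forall i, measurable (A i)) -> P1 (Y1 @^-1` box A) = P2 (Y2 @^-1` box A)) ->
  Rd_mfun g -> \int[P1]_w g (Y1 w) = \int[P2]_w g (Y2 w).
Proof.
move=> /measurable_fun_borelRd mY1 /measurable_fun_borelRd mY2 H /Rd_mfunP mg.
rewrite -(Rintegral_law P1 mY1 mg) -(Rintegral_law P2 mY2 mg).
congr fine; apply: eq_measure_integral => C mC _.
apply: borelRd_measure_unique => //.
by rewrite law_setT ltry.
Qed.

(** Independence is assumed on boxes only. The image under [Y] of [P] restricted to [E] and the law
    of [Y] scaled by [P E] are finite measures that agree on boxes, hence everywhere. *)
Lemma integral_indep {d0 : measure_display} {T : measurableType d0} (P : probability T R)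
    (E : set T) (Y : T -> 'rV[R]_d) (g : 'rV[R]_d -> R) :
  measurable E -> (forall i, measurable_fun setT (fun w => Y w 0 i)) ->
  (forall A, (forall i, measurable (A i)) ->
     P (E `&` Y @^-1` box A) = (P E * P (Y @^-1` box A))%E) ->
  bddf g -> Rd_mfun g -> \int[P]_(w in E) g (Y w) = fine (P E) * \int[P]_w g (Y w).
Proof.
move=> mE /measurable_fun_borelRd mY H [M gM] /Rd_mfunP mg.
have mgY : measurable_fun setT (fun w => g (Y w)) by exact: (measurableT_comp mg mY).
pose PE : {measure set T -> \bar R} := mrestr P mE.
have PEE : (fine (P E))%:E = P E by rewrite fineK// fin_num_measure.
have p0 : 0 <= fine (P E) by exact: fine_ge0.
have iPE : PE.-integrable setT (fun w => (g (Y w))%:E).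
  apply: measurable_bounded_integrable => //.
    by rewrite /PE /= /mrestr setTI -PEE ltry.
  exists M; split; first by rewrite num_real.
  by move=> x Mx w _; rewrite /= (le_trans (gM _))// ltW.
transitivity (\int[PE]_w g (Y w)).
  rewrite /Rintegral; congr fine.
  rewrite [RHS](@negligible_integral _ _ _ _ _ (~` E))//; last 2 first.
  - exact: measurableC.
  - by rewrite /PE /= /mrestr setICl measure0.
  rewrite setTD setCK; apply: eq_measure_integral => A mA AE.
  by rewrite /PE/= /mrestr setIidl.
rewrite -(Rintegral_law PE mY mg).
pose m2 : {measure set borelRd -> \bar R} := mscale (NngNum p0) (law P mY).
transitivity (\int[m2]_v g v).
  congr fine; apply: eq_measure_integral => C mC _.
  apply: borelRd_measure_unique => //.
    by rewrite lawE preimage_setT /PE /= /mrestr setTI -PEE ltry.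
  by move=> A mA; rewrite lawE /PE /= /mrestr setIC H// /mscale /= PEE.
rewrite -(Rintegral_law P mY mg).
have il : (law P mY).-integrable setT (EFin \o g).
  apply: measurable_bounded_integrable => //.
    by rewrite law_setT ltry.
  exists M; split; first by rewrite num_real.
  by move=> x Mx w _; rewrite /= (le_trans (gM _))// ltW.
rewrite /Rintegral -[fine (P E)]/(fine (fine (P E))%:E) -fineM//; last exact: integrable_fin_num.
congr fine; rewrite [LHS]integralE [in RHS]integralE muleBr//; last first.
  by rewrite fin_num_adde_defr// (integrable_pos_fin_num measurableT il).
congr (_ - _)%E; rewrite (ge0_integral_mscale (law P mY) measurableT (NngNum p0))//.
  exact/measurable_funepos/measurable_EFinP.
exact/measurable_funeneg/measurable_EFinP.
Qed.

End euclidean_borel.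

(** * Markov semigroups *)

Lemma measurable_fun_glue {d d' : measure_display} {T : measurableType d}
    {U : measurableType d'} {I : countType} (D : T -> I) (F : I -> T -> U) :
  (forall i, measurable [set w | D w = i]) -> (forall i, measurable_fun setT (F i)) ->
  measurable_fun setT (fun w => F (D w) w).
Proof.
move=> mD mF _ A mA; rewrite setTI.
rewrite (_ : _ @^-1` _ = \bigcup_i ([set w | D w = i] `&` F i @^-1` A)).
  apply: countable_bigcupT_measurable => // i; apply: measurableI => //.
  by rewrite -[X in measurable X]setTI; exact: mF.
by apply/seteqP; split => [w /= Aw|w [i _ [/= <-]]//]; exists (D w).
Qed.

Lemma measurable_level_floor {R : realType} (c : R) (k : int) :
  measurable [set z : measurableTypeR R | Num.floor (c * z) = k].
Proof.
rewrite (_ : [set z | _] = ( *%R c) @^-1` `[k%:~R, (k + 1)%:~R[%classic).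
  by rewrite -[X in measurable X]setTI; exact: mulrl_measurable.
by apply/seteqP; split => z /=; rewrite in_itv/= -floor_eq => /eqP.
Qed.

Lemma cvg_floor_div {R : realType} (z : R) :
  (Num.floor (n.+1%:R * z))%:~R / n.+1%:R @[n --> \oo] --> z.
Proof.
apply/cvgrPdist_le => e e0; near=> n.
have n0 : 0 < n.+1%:R :> R by [].
have /andP[f1 f2] := floor_itv (n.+1%:R * z).
rewrite (_ : z - _ = (n.+1%:R * z - (Num.floor (n.+1%:R * z))%:~R) / n.+1%:R); last first.
  by field; rewrite gt_eqF.
rewrite normrM [X in _ * X]ger0_norm ?invr_ge0// ger0_norm ?subr_ge0//.
apply: (@le_trans _ _ (1 * n.+1%:R^-1)).
  by rewrite ler_wpM2r// lerBlDr addrC ltW// -[1]/(1%:~R) -intrD.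
rewrite mul1r; near: n; have := @cvg_harmonic R => /cvgrPdist_le/(_ _ e0).
by apply: filterS => n; rewrite sub0r normrN /harmonic ger0_norm ?invr_ge0.
Unshelve. all: by end_near. Qed.

(** With [z] rounded down to multiples of [1 / (n + 1)] the function is glued from countably many
    measurable pieces; continuity in [z] makes it the pointwise limit of these. *)
Lemma measurable_fun_caratheodory {d : measure_display} {T : measurableType d} {R : realType}
    (G : T -> R -> R) :
  (forall z, measurable_fun setT (G ^~ z)) -> (forall w, continuous (G w)) ->
  measurable_fun [set: T * measurableTypeR R] (fun p => G p.1 p.2).
Proof.
move=> mG cG.
pose F n (p : T * measurableTypeR R) := G p.1 ((Num.floor (n.+1%:R * p.2))%:~R / n.+1%:R).
apply: (@measurable_fun_cvg _ _ _ _ F); last first.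
  move=> p _; apply: (@cvg_comp _ _ _ _ (G p.1) _ (nbhs (p.2 : R))); last exact: cG.
  exact: cvg_floor_div.
move=> n.
pose D (p : T * measurableTypeR R) := Num.floor (n.+1%:R * p.2).
apply: (@measurable_fun_glue _ _ _ _ _ D (fun k p => G p.1 (k%:~R / n.+1%:R))) => k.
  rewrite (_ : [set p | _] = snd @^-1` [set z | Num.floor (n.+1%:R * z) = k])//.
  by rewrite -[X in measurable X]setTI; apply: measurable_snd => //; exact: measurable_level_floor.
by apply: (measurableT_comp (mG _)); exact: measurable_fst.
Qed.

Lemma Rintegral_probability_cst {d : measure_display} {T : measurableType d} {R : realType}
  (P : probability T R) (c : R) : \int[P]_w c = c.
Proof. by rewrite Rintegral_cst// [X in fine X](probability_setT P) mulr1. Qed.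

Section fubini_dominated.
Context {d1 d2 : measure_display} {T : measurableType d1} {U : measurableType d2} {R : realType}.
Variables (P : probability T R) (Q : probability U R).

(** The dominating function depends on the second variable alone and [P] has mass one, which gives
    integrability on the product. The domain [D] is absorbed by extending [F] by zero. *)
Lemma Rintegral_fubini_dominated (F : T -> U -> R) (b : U -> R) (D : set U) :
  measurable D -> measurable_fun setT (fun p => F p.1 p.2) ->
  Q.-integrable D (EFin \o b) -> (forall w z, D z -> `|F w z| <= b z) ->
  measurable_fun setT (fun w => \int[Q]_(z in D) F w z) /\
  \int[P]_w \int[Q]_(z in D) F w z = \int[Q]_(z in D) \int[P]_w F w z.
Proof.
move=> mD mF ib Fb.
have mFw w : measurable_fun setT (F w).
  rewrite (_ : F w = (fun p => F p.1 p.2) \o pair w)//.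
  by apply: (measurableT_comp mF); exact: measurable_pair1.
pose F' p := (F p.1 \_ D) p.2.
have mF' : measurable_fun setT (EFin \o F').
  apply/measurable_EFinP; rewrite (_ : F' = ((fun p => F p.1 p.2) \_ (snd @^-1` D))).
    apply/(measurable_restrictT _ _).1; last exact: measurable_funTS.
    by rewrite -[X in measurable X]setTI; exact: measurable_snd.
  by apply/funext => p; rewrite /F' !patchE; congr (if _ then _ else _).
have bD : Q.-integrable setT (EFin \o (b \_ D)).
  by rewrite -restrict_EFin; exact/(integrable_mkcond _ mD).1.
have b0 z : D z -> 0 <= b z by move=> Dz; apply: le_trans (Fb point z Dz).
have F'b w z : `|F' (w, z)| <= (b \_ D) z.
  by rewrite /F' !patchE /=; case: ifPn => [/set_mem /Fb //|_]; rewrite normr0.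
have iF' : (P \x Q)%E.-integrable setT (EFin \o F').
  apply/integrable12ltyP => //.
  apply: (@le_lt_trans _ _ (\int[P]_x \int[Q]_z ((b \_ D) z)%:E)%E).
    apply: ge0_le_integral => //.
    - by move=> w _; apply: integral_ge0 => z _.
    - apply: (measurable_fun_fubini_tonelli_F (abse \o (EFin \o F'))) => //.
        by apply: measurableT_comp; [exact: abse_measurable|exact: mF'].
      by move=> p; exact: abse_ge0.
    - move=> w _; apply: ge0_le_integral => //.
      + rewrite (_ : (fun _ => _) = (abse \o (EFin \o F')) \o pair w)//.
        apply: measurableT_comp; last exact: measurable_pair1.
        exact: measurableT_comp.
      + exact: measurable_int bD.
      + by move=> z _; rewrite lee_fin.
  rewrite integral_cst// [X in (_ * X)%E](probability_setT P) mule1.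
  move: (bD) => /integrableP[_]; apply: le_lt_trans; apply: ge0_le_integral => //.
  - by move=> z _; rewrite lee_fin patchE; case: ifPn => // /set_mem; exact: b0.
  - exact: measurable_int bD.
  - by apply: measurableT_comp => //; exact: measurable_int bD.
  - by move=> z _; rewrite lee_fin ler_norm.
have E w : \int[Q]_(z in D) F w z = fine (fubini_F Q (EFin \o F') w) by rewrite Rintegral_mkcond.
split.
  rewrite (funext E); apply: (measurableT_comp (fine_measurable measurableT)).
  exact: (measurable_fubini_F iF').
have iw w : Q.-integrable setT (fun z => (F' (w, z))%:E).
  apply: le_integrable bD => //.
    rewrite (_ : (fun _ => _) = (EFin \o F') \o pair w)//.
    by apply: (measurableT_comp mF'); exact: measurable_pair1.
  by move=> z _; rewrite /= lee_fin (le_trans (F'b w z))// ler_norm.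
transitivity (fine (\int[P]_w \int[Q]_z (F' (w, z))%:E)%E).
  congr fine; apply: eq_integral => w _; rewrite E fineK//.
  exact: (integrable_fin_num _ (iw w)).
rewrite (Fubini iF') Rintegral_mkcond; congr fine; apply: eq_integral => z _.
rewrite patchE /F' /=; case: ifPn => [|] zD.
  transitivity (\int[P]_x (F x z)%:E)%E; first by apply: eq_integral => x _; rewrite patchE zD.
  rewrite fineK//; apply: (@integrable_fin_num _ _ _ P) => //.
  apply: (@bounded_integrable _ _ _ _ _ _ (b z)) => //.
    rewrite (_ : (fun _ => _) = (fun p => F p.1 p.2) \o (fun w => (w, z)))//.
    by apply: (measurableT_comp mF); exact: measurable_pair2.
  by move=> w; apply: Fb; exact: set_mem.
by rewrite integral0_eq// => x _; rewrite patchE (negPf zD).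
Qed.

End fubini_dominated.

(** * Elementary properties of the transition semigroup *)

Section markov_semigroup.
Context {d0 : measure_display} {Om : measurableType d0} {R : realType} {d : nat}.
Variables (P : probability Om R) (X : 'rV[R]_d -> R -> Om -> 'rV[R]_d).
Hypothesis MX : markov_family P X.
Notation T := (semig P X).

Lemma measurable_markov (x : 'rV[R]_d) (s : R) : measurable_fun setT (X x s : Om -> borelRd).
Proof. by apply: measurable_fun_borelRd => i; have [_ _ m _ _] := MX; exact: m. Qed.

Lemma measurable_markov_comp (g : 'rV[R]_d -> R) (x : 'rV[R]_d) (s : R) : Rd_mfun g ->
  measurable_fun setT (fun w => g (X x s w)).
Proof. by move=> /Rd_mfunP mg; exact: (measurableT_comp mg (measurable_markov x s)). Qed.

Lemma integrable_markov (g : 'rV[R]_d -> R) (x : 'rV[R]_d) (s : R) : bddf g -> Rd_mfun g ->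
  P.-integrable setT (EFin \o (fun w => g (X x s w))).
Proof.
move=> [M gM] mg; apply: (@bounded_integrable _ _ _ _ _ _ M) => //.
exact: measurable_markov_comp.
Qed.

Lemma semig_bound (g : 'rV[R]_d -> R) (M : R) (s : R) (x : 'rV[R]_d) : Rd_mfun g ->
  (forall y, `|g y| <= M) -> `|T s g x| <= M.
Proof.
move=> mg gM.
have [_ ] := @le_normr_Rintegral_dominated _ _ _ P setT (fun w => g (X x s w)) (cst M)
  measurableT (measurable_markov_comp x s mg)
  (finite_measure_integrable_cst _ _ measurableT) (fun w _ => gM _).
by rewrite Rintegral_probability_cst.
Qed.

Lemma semigB (g h : 'rV[R]_d -> R) (s : R) (x : 'rV[R]_d) :
  bddf g -> Rd_mfun g -> bddf h -> Rd_mfun h ->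
  T s (fun y => g y - h y) x = T s g x - T s h x.
Proof. by move=> bg mg bh mh; apply: RintegralB => //; exact: integrable_markov. Qed.

Lemma semigD (g h : 'rV[R]_d -> R) (s : R) (x : 'rV[R]_d) :
  bddf g -> Rd_mfun g -> bddf h -> Rd_mfun h ->
  T s (fun y => g y + h y) x = T s g x + T s h x.
Proof. by move=> bg mg bh mh; apply: RintegralD => //; exact: integrable_markov. Qed.

Lemma semigZ (g : 'rV[R]_d -> R) (c s : R) (x : 'rV[R]_d) :
  bddf g -> Rd_mfun g -> T s (fun y => c * g y) x = c * T s g x.
Proof. by move=> bg mg; apply: RintegralZl => //; exact: integrable_markov. Qed.

Lemma semig0 (g : 'rV[R]_d -> R) (x : 'rV[R]_d) : T 0 g x = g x.
Proof.
have [X0 _ _ _ _] := MX; rewrite -[RHS](Rintegral_probability_cst P).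
by apply: eq_Rintegral => w _; rewrite X0.
Qed.

Lemma semig_bddf (g : 'rV[R]_d -> R) (s : R) : bddf g -> Rd_mfun g -> bddf (T s g).
Proof. by move=> [M gM] mg; exists M => x; exact: semig_bound. Qed.

Lemma semig_mfun (g : 'rV[R]_d -> R) (s : R) : 0 <= s -> bddf g -> Rd_mfun g -> Rd_mfun (T s g).
Proof. by have [_ _ _ H _] := MX; exact: H. Qed.

Lemma cst_Rd_mfun (c : R) : Rd_mfun (fun _ : 'rV[R]_d => c).
Proof. by apply/Rd_mfunP; exact: measurable_cst. Qed.

(** Chapman-Kolmogorov: the Markov property for two successive times, with the constant [1] as test
    function at the first. *)
Lemma semig_comp (g : 'rV[R]_d -> R) (s h : R) (x : 'rV[R]_d) : 0 <= s -> 0 <= h ->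
  bddf g -> Rd_mfun g -> T (s + h) g x = T s (T h g) x.
Proof.
move=> s0 h0 bg mg; have [_ _ _ _ H] := MX.
have E : Ex P (prod_along X x [:: (s, fun=> 1); (h, g)] 0) = T (s + h) g x.
  by apply: eq_Rintegral => w _; rewrite /= add0r mul1r mulr1.
rewrite -E H; first apply: eq_Rintegral => w _.
  by rewrite mul1r; apply: eq_Rintegral => w' _; rewrite mulr1.
move=> p; rewrite !inE => /orP[] /eqP -> //=.
by split => //; [exists 1 => y; rewrite normr1|exact: cst_Rd_mfun].
Qed.

End markov_semigroup.

Lemma is_derive_eps {R : realType} (F : R -> R) (s l : R) :
  (forall e : R, 0 < e -> exists2 del : R, 0 < del &
     forall r : R, r != 0 -> `|r| < del -> `|(F (r + s) - F s) / r - l| <= e) ->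
  is_derive s 1 F l.
Proof.
move=> H.
have C : h^-1 *: ((F \o shift s) (h *: (1 : R)) - F s) @[h --> 0^'] --> l.
  apply/cvgrPdist_le => e e0; have [del del0 Hd] := H e e0.
  exists del => //= h /=; rewrite sub0r normrN => hd h0.
  by rewrite distrC [h *: 1]mulr1 [_ *: _]mulrC; exact: Hd.
by apply: DeriveDef; [apply/cvg_ex; exists l|exact: (cvg_lim _ C)].
Qed.

(** Paths and semigroups are controlled at nonnegative times only; composition with [Num.max 0]
    extends them continuously to the whole line. *)
Lemma max0_lipschitz {R : realType} (s r : R) :
  `|Num.max 0 s - Num.max 0 r| <= `|s - r|.
Proof.
have := ler_norm (s - r); have := ler_norm (r - s); rewrite (distrC r s) => A B.
rewrite ler_norml; apply/andP.
by case: (leP 0 s) => a; case: (leP 0 r) => b; split; lra.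
Qed.

(** * Norm continuity in time and the generator *)

Section strongly_continuous_semigroup.
Context {d0 : measure_display} {Om : measurableType d0} {R : realType} {d : nat}.
Variables (P : probability Om R) (X : 'rV[R]_d -> R -> Om -> 'rV[R]_d).
Hypothesis MX : markov_family P X.
Notation T := (semig P X).

(** Continuity at time [0] in the sup norm, stated function by function because it can fail for a
    general bounded Borel function. *)
Definition strongly_cont (g : 'rV[R]_d -> R) : Prop :=
  [/\ bddf g, Rd_mfun g & forall e : R, 0 < e -> exists2 del : R, 0 < del &
    forall h : R, 0 < h < del -> forall x, `|T h g x - g x| <= e].

Lemma bddfB (g h : 'rV[R]_d -> R) : bddf g -> bddf h -> bddf (fun y => g y - h y).
Proof.
by move=> [M gM] [K hK]; exists (M + K) => x; rewrite (le_trans (ler_normB _ _))// lerD.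
Qed.

Lemma bddfZ (c : R) (g : 'rV[R]_d -> R) : bddf g -> bddf (fun y => c * g y).
Proof. by move=> [M gM]; exists (`|c| * M) => x; rewrite normrM ler_wpM2l. Qed.

Lemma Rd_mfunB (g h : 'rV[R]_d -> R) : Rd_mfun g -> Rd_mfun h -> Rd_mfun (fun y => g y - h y).
Proof. by move=> /Rd_mfunP mg /Rd_mfunP mh; apply/Rd_mfunP; exact: measurable_funB. Qed.

Lemma Rd_mfunD (g h : 'rV[R]_d -> R) : Rd_mfun g -> Rd_mfun h -> Rd_mfun (fun y => g y + h y).
Proof. by move=> /Rd_mfunP mg /Rd_mfunP mh; apply/Rd_mfunP; exact: measurable_funD. Qed.

Lemma Rd_mfunZ (c : R) (g : 'rV[R]_d -> R) : Rd_mfun g -> Rd_mfun (fun y => c * g y).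
Proof. by move=> /Rd_mfunP mg; apply/Rd_mfunP; exact: measurable_funM. Qed.

(** For small [s] the difference quotient is within [1] of [h], so [T s g - g] is at most
    [(M + 1) * s] uniformly. *)
Lemma gen_strongly_cont (g h : 'rV[R]_d -> R) : gen P X g h -> strongly_cont g.
Proof.
move=> [bg mg [M hM] mh H]; split => // e e0.
have [del del0 Hd] := H 1 ltr01.
have M0 : 0 <= M by exact: le_trans (hM 0).
exists (Num.min del (e / (M + 1))).
  by rewrite lt_min del0 divr_gt0// ltr_wpDl.
move=> s /andP[s0]; rewrite lt_min => /andP[sd se] x.
have := Hd s; rewrite s0 sd => /(_ isT x) H1.
have -> : T s g x - g x = ((T s g x - g x) / s - h x + h x) * s by field; rewrite gt_eqF.
rewrite normrM (gtr0_norm s0); apply: (@le_trans _ _ ((M + 1) * s)).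
  rewrite ler_wpM2r ?(ltW s0)// addrC (le_trans (ler_normD _ _))// lerD//.
  exact: ltW.
by rewrite mulrC -ler_pdivlMr ?ltW// ltr_wpDl.
Qed.

Lemma semig_diff_bound (g h : 'rV[R]_d -> R) (e s : R) (x : 'rV[R]_d) :
  bddf g -> Rd_mfun g -> bddf h -> Rd_mfun h ->
  (forall y, `|g y - h y| <= e) -> `|T s g x - T s h x| <= e.
Proof.
by move=> bg mg bh mh gh; rewrite -semigB//; apply: semig_bound => //; exact: Rd_mfunB.
Qed.

(** [h] is a uniform limit of difference quotients of [g]. Each quotient inherits norm continuity
    from [g], and contractivity of the semigroup transfers it to the limit. *)
Lemma gen_image_strongly_cont (g h : 'rV[R]_d -> R) : gen P X g h -> strongly_cont h.
Proof.
move=> G; have [bg mg bh mh H] := G; split => // e e0.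
have e30 : 0 < e / 3 by rewrite divr_gt0.
have [s0 s00 Hs] := H _ e30.
have s20 : 0 < s0 / 2 by rewrite divr_gt0.
have ss : 0 < s0 / 2 < s0 by rewrite s20/= ltr_pdivrMr// ltr_pMr// ltr1n.
set s := s0 / 2 in s20 ss.
have [_ _ Hg] := gen_strongly_cont G.
(* Two errors of size [e * s / 6], divided by the step [s], add up to [e / 3]. *)
have [del del0 Hd] := Hg (e * s / 6) ltac:(by rewrite divr_gt0// mulr_gt0).
exists del => // k kd x; have k0 : 0 <= k by case/andP: kd => /ltW.
pose p y := (T s g y - g y) / s.
have bT : bddf (T s g) by exact: semig_bddf.
have mT : Rd_mfun (T s g) by apply: semig_mfun => //; exact: ltW.
have bTk : bddf (T k g) by exact: semig_bddf.
have mTk : Rd_mfun (T k g) by exact: semig_mfun.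
have pE : p = (fun y => s^-1 * (T s g y - g y)) by apply/funext => y; rewrite mulrC.
have bp : bddf p by rewrite pE; apply: bddfZ; exact: bddfB.
have mp : Rd_mfun p by rewrite pE; apply: Rd_mfunZ; exact: Rd_mfunB.
have ph y : `|p y - h y| <= e / 3 by apply: ltW; exact: Hs.
have A1 : `|T k h x - T k p x| <= e / 3.
  by apply: semig_diff_bound => // y; rewrite distrC.
have A2 : `|T k p x - p x| <= e / 3.
  rewrite pE semigZ//; [|exact: bddfB|exact: Rd_mfunB].
  rewrite semigB// -semig_comp// ?(ltW s20)// (addrC k) semig_comp// ?(ltW s20)//.
  have B1 : `|T s (T k g) x - T s g x| <= e * s / 6 by apply: semig_diff_bound => //; exact: Hd.
  have B2 := Hd _ kd x.
  rewrite (_ : _ - _ = s^-1 * ((T s (T k g) x - T s g x) - (T k g x - g x))); last by ring.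
  rewrite normrM gtr0_norm ?invr_gt0// mulrC ler_pdivrMr//.
  apply: (le_trans (ler_normB _ _)); lra.
have := ph x.
rewrite (_ : T k h x - h x = (T k h x - T k p x) + (T k p x - p x) + (p x - h x)); last by ring.
move=> A3; apply: (le_trans (ler_normD _ _)).
have := ler_normD (T k h x - T k p x) (T k p x - p x); lra.
Qed.

(** By contractivity, two times at distance [k] differ no more than times [0] and [k]. *)
Lemma semig_unif_cont (g : 'rV[R]_d -> R) : strongly_cont g -> forall e : R, 0 < e ->
  exists2 del : R, 0 < del & forall s s' : R, 0 <= s -> 0 <= s' -> `|s - s'| < del ->
    forall x, `|T s g x - T s' g x| <= e.
Proof.
move=> [bg mg H] e e0; have [del del0 Hd] := H e e0; exists del => //.
move=> s s'; wlog ss : s s' / s < s' => [W s0 s'0 ssd x|].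
  case: (ltgtP s s') => ss; [exact: W| |by rewrite ss subrr normr0 ltW].
  by rewrite distrC; apply: W => //; rewrite distrC.
move=> s0 s'0 ssd x.
have k0 : 0 < s' - s by rewrite subr_gt0.
rewrite distrC -{1}(subrK s s') (addrC _ s) semig_comp ?(ltW k0)//.
apply: semig_diff_bound => //; [exact: semig_bddf|by apply: semig_mfun => //; exact: ltW|].
by apply: Hd; rewrite k0/=; move: ssd; rewrite distrC gtr0_norm.
Qed.

Lemma semig_continuous (g : 'rV[R]_d -> R) (x : 'rV[R]_d) : strongly_cont g ->
  continuous (fun s : R => T (Num.max 0 s) g x).
Proof.
move=> sg s; apply/cvgrPdist_le => e e0; have [del del0 Hd] := semig_unif_cont sg e0.
exists del => //= r; rewrite /ball/= => rd; apply: Hd; rewrite ?le_max ?lexx//.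
apply: le_lt_trans rd.
exact: max0_lipschitz.
Qed.

(** A right quotient at time [s] is [T s] applied to a quotient at time [0], so contractivity
    settles it. A left quotient is a right quotient taken at the earlier time, whose limit is
    compared with the one at [s] by uniform continuity of [T h]. *)
Lemma gen_is_derive (g h : 'rV[R]_d -> R) (x : 'rV[R]_d) (s : R) : gen P X g h -> 0 < s ->
  is_derive s 1 (fun r => T r g x) (T s h x).
Proof.
move=> G s0; have [bg mg bh mh H] := G.
apply: is_derive_eps => e e0; have e20 : 0 < e / 2 by rewrite divr_gt0.
have [d1 d10 H1] := H _ e20.
have [d2 d20 H2] := semig_unif_cont (gen_image_strongly_cont G) e20.
have quot (k r : R) y : 0 < k -> 0 <= r -> `|(T (r + k) g y - T r g y) / k - T r h y| <= e / 2 \/ d1 <= k.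
  move=> k0 r0; case: (ltP k d1) => kd; [left|by right].
  have bTk : bddf (T k g) by exact: semig_bddf.
  have mTk : Rd_mfun (T k g) by apply: semig_mfun => //; exact: ltW.
  rewrite semig_comp// ?(ltW k0)// -semigB// mulrC -semigZ//; [|exact: bddfB|exact: Rd_mfunB].
  apply: semig_diff_bound => //; [by apply: bddfZ; exact: bddfB|by apply: Rd_mfunZ; exact: Rd_mfunB|].
  by move=> z; rewrite mulrC ltW// H1// k0.
(* The bound by [s] keeps the time [r + s] nonnegative when [r < 0]. *)
exists (Num.min (Num.min d1 d2) s); first by rewrite !lt_min d10 d20.
move=> r r0; rewrite !lt_min => /andP[/andP[rd1 rd2] rs].
case: (ltgtP 0 r) r0 => // [r0 _|r0 _].
  have [|] := quot r s x r0 (ltW s0); last by rewrite leNgt -(gtr0_norm r0) rd1.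
  by rewrite (addrC s r) => /le_trans; apply; lra.
rewrite (ltr0_norm r0) in rd1 rd2 rs.
have k0 : 0 < - r by rewrite oppr_gt0.
have sr : 0 <= r + s by lra.
have [|] := quot (- r) (r + s) x k0 sr; last by rewrite leNgt rd1.
rewrite (_ : r + s - r = s); last by ring.
move=> A1; have A2 : `|T (r + s) h x - T s h x| <= e / 2.
  by apply: H2; rewrite ?(ltW s0)// addrK ltr0_norm.
rewrite (_ : _ - _ = ((T s g x - T (r + s) g x) / - r - T (r + s) h x) + (T (r + s) h x - T s h x)); last first.
  by field; rewrite lt_eqF.
by apply: (le_trans (ler_normD _ _)); lra.
Qed.

Lemma gen_linear (a b : R) (f1 h1 f2 h2 : 'rV[R]_d -> R) : gen P X f1 h1 -> gen P X f2 h2 ->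
  gen P X (fun x => a * f1 x + b * f2 x) (fun x => a * h1 x + b * h2 x).
Proof.
move=> [bf1 mf1 bh1 mh1 H1] [bf2 mf2 bh2 mh2 H2].
have bl (p q : 'rV[R]_d -> R) : bddf p -> bddf q -> bddf (fun x => a * p x + b * q x).
  move=> [M pM] [K qK]; exists (`|a| * M + `|b| * K) => x.
  by rewrite (le_trans (ler_normD _ _))// !normrM lerD// ler_wpM2l.
have ml (p q : 'rV[R]_d -> R) : Rd_mfun p -> Rd_mfun q -> Rd_mfun (fun x => a * p x + b * q x).
  by move=> mp mq; apply: Rd_mfunD; exact: Rd_mfunZ.
split; [exact: bl|exact: ml|exact: bl|exact: ml|move=> e e0].
pose K := `|a| + `|b| + 1.
have K0 : 0 < K by rewrite ltr_wpDl// addr_ge0.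
have eK : 0 < e / K by rewrite divr_gt0.
have [d1 d10 Hd1] := H1 _ eK; have [d2 d20 Hd2] := H2 _ eK.
exists (Num.min d1 d2); first by rewrite lt_min d10.
move=> s; rewrite lt_min => /andP[s0 /andP[sd1 sd2]] x.
have := Hd1 s; rewrite s0 sd1 => /(_ isT x) A1.
have := Hd2 s; rewrite s0 sd2 => /(_ isT x) A2.
rewrite semigD ?semigZ//; [|exact: bddfZ|exact: Rd_mfunZ|exact: bddfZ|exact: Rd_mfunZ].
rewrite (_ : _ - _ = a * ((T s f1 x - f1 x) / s - h1 x) + b * ((T s f2 x - f2 x) / s - h2 x)); last first.
  by field; rewrite gt_eqF.
apply: (le_lt_trans (ler_normD _ _)); rewrite !normrM.
apply: (@le_lt_trans _ _ ((`|a| + `|b|) * (e / K))).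
  by rewrite [leRHS]mulrDl; apply: lerD; rewrite ler_wpM2l// ltW.
by rewrite mulrA ltr_pdivrMr// mulrC ltr_pM2l// ltrDl.
Qed.

End strongly_continuous_semigroup.

(** * Averages over Brownian time *)

Lemma integrable_subr {d : measure_display} {T : measurableType d} {R : realType}
    (mu : {measure set T -> \bar R}) (D : set T) (f g : T -> R) : measurable D ->
  mu.-integrable D (EFin \o f) -> mu.-integrable D (EFin \o g) ->
  mu.-integrable D (EFin \o (fun x => f x - g x)).
Proof.
move=> mD fi gi; rewrite (_ : EFin \o _ = (EFin \o f) \- (EFin \o g))%E; first exact: integrableB.
by apply/funext => x /=; rewrite EFinB.
Qed.

Lemma integrable_mulr {d : measure_display} {T : measurableType d} {R : realType}
    (mu : {measure set T -> \bar R}) (D : set T) (c : R) (f : T -> R) : measurable D ->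
  mu.-integrable D (EFin \o f) -> mu.-integrable D (EFin \o (fun x => c * f x)).
Proof.
move=> mD fi; rewrite (_ : EFin \o _ = (fun x => (c%:E * (f x)%:E)%E)); first exact: integrableZl.
by apply/funext => x /=; rewrite EFinM.
Qed.

Lemma is_derive_under_integral {d : measure_display} {Y : measurableType d} {R : realType}
    (mu : {measure set Y -> \bar R}) (B : set Y) (f f' : R -> Y -> R) (a u v : R) (G : Y -> R) :
  measurable B -> u < a < v ->
  (forall x, u < x < v -> mu.-integrable B (EFin \o f x)) ->
  (forall x y, u < x < v -> B y -> is_derive x 1 (f ^~ y) (f' x y)) ->
  mu.-integrable B (EFin \o G) ->
  (forall x y, u < x < v -> B y -> `|f' x y| <= G y) ->
  is_derive a 1 (fun x => \int[mu]_(y in B) f x y) (\int[mu]_(y in B) f' a y).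
Proof.
move=> mB uav fi df Gi fG.
have Ia : `]u, v[%classic a by rewrite /= in_itv.
have fi' x : `]u, v[%classic x -> mu.-integrable B (EFin \o f x) by rewrite /= in_itv; exact: fi.
have df' x y : `]u, v[%classic x -> B y -> derivable (f ^~ y) x 1.
  by rewrite /= in_itv => uxv By; have [] := df x y uxv By.
have d1 x y : u < x < v -> B y -> partial1of2 f x y = f' x y.
  by move=> uxv By; rewrite partial1of2E; have [] := df x y uxv By.
have Gi' : mu.-integrable B (EFin \o (fun y => `|G y|)) by exact: integrable_norm.
have fG' x y : `]u, v[%classic x -> B y -> `|partial1of2 f x y| <= `|G y|.
  rewrite /= in_itv => uxv By; rewrite d1// (le_trans (fG x y uxv By))//; exact: ler_norm.
apply: DeriveDef; first exact: (derivable_under_integral mB Ia fi' df' (fun=> normr_ge0 _) Gi' fG').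
rewrite -derive1E (differentiation_under_integral mB Ia fi' df' (fun=> normr_ge0 _) Gi' fG').
by apply: eq_Rintegral => y; rewrite inE => By; rewrite d1.
Qed.

Section brownian_time_average.
Context {d0 : measure_display} {Om : measurableType d0} {R : realType} {d : nat}.
Variables (P : probability Om R) (X : 'rV[R]_d -> R -> Om -> 'rV[R]_d).
Hypothesis MX : markov_family P X.
Notation T := (semig P X).
Notation N := (@normal_prob R 0 1).
Notation Rpos := (`]0%R, +oo[%classic : set (measurableTypeR R)).

(* With [c = sqrt t] and [q = 1] this is half of [E T_{|B_t|} g x]. *)
Definition btavg (c : R) (q : R -> R) (g : 'rV[R]_d -> R) (x : 'rV[R]_d) : R :=
  \int[N]_(z in Rpos) (q z * T (c * z) g x).

Variables (c : R) (q : R -> R).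
Hypotheses (c0 : 0 < c) (mq : measurable_fun setT q).
Hypothesis iq : N.-integrable Rpos (EFin \o (fun z => `|q z|)).

(** Joint measurability for Fubini, by the Caratheodory argument: the semigroup is Borel in space
    and, on strongly continuous functions, continuous in time. *)
Lemma measurable_semig_joint {d1 : measure_display} {T1 : measurableType d1}
    (Y : T1 -> 'rV[R]_d) (g : 'rV[R]_d -> R) :
  measurable_fun setT (Y : T1 -> borelRd) -> strongly_cont P X g ->
  measurable_fun [set: T1 * measurableTypeR R]
    (fun p => q p.2 * T (c * Num.max 0 p.2) g (Y p.1)).
Proof.
move=> mY sg; have [bg mg _] := sg.
apply: measurable_funM; first by apply: (measurableT_comp mq); exact: measurable_snd.
apply: (@measurable_fun_caratheodory _ _ _ (fun w z => T (c * Num.max 0 z) g (Y w))).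
  move=> z; have /Rd_mfunP mT : Rd_mfun (T (c * Num.max 0 z) g).
    by apply: semig_mfun => //; rewrite mulr_ge0 ?le_max ?lexx ?(ltW c0).
  exact: (measurableT_comp mT mY).
move=> w z.
have E : (fun z : R => T (c * Num.max 0 z) g (Y w)) = (fun s : R => T (Num.max 0 s) g (Y w)) \o (fun z => c * z).
  by apply/funext => y /=; rewrite maxr_pMr ?mulr0 ?(ltW c0).
rewrite E; apply: continuous_comp; first exact: mulrl_continuous.
exact: semig_continuous.
Qed.

Lemma Rpos_max (z : R) : Rpos z -> Num.max 0 z = z.
Proof. by rewrite /= in_itv/= andbT => /ltW z0; apply/max_idPr. Qed.

Lemma btavg_integrable (g : 'rV[R]_d -> R) (x : 'rV[R]_d) : strongly_cont P X g ->
  N.-integrable Rpos (EFin \o (fun z => q z * T (c * z) g x)).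
Proof.
move=> sg; have [[M gM] mg _] := sg.
have mx : measurable_fun [set: unit] ((fun=> x) : unit -> borelRd) by exact: measurable_cst.
have mj := measurable_semig_joint mx sg.
have iM : N.-integrable Rpos (fun z => (M%:E * (`|q z|)%:E)%E) by apply: integrableZl.
apply: le_integrable iM => //.
  apply/measurable_EFinP.
  apply: (@eq_measurable_fun _ _ _ _ _ (fun z => q z * T (c * Num.max 0 z) g x)).
    by move=> z; rewrite inE => z0; rewrite Rpos_max.
  apply: measurable_funTS.
  rewrite (_ : (fun _ => _) = (fun p : unit * measurableTypeR R => q p.2 * T (c * Num.max 0 p.2) g x) \o pair tt)//.
  by apply: (measurableT_comp mj); exact: measurable_pair1.
move=> z _; rewrite /= lee_fin !normrM normr_id mulrC ler_wpM2r//.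
by rewrite (le_trans _ (ler_norm M))//; exact: semig_bound.
Qed.

Lemma btavg_bound (g : 'rV[R]_d -> R) (M : R) (x : 'rV[R]_d) : strongly_cont P X g ->
  (forall y, `|g y| <= M) -> `|btavg c q g x| <= M * \int[N]_(z in Rpos) `|q z|.
Proof.
move=> sg gM; have [bg mg _] := sg; rewrite -RintegralZl//.
apply: (le_trans (le_normr_Rintegral _ (btavg_integrable x sg))) => //.
apply: le_Rintegral => //.
- exact: integrable_norm (btavg_integrable x sg).
- rewrite (_ : EFin \o _ = (fun z => (M%:E * (`|q z|)%:E)%E)); last by apply/funext => z /=; rewrite EFinM.
  by apply: integrableZl.
- by move=> z _; rewrite normrM mulrC ler_wpM2r//; exact: semig_bound.
Qed.

Lemma btavg_fubini {d1 : measure_display} {T1 : measurableType d1} (Q : probability T1 R)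
    (Y : T1 -> 'rV[R]_d) (g : 'rV[R]_d -> R) :
  measurable_fun setT (Y : T1 -> borelRd) -> strongly_cont P X g ->
  measurable_fun setT (fun w => btavg c q g (Y w)) /\
  \int[Q]_w btavg c q g (Y w) = \int[N]_(z in Rpos) \int[Q]_w (q z * T (c * z) g (Y w)).
Proof.
move=> mY sg; have [[M gM] mg _] := sg.
have iM : N.-integrable Rpos (EFin \o (fun z => M * `|q z|)).
  by rewrite (_ : EFin \o _ = (fun z => (M%:E * (`|q z|)%:E)%E))//; apply: integrableZl.
have E w : \int[N]_(z in Rpos) (q z * T (c * Num.max 0 z) g (Y w)) = btavg c q g (Y w).
  by apply: eq_Rintegral => z; rewrite inE => z0; rewrite Rpos_max.
have [m1 E1] : measurable_fun setT
    (fun w => \int[N]_(z in Rpos) (q z * T (c * Num.max 0 z) g (Y w))) /\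
  \int[Q]_w \int[N]_(z in Rpos) (q z * T (c * Num.max 0 z) g (Y w)) =
  \int[N]_(z in Rpos) \int[Q]_w (q z * T (c * Num.max 0 z) g (Y w)).
  apply: (@Rintegral_fubini_dominated _ _ T1 (measurableTypeR R) R Q N
    (fun w z => q z * T (c * Num.max 0 z) g (Y w)) (fun z => M * `|q z|) Rpos) => //.
  - exact: measurable_semig_joint.
  - by move=> w z _; rewrite normrM mulrC ler_wpM2r//; exact: semig_bound.
split; first by rewrite -(funext E).
transitivity (\int[Q]_w \int[N]_(z in Rpos) (q z * T (c * Num.max 0 z) g (Y w))).
  by apply: eq_Rintegral => w _; rewrite E.
by rewrite E1; apply: eq_Rintegral => z; rewrite inE => z0; rewrite Rpos_max.
Qed.

Lemma btavg_mfun (g : 'rV[R]_d -> R) : strongly_cont P X g -> Rd_mfun (btavg c q g).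
Proof.
move=> sg; apply/Rd_mfunP.
(* Only the measurability half of Fubini is wanted here; the Dirac mass is an arbitrary probability
   on the state space. *)
by have [] := @btavg_fubini _ borelRd (dirac (0 : borelRd)) id g (@measurable_id _ _ _) sg.
Qed.

(** After Fubini, the two times [h] and [c * z] commute by the semigroup property. *)
Lemma semig_btavg (g : 'rV[R]_d -> R) (h : R) (x : 'rV[R]_d) : 0 <= h -> strongly_cont P X g ->
  T h (btavg c q g) x = btavg c q (T h g) x.
Proof.
move=> h0 sg; have [bg mg _] := sg.
have [_ E] := btavg_fubini P (measurable_markov MX x h) sg.
rewrite [LHS]E; apply: eq_Rintegral => z; rewrite inE/= in_itv/= andbT => z0.
have cz : 0 <= c * z by rewrite mulr_ge0 ?ltW.
rewrite RintegralZl//; last by apply: integrable_markov => //; [exact: semig_bddf|exact: semig_mfun].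
by congr (_ * _); rewrite -[LHS](semig_comp MX)// addrC semig_comp.
Qed.

Lemma semig_strongly_cont (g : 'rV[R]_d -> R) (h : R) : 0 <= h ->
  strongly_cont P X g -> strongly_cont P X (T h g).
Proof.
move=> h0 [bg mg H]; split; [exact: semig_bddf|exact: semig_mfun|move=> e e0].
have [del del0 Hd] := H e e0; exists del => // k kd x.
have k0 : 0 <= k by case/andP: kd => /ltW.
rewrite -(semig_comp MX x k0 h0 bg mg) (addrC k h) (semig_comp MX x h0 k0 bg mg).
apply: semig_diff_bound => //.
- exact: semig_bddf.
- exact: semig_mfun.
- exact: Hd.
Qed.

(** The quotient of the average is the average of [T (c * z)] applied to the quotient of [f], so by
    contractivity the error is at most the uniform error for [f] times the mass of [|q|]. Dividing
    by [K + 1] covers a vanishing mass and makes the final inequality strict. *)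
Lemma gen_btavg (f h : 'rV[R]_d -> R) : gen P X f h -> gen P X (btavg c q f) (btavg c q h).
Proof.
move=> G; have [bf mf bh mh H] := G.
have sf := gen_strongly_cont G; have sh := gen_image_strongly_cont MX G.
have bb g : strongly_cont P X g -> bddf (btavg c q g).
  by move=> sg; have [[M gM] _ _] := sg; exists (M * \int[N]_(z in Rpos) `|q z|) => x; exact: btavg_bound.
split; [exact: bb|exact: btavg_mfun|exact: bb|exact: btavg_mfun|move=> e e0].
pose K := \int[N]_(z in Rpos) `|q z|.
have K0 : 0 <= K by apply: Rintegral_ge0.
have eK : 0 < e / (K + 1) by rewrite divr_gt0// ltr_wpDl.
have [del del0 Hd] := H _ eK; exists del => // s sd x.
have s0 : 0 < s by case/andP: sd.
rewrite semig_btavg ?(ltW s0)//.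
have sTf := semig_strongly_cont (ltW s0) sf.
have -> : (btavg c q (T s f) x - btavg c q f x) / s - btavg c q h x =
    \int[N]_(z in Rpos) (s^-1 * (q z * T (c * z) (T s f) x - q z * T (c * z) f x) - q z * T (c * z) h x).
  have i1 g : strongly_cont P X g -> N.-integrable Rpos (EFin \o (fun z => q z * T (c * z) g x)).
    exact: btavg_integrable.
  rewrite RintegralB//; [|by apply: integrable_mulr => //; apply: integrable_subr => //; exact: i1|exact: i1].
  congr (_ - _); rewrite RintegralZl//; last by apply: integrable_subr => //; exact: i1.
  by rewrite mulrC RintegralB//; exact: i1.
have ie : N.-integrable Rpos (EFin \o (fun z => e / (K + 1) * `|q z|)) by exact: integrable_mulr.
have [] := @le_normr_Rintegral_dominated _ _ _ N Rpos
  (fun z => s^-1 * (q z * T (c * z) (T s f) x - q z * T (c * z) f x) - q z * T (c * z) h x) _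
  (measurable_itv _) _ ie.
- have m1 g : strongly_cont P X g -> measurable_fun Rpos (fun z => q z * T (c * z) g x).
    by move=> sg; apply/measurable_EFinP; exact: measurable_int (btavg_integrable x sg).
  by apply: measurable_funB; [apply: measurable_funM => //; apply: measurable_funB|]; exact: m1.
- move=> z; rewrite /= in_itv/= andbT => z0.
  have cz : 0 <= c * z by rewrite mulr_ge0 ?ltW.
  rewrite (_ : _ - _ = (s^-1 * (T (c * z) (T s f) x - T (c * z) f x) - T (c * z) h x) * q z); last by ring.
  have [bTs mTs _] := sTf.
  rewrite normrM ler_wpM2r// -semigB// -semigZ//; [|exact: bddfB|exact: Rd_mfunB].
  apply: semig_diff_bound => //; [by apply: bddfZ; exact: bddfB|by apply: Rd_mfunZ; exact: Rd_mfunB|].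
  by move=> y; rewrite mulrC ltW// Hd.
move=> _ /le_lt_trans; apply; rewrite RintegralZl// -/K.
by rewrite mulrAC ltr_pdivrMr ?ltr_wpDl// mulrDr mulr1 ltrDl.
Qed.

End brownian_time_average.

(** * The evolution equation for Brownian-time averages *)

Section brownian_time_evolution.
Context {d0 : measure_display} {Om : measurableType d0} {R : realType} {d : nat}.
Variables (P : probability Om R) (X : 'rV[R]_d -> R -> Om -> 'rV[R]_d).
Hypothesis MX : markov_family P X.
Notation T := (semig P X).
Notation N := (@normal_prob R 0 1).
Notation phi := (@normal_pdf R 0 1).
Notation Rpos := (`]0%R, +oo[%classic : set (measurableTypeR R)).

Lemma integrable_weight1 : N.-integrable Rpos (EFin \o (fun z : R => `|1 : R|)).
Proof.
by apply: (@bounded_integrable _ _ _ _ _ _ 1) => // z; rewrite normr_id normr1.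
Qed.

Lemma integrable_weight_id : N.-integrable Rpos (EFin \o (fun z : R => `|z|)).
Proof. exact: integrable_norm integrable_normal_id. Qed.

(** Integration by parts for [F z = T (c * z) f x], whose derivative is [c * T (c * z) Af x]. Only
    [f] remains on the right-hand side, so the generator can be applied to the left-hand side once
    more. *)
Lemma btavg_integration_by_parts (c : R) (f Af : 'rV[R]_d -> R) (x : 'rV[R]_d) : 0 < c ->
  gen P X f Af ->
  btavg P X c (fun=> 1) Af x = - (phi 0 / c) * f x + c^-1 * btavg P X c id f x.
Proof.
move=> c0 G; have [[M fM] mf [K AfK] mAf _] := G.
have sf := gen_strongly_cont G; have sAf := gen_image_strongly_cont MX G.
have within (g : 'rV[R]_d -> R) : strongly_cont P X g -> {within `[0, +oo[, continuous (fun z : R => T (c * z) g x)}.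
  move=> sg; have cT : continuous (fun z : R => T (Num.max 0 (c * z)) g x).
    move=> z; apply: (@continuous_comp _ _ _ ( *%R c) (fun s : R => T (Num.max 0 s) g x)).
      exact: mulrl_continuous.
    exact: semig_continuous.
  apply/(@subspace_eq_continuous _ _ _ (fun z : R => T (Num.max 0 (c * z)) g x)).
    move=> z; rewrite inE/= in_itv/= andbT => z0.
    by congr (T _ g x); apply/max_idPr; rewrite mulr_ge0// ltW.
  exact: continuous_subspaceT.
have E : \int[N]_(z in Rpos) (c * T (c * z) Af x) =
    - (phi 0 * T (c * 0) f x) + \int[N]_(z in Rpos) (z * T (c * z) f x).
  apply: (@normal_integration_by_parts R (fun z => T (c * z) f x) (fun z => c * T (c * z) Af x) (Num.max M (c * K))).
  - move=> z z0; rewrite mulrC.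
    have dc : is_derive z 1 ( *%R c) c by apply: is_derive_eq; rewrite /GRing.scale/= mulr1.
    apply: (@is_derive1_comp _ (fun r => T r f x) ( *%R c) z (T (c * z) Af x) c _ dc).
    by apply: gen_is_derive => //; rewrite mulr_gt0.
  - by have /continuous_within_itvcyP[] := within f sf.
  - by move=> z; apply: cvgM; [exact: cvg_cst|exact: within].
  - by move=> z; rewrite le_max (semig_bound MX).
  - by move=> z; rewrite le_max normrM (gtr0_norm c0) ler_pM2l// (semig_bound MX)// orbT.
rewrite mulr0 (semig0 MX) in E.
have cn0 : c != 0 by rewrite gt_eqF.
have i1 : N.-integrable Rpos (EFin \o (fun z => 1 * T (c * z) Af x)).
  by apply: (btavg_integrable MX c0 _ integrable_weight1) => //; exact: measurable_cst.
have E1 : \int[N]_(z in Rpos) (c * T (c * z) Af x) = c * btavg P X c (fun=> 1) Af x.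
  by rewrite /btavg -RintegralZl//; apply: eq_Rintegral => z _; rewrite mul1r.
rewrite -[LHS](mulKf cn0) -E1 E mulrDr; congr (_ + _).
by field.
Qed.

Lemma is_derive_btavg (t : R) (f Af : 'rV[R]_d -> R) (x : 'rV[R]_d) : 0 < t -> gen P X f Af ->
  is_derive t 1 (fun s => btavg P X (Num.sqrt s) (fun=> 1) f x)
    ((2 * Num.sqrt t)^-1 * btavg P X (Num.sqrt t) id Af x).
Proof.
move=> t0 G; have [[M fM] mf [K AfK] mAf _] := G.
have sf := gen_strongly_cont G; have sAf := gen_image_strongly_cont MX G.
have t20 : 0 < t / 2 by rewrite divr_gt0.
have K0 : 0 <= K by exact: le_trans (AfK 0).
have st0 : 0 < Num.sqrt (t / 2) by rewrite sqrtr_gt0.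
have i2 : N.-integrable Rpos (EFin \o (fun z => z * T (Num.sqrt t * z) Af x)).
  by apply: (btavg_integrable MX _ _ integrable_weight_id) => //; rewrite sqrtr_gt0.
rewrite /btavg -RintegralZl//.
have -> : \int[N]_(z in Rpos) ((2 * Num.sqrt t)^-1 * (z * T (Num.sqrt t * z) Af x)) =
    \int[N]_(z in Rpos) (T (Num.sqrt t * z) Af x * (z * (2 * Num.sqrt t)^-1)).
  by apply: eq_Rintegral => z _; ring.
(* On the window from [t / 2] to [2 * t] the factor [1 / (2 sqrt s)] is largest at the left end,
   which gives a dominating function linear in [|z|]. *)
apply: (@is_derive_under_integral _ _ _ N Rpos (fun s z => 1 * T (Num.sqrt s * z) f x)
  (fun s z => T (Num.sqrt s * z) Af x * (z * (2 * Num.sqrt s)^-1)) t (t / 2) (t * 2)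
  (fun z => K / (2 * Num.sqrt (t / 2)) * `|z|)) => //.
- by apply/andP; split; lra.
- move=> s /andP[s1 s2].
  apply: (btavg_integrable MX _ _ integrable_weight1) => //; first by rewrite sqrtr_gt0; lra.
- move=> s z /andP[s1 s2]; rewrite /= in_itv/= andbT => z0.
  have s0 : 0 < s by lra.
  rewrite (_ : (fun _ => _) = (fun r => T r f x) \o (fun s => Num.sqrt s * z)); last first.
    by apply/funext => y; rewrite mul1r.
  have ds := is_derive1_sqrt s0.
  have dc : is_derive s 1 (fun s => Num.sqrt s * z) (z * (2 * Num.sqrt s)^-1).
    apply: is_derive_eq; rewrite /GRing.scale/=; ring.
  apply: (@is_derive1_comp _ (fun r => T r f x) (fun s => Num.sqrt s * z) s _ _ _ dc).
  by apply: gen_is_derive => //; rewrite mulr_gt0// sqrtr_gt0.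
- by apply: integrable_mulr => //; exact: integrable_weight_id.
- move=> s z /andP[s1 s2] _.
  have s0 : 0 < s by lra.
  have q0 : 0 < Num.sqrt s by rewrite sqrtr_gt0.
  have qle : Num.sqrt (t / 2) <= Num.sqrt s by rewrite ler_wsqrtr// ltW.
  rewrite !normrM [`|(_)^-1|]ger0_norm; last by rewrite invr_ge0 mulr_ge0// ltW.
  rewrite (_ : K / _ * _ = K * (`|z| / (2 * Num.sqrt (t / 2)))); last by ring.
  have A1 : 0 <= `|z| / (2 * Num.sqrt s) by apply: divr_ge0 => //; rewrite mulr_ge0// ltW.
  have A2 : `|T (Num.sqrt s * z) Af x| <= K by exact: semig_bound.
  by apply: ler_pM => //; rewrite ler_wpM2l// lef_pV2 ?posrE ?mulr_gt0// ler_pM2l.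
Qed.

(** The time derivative is [c^-1] times the average of [Af] with weight [z]. Applying the generator
    to the integrated formula gives the same term in [h2 x / 2], minus [phi 0 / c * Af x]; this
    excess is [Af x / sqrt (2 pi t)]. *)
Theorem brownian_time_evolution (u : R -> 'rV[R]_d -> R) (f Af : 'rV[R]_d -> R) (t : R) :
  0 < t -> gen P X f Af ->
  (forall s x, 0 < s -> u s x = 2 * btavg P X (Num.sqrt s) (fun=> 1) f x) ->
  exists h2, [/\ gen P X (u t) (fun x => 2 * btavg P X (Num.sqrt t) (fun=> 1) Af x),
    gen P X (fun x => 2 * btavg P X (Num.sqrt t) (fun=> 1) Af x) h2 &
    forall x, is_derive t 1 (fun s => u s x) (Af x / Num.sqrt (2 * pi * t) + h2 x / 2)].
Proof.
move=> t0 G uE; set c := Num.sqrt t.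
have c0 : 0 < c by rewrite sqrtr_gt0.
have G1 : gen P X (btavg P X c (fun=> 1) f) (btavg P X c (fun=> 1) Af).
  by apply: gen_btavg => //; exact: integrable_weight1.
have G2 : gen P X (btavg P X c id f) (btavg P X c id Af).
  by apply: gen_btavg => //; exact: integrable_weight_id.
(* Twice the coefficients of the integration by parts formula. *)
pose a := - (2 * phi 0 / c); pose b := 2 / c.
exists (fun x => a * Af x + b * btavg P X c id Af x); split.
- have := gen_linear MX 2 0 G1 G; congr (gen P X _ _); apply/funext => x.
    by rewrite uE// mul0r addr0.
  by rewrite mul0r addr0.
- have := gen_linear MX a b G G2; congr (gen P X _ _); apply/funext => x.
  by rewrite (btavg_integration_by_parts _ c0 G) /a /b; ring.
- move=> x; have D := is_derive_btavg x t0 G.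
  have D2 : is_derive t 1 (fun s => 2 * btavg P X (Num.sqrt s) (fun=> 1) f x)
    (2 * ((2 * c)^-1 * btavg P X c id Af x)) by exact: is_deriveZ.
  have near_u : {near t, (fun s => 2 * btavg P X (Num.sqrt s) (fun=> 1) f x) =1 (fun s => u s x)}.
    by near=> s; rewrite uE//; near: s; exact: lt_nbhsr.
  have -> : Af x / Num.sqrt (2 * pi * t) + (a * Af x + b * btavg P X c id Af x) / 2 =
      2 * ((2 * c)^-1 * btavg P X c id Af x).
    have p0 : Num.sqrt (pi *+ 2) != 0 :> R by rewrite gt_eqF// sqrtr_gt0 mulrn_wgt0// pi_gt0.
    have -> : Num.sqrt (2 * pi * t) = Num.sqrt (pi *+ 2) * c.
      by rewrite sqrtrM ?mulr_ge0 ?pi_ge0// mulr_natl.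
    have -> : a = - (2 / Num.sqrt (pi *+ 2) / c).
      rewrite /a normal_pdf01E /normal_peak expr1n mul1r expr0n/= oppr0 mul0r expR0 mulr1.
      by [].
    by rewrite /b; field; rewrite p0 gt_eqF.
  case: D2 => D21 D22; apply: DeriveDef.
    by apply: near_eq_derivable D21 => //; apply: filterS near_u => y ->.
  by rewrite -D22; apply: near_eq_derive => //; apply: filterS near_u => y ->.
Unshelve. all: by end_near. Qed.

End brownian_time_evolution.

(** * The excursion representation *)

Lemma InP {T : eqType} (x : T) (s : seq T) :
  reflect (Stdlib.Lists.List.In x s) (x \in s).
Proof.
elim: s => [|y s IH] /=; first by constructor.
rewrite inE; apply: (iffP orP) => [[/eqP ->|/IH]|[->|/IH]]; auto.
Qed.

Lemma bigcap_seq_cons {T : Type} {I : eqType} (i : I) (s : seq I) (F : I -> set T) :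
  \bigcap_(k in [set` i :: s]) F k = F i `&` \bigcap_(k in [set` s]) F k.
Proof.
apply/seteqP; split => [w H|w [Fi H] k /=].
  by split => [|k ks]; apply: H; rewrite /= inE ?eqxx// ks orbT.
by rewrite inE => /orP[/eqP ->|/H].
Qed.

Lemma within_continuous_max0 {R : realType} {V : topologicalType} (F : R -> V) :
  {within `[0, +oo[, continuous F} -> continuous (fun s : R => F (Num.max 0 s)).
Proof.
move=> /subspace_continuousP cF s.
have m0 : `[0, +oo[%classic (Num.max 0 s) by rewrite /= in_itv/= andbT le_max lexx.
apply: cvg_comp; last exact: (cF _ m0).
move=> A [e /= e0 eA]; exists e => //= r rs; apply: eA => /=; last by rewrite in_itv/= andbT le_max lexx.
exact: le_lt_trans (max0_lipschitz _ _) rs.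
Qed.

Lemma countable_bigcapT_measurable {d : measure_display} {T : measurableType d} {I : countType}
    (F : I -> set T) : (forall i, measurable (F i)) -> measurable (\bigcap_i F i).
Proof.
move=> mF; rewrite -[X in measurable X]setCK setC_bigcap; apply: measurableC.
by apply: countable_bigcupT_measurable => // i; exact: measurableC.
Qed.

(** Countable additivity over the level sets of [D], numbered by [pickle]; a number that codes no
    index has an empty level set. *)
Lemma Rintegral_partition {d : measure_display} {T : measurableType d} {R : realType}
    (mu : {finite_measure set T -> \bar R}) {I : countType} (D : T -> I) (F G : T -> R) (M : R) :
  (forall i, measurable [set w | D w = i]) ->
  measurable_fun setT F -> measurable_fun setT G ->
  (forall w, `|F w| <= M) -> (forall w, `|G w| <= M) ->
  (forall i, \int[mu]_(w in [set w | D w = i]) F w = \int[mu]_(w in [set w | D w = i]) G w) ->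
  \int[mu]_w F w = \int[mu]_w G w.
Proof.
move=> mD mF mG FM GM H.
pose L k := [set w | pickle (D w) = k].
have LE k : L k = set0 \/ exists i, L k = [set w | D w = i].
  case: (pselect (exists i : I, pickle i = k)) => [[i <-]|nk]; [right; exists i|left].
    apply/seteqP; split => w; rewrite /L /=; first by move/(pcan_inj pickleK).
    by move=> ->.
  by rewrite -subset0 => w /= Dw; apply: nk; exists (D w).
have mL k : measurable (L k) by case: (LE k) => [->//|[i ->]].
have UL : setT = \bigcup_k L k.
  by apply/seteqP; split => // w _; exists (pickle (D w)).
have tL : trivIset setT L by move=> i j _ _ [w [/= <- <-]].
have iF : mu.-integrable setT (EFin \o F) by exact: (@bounded_integrable _ _ _ _ _ _ M).
have iG : mu.-integrable setT (EFin \o G) by exact: (@bounded_integrable _ _ _ _ _ _ M).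
rewrite /Rintegral; congr fine.
rewrite UL !integral_bigcup//; [|by rewrite -UL..].
apply: eq_eseriesr => k _.
case: (LE k) => [->|[i Li]]; first by rewrite !integral_set0.
have := H i; rewrite -Li /Rintegral => Hi.
rewrite -[LHS]fineK ?Hi ?fineK//; apply: integrable_fin_num => //; exact: (integrableS measurableT).
Qed.

(** With [C] fixed, both sides are finite measures in [A] that agree on the pi-system. *)
Lemma indep_pi_lambda {d : measure_display} {T : measurableType d} {R : realType}
    (P : probability T R) (G : set (set T)) (C : set T) :
  G `<=` measurable -> G setT -> setI_closed G -> measurable C ->
  (forall A, G A -> P (A `&` C) = (P A * P C)%E) ->
  forall A, <<s G >> A -> P (A `&` C) = (P A * P C)%E.
Proof.
move=> Gm GT GI mC H A sA.
have PCE : (fine (P C))%:E = P C by rewrite fineK// fin_num_measure.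
have p0 : 0 <= fine (P C) by exact: fine_ge0.
pose m1 : {measure set T -> \bar R} := mrestr P mC.
pose m2 : {measure set T -> \bar R} := mscale (NngNum p0) P.
have : m1 A = m2 A.
  apply: (@g_sigma_algebra_measure_unique _ R T G Gm (fun=> setT)) => //.
  - by rewrite bigcup_const.
  - by move=> B GB; rewrite /m1 /m2 /= /mrestr /mscale/= H// PCE muleC.
  - by move=> _; rewrite /m1 /= /mrestr setTI -PCE ltry.
by rewrite /m1 /m2 /= /mrestr /mscale/= PCE muleC.
Qed.

Section real_family_sigma.
Context {T : pointedType} {R : realType} {I : Type}.
Variable Y : I -> T -> R.

(** A generating pi-system of the sigma-algebra of the family, in the shape of [cyl_event] so that
    mutual independence applies to it verbatim. *)
Definition cylinders : set (set T) :=
  [set E | exists (s : seq I) (A : I -> set R), (forall i, measurable (A i)) /\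
     E = [set w | forall i, Stdlib.Lists.List.In i s -> A i (Y i w)]].

Lemma cylinders_setT : cylinders setT.
Proof. by exists [::], (fun=> setT); split => //; apply/seteqP; split. Qed.

Lemma cylinders_setI : setI_closed cylinders.
Proof.
move=> _ _ [s1 [A1 [mA1 ->]]] [s2 [A2 [mA2 ->]]].
(* An index may occur in one list only, so each constraint is made conditional on membership in its
   own list. *)
exists (s1 ++ s2), (fun i => [set y | (Stdlib.Lists.List.In i s1 -> A1 i y)] `&`
  [set y | (Stdlib.Lists.List.In i s2 -> A2 i y)]); split.
  have mI s (A : I -> set R) i : measurable (A i) ->
      measurable [set y | Stdlib.Lists.List.In i s -> A i y].
    move=> mA; case: (pselect (Stdlib.Lists.List.In i s)) => Is.
      by rewrite (_ : [set y | _] = A i)//; apply/seteqP; split => y //=; exact.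
    by rewrite (_ : [set y | _] = setT)//; apply/seteqP; split => // y _ /Is.
  by move=> i; apply: measurableI; exact: mI.
apply/seteqP; split => [w [/= H1 H2] i _|w /= H]; first by split; [exact: H1|exact: H2].
by split => i Is; have [] := H i; rewrite ?Stdlib.Lists.List.in_app_iff; auto.
Qed.

Lemma measurable_cylinders (i : I) :
  measurable_fun [set: g_sigma_algebraType cylinders] (Y i).
Proof.
move=> _ A mA; rewrite setTI; apply: sub_sigma_algebra.
exists [:: i], (fun=> A); split => //; apply/seteqP; split => w /=.
  by move=> Aw j [<-|].
by apply; left.
Qed.

End real_family_sigma.

(** * The excursion label as a functional of [B] *)

Section excursion_label.
Context {d0 : measure_display} {Om : measurableType d0} {R : realType}.
Variables (P : probability Om R) (B : R -> Om -> R).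
Hypothesis BM : brownian P B.
Notation OmB := (g_sigma_algebraType (cylinders B)).

Lemma brownian_continuous_max0 (w : Om) : continuous (fun s : R => B (Num.max 0 s) w).
Proof. by have [_ cB _ _] := BM; exact: (within_continuous_max0 (cB w)). Qed.

(** A continuous path without zeros on a compact segment is bounded away from zero there; conversely
    a lower bound at rational parameters extends to the whole segment by density. The quantification
    over real times thus becomes countable. *)
Lemma in_excP (w : Om) (t q : R) : 0 < t -> 0 < q ->
  in_exc B w t q <-> exists k : nat, forall r : rat, 0 <= (ratr r : R) <= 1 ->
    k.+1%:R^-1 <= `|B (q + ratr r * (t - q)) w|.
Proof.
move=> t0 q0.
pose b l := B (Num.max 0 (q + l * (t - q))) w.
have cb : continuous b.
  move=> l; apply: (@continuous_comp _ _ _ (fun l : R => q + l * (t - q)) (fun s : R => B (Num.max 0 s) w)).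
    by apply: cvgD; [exact: cvg_cst|apply: cvgM; [exact: cvg_id|exact: cvg_cst]].
  exact: brownian_continuous_max0.
have pos l : 0 <= l <= 1 -> 0 < q + l * (t - q).
  by move=> /andP[l0 l1]; have [l2|l2] := lerP l (1 / 2); nra.
have bE l : 0 <= l <= 1 -> b l = B (q + l * (t - q)) w.
  by move=> l01; rewrite /b; congr (B _ w); apply/max_idPr; rewrite ltW// pos.
have cvx l : 0 <= l <= 1 -> Num.min q t <= q + l * (t - q) <= Num.max q t.
  by move=> /andP[l0 l1]; case: (leP q t) => qt; apply/andP; split; nra.
split.
  move=> H.
  have cnb : {within `[(0 : R), 1], continuous (fun l => `|b l|)}.
    by apply: continuous_subspaceT => l; apply: cvg_norm; exact: cb.
  have [c c01 cmin] := EVT_min (@ler01 R) cnb.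
  have c01' : 0 <= c <= 1 by rewrite in_itv/= in c01.
  have bc : 0 < `|b c|.
    by rewrite normr_gt0 bE//; apply/eqP; apply: H; exact: cvx.
  exists (Num.truncn `|b c|^-1) => r r01; rewrite -bE//.
  apply: (@le_trans _ _ `|b c|); last by apply: cmin; rewrite in_itv.
  by rewrite -[leRHS]invrK lef_pV2 ?posrE ?invr_gt0// ltW// truncnS_gt.
move=> [k H] r rqt B0.
have e0 : 0 < k.+1%:R^-1 :> R by rewrite invr_gt0.
set e : R := k.+1%:R^-1 in H e0.
have [l l01 lr] : exists2 l : R, 0 <= l <= 1 & q + l * (t - q) = r.
  have [qt|qt] := eqVneq q t.
    exists 0; first by rewrite lexx ler01.
    by move: rqt; rewrite qt minxx maxxx mul0r addr0 -eq_le => /eqP.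
  exists ((r - q) / (t - q)); last by field; rewrite subr_eq0 eq_sym.
  move: rqt; case: (ltgtP q t) qt => // qt _ /andP[r1 r2].
    have tq : 0 < t - q by rewrite subr_gt0.
    by rewrite divr_ge0 ?ler_pdivrMr ?mul1r; lra.
  have tq : 0 < q - t by rewrite subr_gt0.
  rewrite (_ : (r - q) / (t - q) = (q - r) / (q - t)); last first.
    by rewrite -(opprB q r) -(opprB q t) invrN mulrNN.
  by rewrite divr_ge0 ?ler_pdivrMr ?mul1r; lra.
have b0 : b l = 0 by rewrite bE// lr.
have [del /= del0 Hd] : \forall y \near l, `|b l - b y| < e by have /cvgrPdist_lt := cb l; exact.
have [p] : exists p : rat, Num.max 0 (l - del) < ratr p < Num.min 1 (l + del).
  have : Num.max 0 (l - del) < Num.min 1 (l + del).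
    by move/andP: l01 => [l0 l1]; rewrite lt_min !gt_max ltr01/=; apply/andP; split; [|apply/andP; split]; lra.
  by move=> /rat_in_itvoo[p]; rewrite in_itv => ?; exists p.
rewrite gt_max lt_min => /andP[/andP[p0 p1] /andP[p2 p3]].
have p01 : 0 <= (ratr p : R) <= 1 by rewrite !ltW.
have := Hd (ratr p); rewrite /ball/= b0 sub0r normrN bE// => /(_ _) Hp.
have := H p p01; rewrite leNgt => /negP; apply; apply: Hp.
by rewrite ltr_distl; apply/andP; split; lra.
Qed.

Lemma measurable_in_exc (t q : R) : 0 < t -> @measurable _ OmB [set w | in_exc B w t q].
Proof.
move=> t0; have [q0|q0] := lerP q 0.
  (* For [q <= 0 < t] the segment contains time [0], where [B] vanishes. This covers the junk value
     [-1] of the enumeration. *)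
  rewrite (_ : [set w | _] = set0)//; apply/seteqP; split => // w /= H.
  have [B0 _ _ _] := BM; apply: (H 0 _ (B0 w)).
  by rewrite ge_min le_max q0 (ltW t0) orbT.
rewrite (_ : [set w | _] = \bigcup_k \bigcap_(r : rat)
   [set w | 0 <= (ratr r : R) <= 1 -> k.+1%:R^-1 <= `|B (q + ratr r * (t - q)) w|]); last first.
  apply/seteqP; split => w /=; first by move=> /(in_excP w t0 q0)[k H]; exists k => // r _; exact: H.
  by move=> [k _ H]; apply/(in_excP w t0 q0); exists k => r; exact: H.
apply: bigcupT_measurable => k; apply: countable_bigcapT_measurable => r.
case: (boolP (0 <= (ratr r : R) <= 1)) => r01; last first.
  by rewrite (_ : [set w | _] = setT)//; apply/seteqP; split.
rewrite (_ : [set w | _] = (fun w => `|B (q + ratr r * (t - q)) w|) @^-1` `[k.+1%:R^-1, +oo[%classic).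
  rewrite -[X in measurable X]setTI.
  have mB : measurable_fun [set: OmB] (fun w => `|B (q + ratr r * (t - q)) w|).
    by apply: measurableT_comp => //; exact: measurable_cylinders.
  exact: mB.
by apply/seteqP; split => w /=; rewrite in_itv/= andbT; [exact|].
Qed.

(** The label [0] arises in two ways: as the least index found, or by default when no enumerated
    point lies in the excursion. Both are countable conditions on membership. *)
Lemma exc_labelP (w : Om) (t : R) (n : nat) : exc_label B w t = n <->
  (in_exc B w t (ratpt n) /\ forall j, (j < n)%N -> ~ in_exc B w t (ratpt j)) \/
  (n = 0%N /\ forall j, ~ in_exc B w t (ratpt j)).
Proof.
rewrite /exc_label; case: pselect => [h|h]; last first.
  have nH j : ~ in_exc B w t (ratpt j) by move=> H; apply: h; exists j; exact/asboolP.
  by split => [<-|[[/nH]//|[->//]]]; right.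
case: ex_minnP => m /asboolP Hm mmin; split.
  move=> <-; left; split => // j jm /asboolP /mmin; by rewrite leqNgt jm.
move=> [[Hn nmin]|[_ nH]]; last by have := nH _ Hm.
apply/eqP; rewrite eqn_leq mmin; last exact/asboolP.
by rewrite leqNgt; apply/negP => /nmin.
Qed.

Lemma measurable_exc_label (t : R) (n : nat) : 0 < t ->
  @measurable _ OmB [set w | exc_label B w t = n].
Proof.
move=> t0.
have mI j : @measurable _ OmB [set w | in_exc B w t (ratpt j)] by exact: measurable_in_exc.
have mC (D : set nat) : @measurable _ OmB (\bigcap_(j in D) ~` [set w | in_exc B w t (ratpt j)]).
  rewrite bigcap_mkcond; apply: countable_bigcapT_measurable => j; case: ifPn => // _.
  exact: measurableC.
have mn0 : @measurable _ OmB [set w : Om | n = 0%N].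
  case: n => [|n].
    by rewrite (_ : [set w | _] = setT)//; apply/seteqP; split.
  by rewrite (_ : [set w | _] = set0)//; apply/seteqP; split.
rewrite (_ : [set w | _] = ([set w | in_exc B w t (ratpt n)] `&`
    \bigcap_(j in [set j | (j < n)%N]) ~` [set w | in_exc B w t (ratpt j)]) `|`
  ([set w | n = 0%N] `&` \bigcap_(j in setT) ~` [set w | in_exc B w t (ratpt j)])).
  by apply: measurableU; apply: measurableI.
apply/seteqP; split => w /=.
  by move=> /exc_labelP[[H1 H2]|[H1 H2]]; [left|right]; split => // j jn; exact: H2.
move=> H; apply/exc_labelP; case: H => [[H1 H2]|[H1 H2]]; [left|right]; split => // j.
  exact: H2.
Qed.

End excursion_label.

(** * From the excursion-based process to an average over Brownian time *)

Section excursion_representation.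
Context {d0 : measure_display} {Om : measurableType d0} {R : realType} {d : nat}.
Variables (P : probability Om R) (X : 'rV[R]_d -> R -> Om -> 'rV[R]_d).
Variables (Xc : nat -> 'rV[R]_d -> R -> Om -> 'rV[R]_d).
Variables (B : R -> Om -> R) (sel : nat -> Om -> nat) (f : 'rV[R]_d -> R).
Hypotheses (MX : markov_family P X) (MXc : forall i, markov_family P (Xc i)).
Hypothesis SL : forall i x, same_law P (coords (Xc i x)) (coords (X x)).
Hypotheses (BM : brownian P B) (IND : forall x, ebtp_indep P Xc B sel x).
Hypotheses (bf : bddf f) (cf : continuous f) (sf : strongly_cont P X f).
Notation OmB := (g_sigma_algebraType (cylinders B)).
Notation T := (semig P X).

Let mf : Rd_mfun f. Proof. exact: continuous_Rd_mfun. Qed.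

Lemma cylinders_measurable : cylinders B `<=` measurable.
Proof.
move=> _ [s [A [mA ->]]]; have [_ _ mB _] := BM.
rewrite (_ : [set w | _] = \bigcap_(i in [set i | i \in s]) (B i @^-1` A i)).
  apply: fin_bigcap_measurable; first exact: finite_seq.
  by move=> i _; rewrite -[X in measurable X]setTI; exact: mB.
apply/seteqP; split => w /= H i; [move=> /= /InP|move=> /InP]; exact: H.
Qed.

Lemma sigmaB_measurable (E : set Om) : <<s cylinders B >> E -> measurable E.
Proof. by apply: smallest_sub => //; [exact: sigma_algebra_measurable|exact: cylinders_measurable]. Qed.

Lemma measurable_sel (n k : nat) : measurable [set w | sel n w = k].
Proof.
have [mY _] := IND 0; have := mY (inr (Some n)) (0, None) measurableT [set k%:R] (measurable_set1 _).
rewrite setTI /=; congr measurable; apply/seteqP; split => w /=; last by move=> ->.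
by move=> /eqP; rewrite eqr_nat => /eqP.
Qed.

Lemma semig_copy (k : nat) (s : R) (x : 'rV[R]_d) : \int[P]_w f (Xc k x s w) = T s f x.
Proof.
apply: integral_same_law => //.
- by move=> i; have [_ _ m _ _] := MXc k; exact: m.
- by move=> i; have [_ _ m _ _] := MX; exact: m.
move=> A mA.
have := SL k x [seq (s, i) | i <- enum 'I_d] (A := fun p => A p.2) (fun p => mA p.2).
have E (Z : 'rV[R]_d -> R -> Om -> 'rV[R]_d) :
    [set w | forall i, Stdlib.Lists.List.In i [seq (s, i0) | i0 <- enum 'I_d] ->
       A i.2 (coords (Z x) i w)] = Z x s @^-1` box A.
  apply/seteqP; split => w /= H.
    by move=> i; apply: (H (s, i)); apply/InP/mapP; exists i; rewrite ?mem_enum.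
  by move=> i /InP/mapP[j _ ->] /=; exact: H.
by rewrite !E.
Qed.

(** Mutual independence is given on cylinder events. It factors the three events when [E] is a
    cylinder of [B]; the pi-lambda argument, with [S] alone and with the intersection of [S] and
    [Y], then reaches every [E] in the sigma-algebra of [B]. *)
Lemma copy_indep (E : set Om) (n k : nat) (s : R) (x : 'rV[R]_d) (A : 'I_d -> set R) :
  <<s cylinders B >> E -> (forall i, measurable (A i)) ->
  P ((E `&` [set w | sel n w = k]) `&` Xc k x s @^-1` box A) =
  (P (E `&` [set w | sel n w = k]) * P (Xc k x s @^-1` box A))%E.
Proof.
move=> sE mA; set S := [set w | _]; set Y := _ @^-1` _.
have mS : measurable S by exact: measurable_sel.
have mY : measurable Y.
  have := measurable_markov (MXc k) x s measurableT (measurable_box mA).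
  by rewrite setTI.
have [_ I] := IND x.
(* Index lists and target sets are chosen so that the cylinder events of the three groups are [Y],
   [S] and the given cylinder of [B]. The selector does not depend on its index, hence the dummy
   [(0, None)]. *)
pose ss (sB : seq R) (j : (nat + option nat)%type) : seq (R * option 'I_d) :=
  match j with
  | inl _ => [seq (s, Some i) | i <- enum 'I_d]
  | inr (Some _) => [:: (0, None)]
  | inr None => [seq (r, None) | r <- sB]
  end.
pose AA (AB : R -> set R) (j : (nat + option nat)%type) (p : R * option 'I_d) : set R :=
  match j with
  | inl _ => if p.2 is Some i then A i else setT
  | inr (Some _) => [set k%:R]
  | inr None => AB p.1
  end.
pose Yf (j : (nat + option nat)%type) (p : R * option 'I_d) :=
    match j with
    | inl i => fun w => match p.2 with Some j => Xc i x p.1 w 0 j | None => 0 end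
    | inr None => B p.1
    | inr (Some n) => fun w => (sel n w)%:R
    end.
have mAA AB : (forall r, measurable (AB r)) -> forall j p, measurable (AA AB j p).
  by move=> mAB [i|[i|]] [r [j|]] //=; exact: mA.
have cY sB AB : cyl_event Yf (ss sB) (AA AB) (inl k) = Y.
  apply/seteqP; split => w /= H.
    by move=> i; apply: (H (s, Some i)); apply/InP/mapP; exists i; rewrite ?mem_enum.
  by move=> p /InP/mapP[i _ ->] /=; exact: H.
have cS sB AB : cyl_event Yf (ss sB) (AA AB) (inr (Some n)) = S.
  apply/seteqP; split => w /= H.
    by have := H (0, None) (or_introl erefl) => /eqP; rewrite eqr_nat => /eqP.
  by move=> p _; rewrite /AA /Yf /=; move: H; rewrite /S /= => ->.
have cB sB AB : cyl_event Yf (ss sB) (AA AB) (inr None) =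
    [set w | forall r, Stdlib.Lists.List.In r sB -> AB r (B r w)].
  apply/seteqP; split => w /= H.
    by move=> r /InP rs; apply: (H (r, None)); apply/InP/mapP; exists r.
  by move=> p /InP/mapP[r /InP rs ->] /=; exact: H.
have PSY : P (S `&` Y) = (P S * P Y)%E.
  have := I [:: inr (Some n); inl k] isT (ss [::]) (AA (fun=> setT)) (mAA _ (fun=> measurableT)).
  rewrite -/Yf !big_cons big_nil mule1 cS cY => <-; congr (P _).
  by rewrite !bigcap_seq_cons set_nil bigcap_set0 setIT cS cY.
have step2 E' : cylinders B E' -> P (E' `&` S) = (P E' * P S)%E.
  move=> [sB [AB [mAB ->]]].
  have := I [:: inr None; inr (Some n)] isT (ss sB) (AA AB) (mAA _ mAB).
  rewrite -/Yf !big_cons big_nil mule1 cS cB => <-; congr (P _).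
  by rewrite !bigcap_seq_cons set_nil bigcap_set0 setIT cS cB.
have step3 E' : cylinders B E' -> P (E' `&` (S `&` Y)) = (P E' * P (S `&` Y))%E.
  move=> [sB [AB [mAB ->]]].
  have := I [:: inr None; inr (Some n); inl k] isT (ss sB) (AA AB) (mAA _ mAB).
  rewrite -/Yf !big_cons big_nil mule1 cS cB cY PSY => <-; congr (P _).
  by rewrite !bigcap_seq_cons set_nil bigcap_set0 setIT cS cB cY.
have CT := @cylinders_setT Om R R B.
have CI := @cylinders_setI Om R R B.
rewrite -setIA.
rewrite (indep_pi_lambda cylinders_measurable CT CI _ step3 sE); last exact: measurableI.
by rewrite (indep_pi_lambda cylinders_measurable CT CI mS step2 sE) PSY muleA.
Qed.

(* [|B t|] is rounded down to multiples of [1 / m.+1]; on each of the countably many events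
   fixing the label, the selected copy and the rounded time, independence applies. *)
Lemma ebtp_average (x : 'rV[R]_d) (t : R) : 0 < t ->
  Ex P (fun w => f (ebtp Xc B sel x t w)) = \int[P]_w T `|B t w| f x.
Proof.
move=> t0; have [M fM] := bf; have [_ _ mB _] := BM.
have mXc k s : measurable_fun setT (fun w => f (Xc k x s w)) by exact: (measurable_markov_comp (MXc k) x s mf).
have cT : continuous (fun s : R => T (Num.max 0 s) f x) by exact: semig_continuous.
pose fl (m : nat) (w : Om) : int := Num.floor (m.+1%:R * `|B t w|).
pose S (m : nat) (w : Om) : R := (fl m w)%:~R / m.+1%:R.
have S0 m w : 0 <= S m w by rewrite divr_ge0// ler0z floor_ge0 mulr_ge0.
pose lab (w : Om) := exc_label B w t.
pose D (m : nat) (w : Om) : (nat * nat * int)%type := (lab w, sel (lab w) w, fl m w).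
have sfl m j : <<s cylinders B >> [set w | fl m w = j].
  have mBn : measurable_fun [set: OmB] (fun w => `|B t w| : measurableTypeR R).
    by apply: measurableT_comp => //; exact: measurable_cylinders.
  have := mBn measurableT _ (measurable_level_floor m.+1%:R j).
  by rewrite setTI.
have slab n : <<s cylinders B >> [set w | lab w = n] by exact: (measurable_exc_label BM n t0).
have sE m n j : <<s cylinders B >> ([set w | lab w = n] `&` [set w | fl m w = j]).
  by apply: (@measurableI _ OmB); [exact: slab|exact: sfl].
have DE m i : [set w | D m w = i] =
    ([set w | lab w = i.1.1] `&` [set w | fl m w = i.2]) `&` [set w | sel i.1.1 w = i.1.2].
  apply/seteqP; split => w /=; first by move=> <-.
  by case: i => [[n k] j] /= [[<- <-] <-].
have mD m i : measurable [set w | D m w = i].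
  by rewrite DE; apply: measurableI; [apply: sigmaB_measurable; exact: sE|exact: measurable_sel].
pose F (m : nat) (w : Om) := f (Xc (sel (lab w) w) x (S m w) w).
pose G (m : nat) (w : Om) := T (S m w) f x.
have mF m : measurable_fun setT (F m).
  by apply: (@measurable_fun_glue _ _ _ _ _ (D m) (fun i w => f (Xc i.1.2 x (i.2%:~R / m.+1%:R) w))).
have mG m : measurable_fun setT (G m).
  by apply: (@measurable_fun_glue _ _ _ _ _ (D m) (fun i w => T (i.2%:~R / m.+1%:R) f x)).
have FG m : \int[P]_w F m w = \int[P]_w G m w.
  apply: (@Rintegral_partition _ _ _ P _ (D m) (F m) (G m) M) => //.
    by move=> w; exact: fM.
    by move=> w; exact: semig_bound.
  move=> i; pose s : R := i.2%:~R / m.+1%:R.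
  transitivity (\int[P]_(w in [set w | D m w = i]) f (Xc i.1.2 x s w)).
    by apply: eq_Rintegral => w; rewrite inE /= => Di; rewrite /F /S /s -Di.
  transitivity (\int[P]_(w in [set w | D m w = i]) (T s f x)); last first.
    by apply: eq_Rintegral => w; rewrite inE /= => Di; rewrite /G /S /s -Di.
  rewrite Rintegral_cst// mulrC -(semig_copy i.1.2) (@integral_indep _ _ _ _ P _ (Xc i.1.2 x s))//.
  - by move=> j; have [_ _ m' _ _] := MXc i.1.2; exact: m'.
  - by move=> A mA; rewrite DE copy_indep.
have Scvg w : S m w @[m --> \oo] --> `|B t w| by exact: cvg_floor_div.
have Mint : P.-integrable setT (EFin \o (cst M)) by exact: finite_measure_integrable_cst.
(* For a fixed outcome the label and the copy are the same for all [m]; only the time varies, so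
   path continuity of a single copy is enough. *)
have cF : \int[P]_w F m w @[m --> \oo] --> \int[P]_w f (ebtp Xc B sel x t w).
  apply: (@Rintegral_dominated_cvg _ _ _ P setT F _ (cst M)) => //; last by move=> m w _; exact: fM.
  move=> w _; set k := sel (lab w) w.
  have cX : continuous (fun s : R => f (Xc k x (Num.max 0 s) w)).
    move=> s; apply: (@continuous_comp _ _ _ (fun s : R => Xc k x (Num.max 0 s) w) f); last exact: cf.
    by have [_ c _ _ _] := MXc k; exact: (within_continuous_max0 (c x w)).
  have : f (Xc k x (Num.max 0 (S m w)) w) @[m --> \oo] --> f (Xc k x (Num.max 0 `|B t w|) w).
    by apply: (@cvg_comp _ _ _ (fun m => S m w) (fun s : R => f (Xc k x (Num.max 0 s) w)) _ _ _ (Scvg w)); exact: cX.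
  have -> : Num.max 0 `|B t w| = `|B t w| by apply/max_idPr.
  apply: cvg_trans; apply: near_eq_cvg; near=> m.
  by rewrite /F -/k (max_idPr _).
have cG : \int[P]_w G m w @[m --> \oo] --> \int[P]_w T `|B t w| f x.
  apply: (@Rintegral_dominated_cvg _ _ _ P setT G _ (cst M)) => //; last first.
    by move=> m w _; exact: semig_bound.
  move=> w _.
  have : T (Num.max 0 (S m w)) f x @[m --> \oo] --> T (Num.max 0 `|B t w|) f x.
    by apply: (@cvg_comp _ _ _ (fun m => S m w) (fun s : R => T (Num.max 0 s) f x) _ _ _ (Scvg w)); exact: cT.
  have -> : Num.max 0 `|B t w| = `|B t w| by apply/max_idPr.
  apply: cvg_trans; apply: near_eq_cvg; near=> m.
  by rewrite /G (max_idPr _).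
rewrite (_ : (fun m => \int[P]_w F m w) = (fun m => \int[P]_w G m w)) in cF; last by apply/funext.
exact: (cvg_unique _ cF cG).
Unshelve. all: by end_near. Qed.

Lemma ebtp_btavg (x : 'rV[R]_d) (t : R) : 0 < t ->
  Ex P (fun w => f (ebtp Xc B sel x t w)) = 2 * btavg P X (Num.sqrt t) (fun=> 1) f x.
Proof.
move=> t0; rewrite ebtp_average//; have [M fM] := bf; have [B0 _ mB gB] := BM.
have st0 : 0 < Num.sqrt t by rewrite sqrtr_gt0.
pose g (s : R) := T (Num.max 0 s) f x.
have cg : continuous g by exact: semig_continuous.
have mg : @measurable_fun _ _ (measurableTypeR R) (measurableTypeR R) setT (fun b => g `|b|).
  apply: continuous_measurable_fun => b.
  by apply: (@continuous_comp _ _ _ (fun b : R => `|b|) g); [exact: norm_continuous|exact: cg].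
have mBt : @measurable_fun _ _ Om (measurableTypeR R) setT (B t) by exact: mB.
pose sc (z : R) := Num.sqrt t * z.
have msc : @measurable_fun _ _ (measurableTypeR R) (measurableTypeR R) setT sc by exact: mulrl_measurable.
transitivity (\int[law P mBt]_b g `|b|).
  by rewrite Rintegral_law//; apply: eq_Rintegral => w _; rewrite /g (max_idPr _).
transitivity (\int[law (@normal_prob R 0 1) msc]_b g `|b|).
  (* Only the marginal law of [B t] matters: as the increment from time [0] it is centred normal
     with variance [t], the law of [sqrt t] times a standard normal variable. *)
  rewrite /Rintegral; congr fine; apply: eq_measure_integral => A mA _.
  have [+ _] := gB 0 t (lexx 0) t0 => /(_ A mA).
  rewrite !lawE subr0 (_ : (fun w => _) = B t); last by apply/funext => w; rewrite B0 subr0.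
  by move=> H; apply: (eq_trans H); rewrite normal_prob_scale.
rewrite Rintegral_law//.
transitivity (\int[@normal_prob R 0 1]_z g (sc `|z|)).
  by apply: eq_Rintegral => z _; rewrite /sc normrM (ger0_norm (ltW st0)).
rewrite (@integral_normal_norm _ (fun z => g (sc z)) M)//.
- congr (2 * _); apply: eq_Rintegral => z; rewrite inE/= in_itv/= andbT => z0.
  by rewrite mul1r /g /sc (max_idPr _)// mulr_ge0// ltW.
- apply: continuous_measurable_fun => b.
  apply: (@continuous_comp _ _ _ sc g); last exact: cg.
  by apply: cvgM; [exact: cvg_cst|exact: cvg_id].
- by move=> z; exact: semig_bound.
Qed.

End excursion_representation.

(** * Partial derivatives *)

(** Directional derivatives reduce to calculus on the real line, since the two difference quotients
    coincide as functions of [h]. *)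
Lemma derive_quotient_line {R : realType} {V : normedModType R} (f : V -> R) (x v : V) (r : R) :
  (fun h : R => h^-1 *: ((f \o shift (x + r *: v)) (h *: v) - f (x + r *: v))) =
  (fun h : R => h^-1 *: (((fun s : R => f (x + s *: v)) \o shift r) (h *: (1 : R)) - f (x + r *: v))).
Proof.
apply/funext => h /=; congr (_ *: (f _ - _)).
by rewrite [h *: (1 : R)]mulr1 scalerDl addrCA.
Qed.

Lemma is_derive_line {R : realType} {V : normedModType R} (f : V -> R) (x v : V) (r l : R) :
  is_derive (x + r *: v) v f l -> is_derive r 1 (fun s : R => f (x + s *: v)) l.
Proof.
move=> [df <-]; split; last by rewrite /derive derive_quotient_line.
by move: df; rewrite /derivable derive_quotient_line.
Qed.

Lemma line_is_derive {R : realType} {V : normedModType R} (f : V -> R) (x v : V) (l : R) :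
  is_derive (0 : R) 1 (fun s : R => f (x + s *: v)) l -> is_derive x v f l.
Proof.
have x0 : x = x + (0 : R) *: v by rewrite scale0r addr0.
move=> [df <-]; rewrite [in is_derive x]x0; split; last by rewrite /derive derive_quotient_line.
by rewrite /derivable derive_quotient_line.
Qed.

Section coordinate_derivatives.
Context {R : realType} {d : nat}.
Implicit Types (v g : 'rV[R]_d -> R) (x y : 'rV[R]_d).

Definition has_partial (i : 'I_d) v g : Prop := forall x, is_derive x (ei i) v (g x).

Lemma has_partial_derive (i : 'I_d) v g : has_partial i v g -> 'D_(ei i) v = g.
Proof. by move=> H; apply/funext => x; have [] := H x. Qed.

Lemma has_partial_derivable (i : 'I_d) v g x : has_partial i v g -> derivable v x (ei i).
Proof. by move=> H; have [] := H x. Qed.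

Lemma has_partial_line (i : 'I_d) v g x (r : R) : has_partial i v g ->
  is_derive r 1 (fun s : R => v (x + s *: ei i)) (g (x + r *: ei i)).
Proof. by move=> H; apply: is_derive_line. Qed.

Lemma continuous_line (i : 'I_d) v g x : has_partial i v g ->
  continuous (fun s : R => v (x + s *: ei i)).
Proof.
move=> H s; apply: differentiable_continuous; apply/derivable1_diffP.
by have [] := has_partial_line x s H.
Qed.

Lemma mean_value_line (i : 'I_d) v g x (a : R) : has_partial i v g ->
  exists2 c : R, `|c| <= `|a| & v (x + a *: ei i) - v x = a * g (x + c *: ei i).
Proof.
move=> H; have c0 : continuous (fun s : R => v (x + s *: ei i)) by exact: (continuous_line H).
have [a0|a0] := leP 0 a.
  have [||c] := @MVT_segment R (fun s => v (x + s *: ei i)) (fun s => g (x + s *: ei i)) 0 a a0.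
  - by move=> s _; exact: has_partial_line.
  - exact: continuous_subspaceT.
  rewrite in_itv/= => /andP[c1 c2]; rewrite scale0r addr0 subr0 => ->.
  by exists c; [rewrite !ger0_norm|rewrite mulrC].
have [||c] := @MVT_segment R (fun s => v (x + s *: ei i)) (fun s => g (x + s *: ei i)) a 0 (ltW a0).
- by move=> s _; exact: has_partial_line.
- exact: continuous_subspaceT.
rewrite in_itv/= => /andP[c1 c2]; rewrite scale0r addr0 sub0r => E.
exists c; first by rewrite !ler0_norm ?lerN2// ltW.
by rewrite -[LHS]opprB E; ring.
Qed.

(** Rolle for [a ^+ 2 * psi r - psi a * r ^+ 2] on [[0, a]] expresses [psi a] through [dpsi c], and
    the mean value theorem for [g] between [- c] and [c] produces [h]. The final point is at
    distance at most [2 c + c] from [x], whence the constant [3]. Mere existence of two derivatives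
    along the line is enough. *)
Lemma symmetric_difference_pos (i : 'I_d) v g h x (a : R) : 0 < a ->
  has_partial i v g -> has_partial i g h ->
  exists2 c : R, `|c| <= 3 * `|a| &
    v (x + a *: ei i) + v (x - a *: ei i) - 2 * v x = a ^+ 2 * h (x + c *: ei i).
Proof.
move=> a0 Hv Hg.
pose psi (r : R) := v (x + r *: ei i) + v (x + (- r) *: ei i) - 2 * v x.
pose dpsi (r : R) := g (x + r *: ei i) - g (x + (- r) *: ei i).
have D (r : R) : is_derive r 1 psi (dpsi r).
  have E1 := has_partial_line x r Hv.
  have E2 : is_derive r 1 (fun s : R => v (x + (- s) *: ei i)) (g (x + (- r) *: ei i) * -1).
    exact: (@is_derive1_comp _ (fun s => v (x + s *: ei i)) (fun s : R => - s)
      _ _ _ (has_partial_line x (- r) Hv)).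
  by apply: is_derive_eq; rewrite /dpsi; ring.
pose k (r : R) := a ^+ 2 * psi r - psi a * r ^+ 2.
have Dk (r : R) : is_derive r 1 k (a ^+ 2 * dpsi r - psi a * (2 * r)).
  have Dr := D r.
  by apply: is_derive_eq; rewrite /GRing.scale/=; ring.
have psi0 : psi 0 = 0 by rewrite /psi oppr0 scale0r addr0; ring.
have [|||c] := @Rolle R k 0 a a0.
- by move=> r _; have [] := Dk r.
- by apply: continuous_subspaceT => r; apply: differentiable_continuous; apply/derivable1_diffP; have [] := Dk r.
- by rewrite /k psi0; ring.
rewrite in_itv/= => /andP[c0 ca] [_].
have [_ ->] := Dk c => /eqP; rewrite subr_eq0 => /eqP E.
have [b bc Eb] := mean_value_line (x + (- c) *: ei i) (2 * c) Hg.
have Eb' : dpsi c = 2 * c * h (x + (b - c) *: ei i).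
  move: Eb; rewrite -addrA -scalerDl (_ : - c + 2 * c = c); last by ring.
  by rewrite /dpsi => ->; rewrite -addrA -scalerDl (addrC (- c)).
exists (b - c).
  rewrite (gtr0_norm a0) (le_trans (ler_normB _ _))// (gtr0_norm c0).
  by move: bc; rewrite (gtr0_norm (_ : 0 < 2 * c)); lra.
have c2 : 2 * c != 0 by lra.
rewrite -scaleNr -/(psi a); apply: (mulIf c2); rewrite -E Eb'; ring.
Qed.

Lemma symmetric_difference (i : 'I_d) v g h x (a : R) :
  has_partial i v g -> has_partial i g h ->
  exists2 c : R, `|c| <= 3 * `|a| &
    v (x + a *: ei i) + v (x - a *: ei i) - 2 * v x = a ^+ 2 * h (x + c *: ei i).
Proof.
move=> Hv Hg; have [a0|a0|->] := ltgtP a 0.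
- have na0 : 0 < - a by rewrite oppr_gt0.
  have [c ca E] := symmetric_difference_pos x na0 Hv Hg.
  exists c; first by rewrite normrN in ca.
  by rewrite -sqrrN -E scaleNr opprK; ring.
- exact: symmetric_difference_pos Hv Hg.
- by exists 0; rewrite ?normr0 ?mulr0// scale0r subr0 addr0; ring.
Qed.

(** Interpolates from [0] to [e] by switching on one coordinate at a time. *)
Definition trunc (k : nat) (e : 'rV[R]_d) : 'rV[R]_d := \row_i (if (i < k)%N then e 0 i else 0).

Lemma truncS (i : 'I_d) (e : 'rV[R]_d) : trunc i.+1 e = trunc i e + e 0 i *: ei i.
Proof.
apply/rowP => j; rewrite !mxE eqxx/= ltnS leq_eqVlt val_eqE.
by case: eqVneq => [->|_] /=; rewrite ?ltnn ?mulr1 ?add0r// mulr0 addr0.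
Qed.

Lemma telescope_coordinates v y (e : 'rV[R]_d) :
  v (y + e) - v y = \sum_(i < d) (v (y + trunc i e + e 0 i *: ei i) - v (y + trunc i e)).
Proof.
have t0 : trunc 0 e = 0 by apply/rowP => j; rewrite !mxE.
have td : trunc d e = e by apply/rowP => j; rewrite !mxE ltn_ord.
rewrite -[in v (y + e)]td -[X in _ - v X]addr0 -[X in _ - v (y + X)]t0.
rewrite -(telescope_sumr (fun k => v (y + trunc k e)))// big_mkord.
by apply: eq_bigr => i _; rewrite truncS addrA.
Qed.

Lemma norm_coord_le x (i : 'I_d) : `|x 0 i| <= `|x|.
Proof.
rewrite [leRHS]/Num.norm/= mx_normrE.
exact: (@le_bigmax _ _ _ _ (fun ij : 'I_1 * 'I_d => `|x ij.1 ij.2|) (0, i)).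
Qed.

Lemma norm_trunc_le (k : nat) (e : 'rV[R]_d) : `|trunc k e| <= `|e|.
Proof.
rewrite [leLHS]/Num.norm/= mx_normrE; apply: bigmax_le => [|[i j] _ /=]; first exact: normr_ge0.
rewrite mxE; case: ifP => _; last by rewrite normr0.
exact: norm_coord_le.
Qed.

Lemma norm_ei (i : 'I_d) : `|ei i : 'rV[R]_d| <= 1.
Proof.
rewrite [leLHS]/Num.norm/= mx_normrE; apply: bigmax_le => [|[j k] _ /=]; first exact: ler01.
by rewrite mxE; case: (_ && _); rewrite ?normr1 ?normr0.
Qed.

(** The increment is split along the coordinates, and each piece is bounded by the mean value
    theorem: [v] is Lipschitz with constant [M * d] in the maximum norm, hence Hölder with exponent
    [1]. *)
Lemma bounded_partials_holder v (g : 'I_d -> 'rV[R]_d -> R) (M : R) :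
  (forall i, has_partial i v (g i)) -> (forall i x, `|g i x| <= M) -> holder v.
Proof.
move=> Hv gM; exists (M * d%:R), 1; split; first by rewrite ltr01 lexx.
move=> x y; rewrite powRr1//.
rewrite (_ : x = y + (x - y)); last by rewrite addrC subrK.
set e := x - y; rewrite telescope_coordinates addrAC subrr add0r.
rewrite (le_trans (ler_norm_sum _ _ _))//.
rewrite (@le_trans _ _ (\sum_(i < d) (M * `|e|)))//; last first.
  by rewrite sumr_const card_ord -mulr_natr; lra.
apply: ler_sum => i _.
have [c _ ->] := mean_value_line (y + trunc i e) (e 0 i) (Hv i).
by rewrite normrM mulrC ler_pM// norm_coord_le.
Qed.

(** A Landau-type inequality: over a unit step the increment of [v] equals [g] at an intermediate
    point, which differs from [g x] by at most the bound on [h]. *)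
Lemma bounded_partial i v g h (M M' : R) : has_partial i v g -> has_partial i g h ->
  (forall x, `|v x| <= M) -> (forall x, `|h x| <= M') -> forall x, `|g x| <= 2 * M + M'.
Proof.
move=> Hv Hg vM hM x.
have [c c1 Ec] := mean_value_line x 1 Hv.
have [b _ Eb] := mean_value_line x c Hg.
have -> : g x = v (x + 1 *: ei i) - v x - c * h (x + b *: ei i) by rewrite Ec -Eb; ring.
rewrite normr1 in c1.
have B1 := ler_normB (v (x + 1 *: ei i) - v x) (c * h (x + b *: ei i)).
have B2 := ler_normB (v (x + 1 *: ei i)) (v x).
have B3 : `|c * h (x + b *: ei i)| <= 1 * M' by rewrite normrM ler_pM.
have := vM x; have := vM (x + 1 *: ei i).
by lra.
Qed.

Lemma holder_continuous v : holder v -> continuous v.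
Proof.
move=> [C [a [/andP[a0 _] H]]] x; have FF := @nbhs_filter _ x; apply/(@cvgrPdist_lt _ _ _ (nbhs x) FF) => e e0.
pose C' := `|C| + 1; have C0 : 0 < C' by rewrite ltr_wpDl.
have ec : 0 < e / C' by rewrite divr_gt0.
near=> y.
rewrite (le_lt_trans (H x y))// (@le_lt_trans _ _ (C' * `|x - y| `^ a))//.
  by rewrite ler_wpM2r ?powR_ge0// /C' (le_trans (ler_norm C))// lerDl.
rewrite mulrC -ltr_pdivlMr//.
have -> : e / C' = ((e / C') `^ a^-1) `^ a by rewrite -powRrM mulVf ?powRr1 ?gt_eqF// ltW.
rewrite gt0_ltr_powR// ?nnegrE ?powR_ge0//.
near: y; apply: (@cvgr_dist_lt _ _ _ (nbhs x) FF id x cvg_id); exact: powR_gt0.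
Unshelve. all: by end_near. Qed.

End coordinate_derivatives.

(** * Gaussian vectors and the heat semigroup *)

Section euclidean_measurability.
Context {R : realType} {d : nat}.

Lemma Rd_mfun_coord (i : 'I_d) : Rd_mfun (fun v : 'rV[R]_d => v 0 i).
Proof. by apply: continuous_Rd_mfun; exact: coord_continuous. Qed.

Lemma Rd_mfunM (g h : 'rV[R]_d -> R) : Rd_mfun g -> Rd_mfun h -> Rd_mfun (fun v => g v * h v).
Proof. by move=> /Rd_mfunP mg /Rd_mfunP mh; apply/Rd_mfunP; exact: measurable_funM. Qed.

Lemma Rd_mfun_affine (g : 'rV[R]_d -> R) (c : R) (x : 'rV[R]_d) :
  Rd_mfun g -> Rd_mfun (fun v => g (x + c *: v)).
Proof.
move=> /Rd_mfunP mg; apply/Rd_mfunP.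
have mY : measurable_fun [set: borelRd] ((fun v : borelRd => x + c *: v) : borelRd -> borelRd).
  apply: measurable_fun_borelRd => i.
  rewrite (_ : (fun v => _) = (fun v : 'rV[R]_d => x 0 i + c * v 0 i)); last first.
    by apply/funext => v; rewrite !mxE.
  apply/Rd_mfunP; apply: Rd_mfunD; first exact: cst_Rd_mfun.
  by apply: Rd_mfunZ; exact: Rd_mfun_coord.
exact: (measurableT_comp mg mY).
Qed.

Lemma Rd_mfun_vector {d1 : measure_display} {T : measurableType d1} (g : 'rV[R]_d -> R)
    (Y : T -> 'rV[R]_d) : Rd_mfun g -> (forall i, measurable_fun setT (fun w => Y w 0 i)) ->
  measurable_fun setT (fun w => g (Y w)).
Proof.
move=> /Rd_mfunP mg mY.
exact: (measurableT_comp mg (measurable_fun_borelRd mY)).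
Qed.

End euclidean_measurability.

(** * Standard Gaussian vectors: moments, resampling, Cameron-Martin shifts and sign flips *)

Section gaussian_vector.
Context {d0 : measure_display} {Om : measurableType d0} {R : realType} {d : nat}.
Variables (P : probability Om R) (Z : Om -> 'rV[R]_d).
Notation N := (@normal_prob R 0 1).

Definition std_gaussian : Prop :=
  (forall i, measurable_fun setT (fun w => Z w 0 i)) /\
  forall A, (forall i, measurable (A i)) -> P (Z @^-1` box A) = (\prod_(i < d) N (A i))%E.

Hypothesis ZG : std_gaussian.

Let mZ : forall i, measurable_fun setT (fun w => Z w 0 i). Proof. by case: ZG. Qed.

Lemma gaussian_coord_law (i : 'I_d) (A : set R) : measurable A ->
  P ((fun w => Z w 0 i) @^-1` A) = N A.
Proof.
move=> mA; have [_ LZ] := ZG.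
have := LZ (fun j => if j == i then A else setT).
rewrite (_ : Z @^-1` box _ = (fun w => Z w 0 i) @^-1` A); last first.
  apply/seteqP; split => w /=; first by move=> /(_ i); rewrite eqxx.
  by move=> Aw j; case: eqVneq => // ->.
move=> ->; last by move=> j; case: ifP.
rewrite (bigD1 i)//= eqxx big1 ?mule1// => j /negbTE ->.
exact: (@probability_setT _ _ _ N).
Qed.

Lemma ge0_integral_gaussian_coord (i : 'I_d) (h : R -> R) : measurable_fun setT h ->
  (forall z, 0 <= h z) ->
  (\int[P]_w (h (Z w 0 i))%:E = \int[N]_z (h z)%:E)%E.
Proof.
move=> mh h0.
have mZi : @measurable_fun _ _ Om (measurableTypeR R) setT (fun w => Z w 0 i) by exact: mZ.
have mh' : @measurable_fun _ _ (measurableTypeR R) _ setT (fun z : R => (h z)%:E).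
  by apply/measurable_EFinP.
rewrite -(@ge0_integral_law _ _ _ _ _ P _ mZi (fun z => (h z)%:E))//.
by apply: eq_measure_integral => A mA _; exact: gaussian_coord_law.
Qed.

Lemma integrable_gaussian_coord (i : 'I_d) (h : R -> R) : measurable_fun setT h ->
  N.-integrable setT (EFin \o h) -> P.-integrable setT (EFin \o (fun w => h (Z w 0 i))).
Proof.
move=> mh /integrableP[_ ih]; apply/integrableP; split.
  apply/measurable_EFinP.
  exact: (measurableT_comp mh (mZ i)).
move: ih; rewrite -(ge0_integral_gaussian_coord i (h := fun z => `|h z|))//.
by apply: measurableT_comp.
Qed.

Lemma integrable_gaussian_exp (i : 'I_d) (c : R) :
  P.-integrable setT (EFin \o (fun w => expR (c * `|Z w 0 i|))).
Proof.
apply: (@integrable_gaussian_coord i (fun z => expR (c * `|z|))).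
  by apply: measurableT_comp => //; apply: measurable_funM => //; exact: measurableT_comp.
exact: integrable_normal_expR_norm.
Qed.

(** A single integrable weight that dominates all the polynomial factors in [Z] met later. *)
Definition gweight (w : Om) : R := 1 + \sum_(i < d) Z w 0 i ^+ 4.

Lemma measurable_gweight : measurable_fun setT gweight.
Proof.
apply: measurable_funD => //; apply: measurable_sum => i.
exact: measurable_funX.
Qed.

Lemma integrable_gweight : P.-integrable setT (EFin \o gweight).
Proof.
have iE i : P.-integrable setT (EFin \o (fun w => 256 * expR (1 * `|Z w 0 i|))).
  by apply: integrable_mulr => //; exact: integrable_gaussian_exp.
have iS : P.-integrable setT (EFin \o (fun w => 1 + \sum_(i < d) (256 * expR (1 * `|Z w 0 i|)))).
  rewrite (_ : EFin \o _ = (fun w => ((1 : R)%:E + \sum_(i < d) (256 * expR (1 * `|Z w 0 i|))%:E)%E)).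
    apply: integrableD => //; first exact: finite_measure_integrable_cst.
    by apply: integrable_sum => // i _; exact: iE.
  by apply/funext => w /=; rewrite EFinD sumEFin.
apply: le_integrable iS => //.
  by apply/measurable_EFinP; exact: measurable_gweight.
move=> w _; rewrite /= lee_fin /gweight.
have S1 : 0 <= \sum_(i < d) Z w 0 i ^+ 4 by apply: sumr_ge0 => i _; rewrite exprn_even_ge0.
have S2 : \sum_(i < d) Z w 0 i ^+ 4 <= \sum_(i < d) (256 * expR (1 * `|Z w 0 i|)).
  by apply: ler_sum => i _; rewrite mul1r expr4_le_expR.
by rewrite !ger0_norm; lra.
Qed.

(** The norm is the maximum norm, so it is attained at some coordinate, whose fourth power is one of
    the summands. *)
Lemma norm4_le_gweight w : 1 + `|Z w| ^+ 4 <= gweight w.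
Proof.
rewrite lerD2l; set n := `|Z w|.
have S0 : 0 <= \sum_(i < d) Z w 0 i ^+ 4 by apply: sumr_ge0 => i _; rewrite exprn_even_ge0.
have [n0|n0] := eqVneq n 0; first by rewrite n0 expr0n.
have [[j i] /= E] := @mx_norm_neq0 _ _ _ (Z w) n0.
have {}E : n = `|Z w 0 i| by rewrite /n -(ord1 j).
rewrite E (bigD1 i)//= -normrX ger0_norm ?exprn_even_ge0// lerDl.
by apply: sumr_ge0 => k _; rewrite exprn_even_ge0.
Qed.

Definition setc (i : 'I_d) (v : 'rV[R]_d) (z : R) : 'rV[R]_d :=
  \row_j (if j == i then z else v 0 j).

Lemma measurable_setc (i : 'I_d) :
  measurable_fun setT ((fun p : Om * measurableTypeR R => setc i (Z p.1) p.2) : _ -> borelRd).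
Proof.
apply: measurable_fun_borelRd => j.
rewrite (_ : (fun p : Om * measurableTypeR R => _) =
  (fun p => if j == i then p.2 else Z p.1 0 j)); last by apply/funext => p; rewrite mxE.
case: (j == i); first exact: measurable_snd.
exact: (measurableT_comp (mZ j) measurable_fst).
Qed.

(** Replacing the [i]-th coordinate by an independent normal variable does not change the law of
    [Z]: this is visible on boxes. Tonelli then isolates a one-dimensional normal integral. *)
Lemma ge0_gaussian_split (i : 'I_d) (G : 'rV[R]_d -> R) : Rd_mfun G -> (forall v, 0 <= G v) ->
  (\int[P]_w (G (Z w))%:E = \int[P]_w \int[N]_z (G (setc i (Z w) z))%:E)%E.
Proof.
move=> mG G0; have [_ LZ] := ZG.
have mZb : measurable_fun setT (Z : Om -> borelRd) by exact: measurable_fun_borelRd.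
have mE : measurable_fun setT (fun v : borelRd => (G v)%:E).
  by apply/measurable_EFinP; exact/Rd_mfunP.
have E0 (v : borelRd) : (0 <= (G v)%:E)%E by rewrite lee_fin.
rewrite -(@ge0_integral_law _ _ _ _ _ P _ mZb (fun v => (G v)%:E))//.
transitivity (\int[law (P \x N)%E (measurable_setc i)]_v (G v)%:E)%E.
  apply: eq_measure_integral => C mC _.
  apply: (@borelRd_measure_unique _ _ (law P mZb) (law (P \x N)%E (measurable_setc i))) => //.
    by rewrite law_setT ltry.
  move=> A mA; rewrite (lawE P mZb) (lawE (P \x N)%E (measurable_setc i)) [LHS]LZ//.
  rewrite (_ : _ @^-1` box A =
    (Z @^-1` box (fun j => if j == i then setT else A j)) `*` A i); last first.
    apply/seteqP; split => -[w z] /=.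
      move=> H; split; last by have := H i; rewrite mxE eqxx.
      by move=> j; have := H j; rewrite mxE; case: eqP.
    by move=> [H1 H2] j; rewrite mxE; have := H1 j; case: eqVneq => // ->.
  have mA' j : measurable (if j == i then setT else A j) by case: ifP.
  set E := Z @^-1` _; have mE' : measurable E.
    by have := mZb measurableT _ (measurable_box mA'); rewrite setTI.
  rewrite [RHS]product_measure1E//; last exact: mA.
  have PE : P E = (\prod_(j < d) N (if j == i then setT else A j))%E by exact: LZ.
  transitivity (P E * N (A i))%E; last by [].
  rewrite PE (bigD1 i)//= [in RHS](bigD1 i)//= eqxx.
  rewrite [X in ((X * _) * _)%E](@probability_setT _ _ _ N) mul1e muleC; congr (_ * _)%E.
  by apply: eq_bigr => j /negbTE ->.
rewrite ge0_integral_law//.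
have mF := measurableT_comp mE (measurable_setc i).
by apply: (eq_trans (fubini_tonelli1 (m1 := P) (m2 := N) _ mF _)) => // -[w z]; exact: E0.
Qed.

Lemma ge0_cameron_martin (i : 'I_d) (a : R) (G : 'rV[R]_d -> R) : Rd_mfun G -> (forall v, 0 <= G v) ->
  (\int[P]_w (G (Z w + a *: ei i))%:E =
   \int[P]_w (G (Z w) * expR (a * Z w 0 i - a ^+ 2 / 2))%:E)%E.
Proof.
move=> mG G0.
rewrite (ge0_gaussian_split i (G := fun v => G (v + a *: ei i)))//; last first.
  rewrite (_ : (fun v => _) = (fun v => G (a *: ei i + 1 *: v))); first exact: Rd_mfun_affine.
  by apply/funext => v; rewrite scale1r addrC.
rewrite (ge0_gaussian_split i (G := fun v => G v * expR (a * v 0 i - a ^+ 2 / 2))); last 2 first.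
- apply: Rd_mfunM => //; apply/Rd_mfunP; apply: measurableT_comp => //; apply/Rd_mfunP.
  apply: Rd_mfunB; last exact: cst_Rd_mfun.
  by apply: Rd_mfunZ; exact: Rd_mfun_coord.
- by move=> v; rewrite mulr_ge0// expR_ge0.
apply: eq_integral => w _.
have mGz : measurable_fun setT (fun z => G (setc i (Z w) z)).
  apply: (@Rd_mfun_vector _ _ _ (measurableTypeR R)) => // j.
  rewrite (_ : (fun z => _) = (fun z => if j == i then z else Z w 0 j)); last by apply/funext => z; rewrite mxE.
  by case: (j == i); [exact: measurable_id|exact: measurable_cst].
transitivity (\int[N]_z (G (setc i (Z w) (z + a)))%:E)%E.
  apply: eq_integral => z _; congr ((G _)%:E); apply/rowP => j; rewrite !mxE eqxx/=.
  by case: eqVneq => _; rewrite ?mulr1// mulr0 addr0.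
rewrite (@ge0_integral_normal_shift _ a (fun z => G (setc i (Z w) z)))//.
by apply: eq_integral => z _; rewrite mxE eqxx.
Qed.

(** Positive and negative parts are treated separately: the density is nonnegative, so it can be
    moved in and out of [Num.max]. *)
Lemma cameron_martin (i : 'I_d) (a : R) (G : 'rV[R]_d -> R) : Rd_mfun G ->
  \int[P]_w G (Z w + a *: ei i) =
  \int[P]_w (G (Z w) * expR (a * Z w 0 i - a ^+ 2 / 2)).
Proof.
move=> mG; rewrite /Rintegral integralE [in RHS]integralE; congr (fine (_ - _)%E).
- have mp : Rd_mfun (fun v => Num.max (G v) 0).
    by apply/Rd_mfunP; apply: measurable_maxr => //; exact/Rd_mfunP.
  transitivity (\int[P]_w (Num.max (G (Z w + a *: ei i)) 0)%:E)%E.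
    by apply: eq_integral => w _; rewrite funeposE/= EFin_max.
  rewrite (ge0_cameron_martin i a mp); last by move=> v; rewrite le_max lexx orbT.
  apply: eq_integral => w _; rewrite funeposE/= -EFin_max; congr (_%:E).
  by rewrite maxr_pMl ?expR_ge0// mul0r.
- have mp : Rd_mfun (fun v => Num.max (- G v) 0).
    apply/Rd_mfunP; apply: measurable_maxr => //; apply: measurableT_comp => //; exact/Rd_mfunP.
  transitivity (\int[P]_w (Num.max (- G (Z w + a *: ei i)) 0)%:E)%E.
    by apply: eq_integral => w _; rewrite funenegE/= EFin_max.
  rewrite (ge0_cameron_martin i a mp); last by move=> v; rewrite le_max lexx orbT.
  apply: eq_integral => w _; rewrite funenegE/= -EFin_max; congr (_%:E).
  by rewrite maxr_pMl ?expR_ge0// mul0r mulNr.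
Qed.

Definition flipc (i : 'I_d) (v : 'rV[R]_d) : 'rV[R]_d :=
  \row_j (if j == i then - v 0 j else v 0 j).

Lemma gaussian_flip (i : 'I_d) (G : 'rV[R]_d -> R) : Rd_mfun G ->
  \int[P]_w G (flipc i (Z w)) = \int[P]_w G (Z w).
Proof.
have [_ LZ] := ZG.
apply: integral_same_law => //.
  move=> j; rewrite (_ : (fun w => _) = (fun w => if j == i then - Z w 0 j else Z w 0 j)); last first.
    by apply/funext => w; rewrite mxE.
  by case: (j == i) => //; exact: measurableT_comp.
move=> A mA.
have mN (B : set R) : measurable B -> measurable ((fun z : R => - z) @^-1` B).
  move=> mB; rewrite -[X in measurable X]setTI.
  exact: (@oppr_measurable R setT measurableT B mB).
rewrite (_ : _ @^-1` box A = Z @^-1` box (fun j => if j == i then (fun z : R => - z) @^-1` A j else A j)).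
  rewrite !LZ//; last by move=> j; case: ifP => // _; exact: mN.
  by apply: eq_bigr => j _; case: ifP => // _; rewrite normal_probN.
by apply/seteqP; split => w H j; have := H j; rewrite /= !mxE; case: eqP.
Qed.

End gaussian_vector.

(** The form in which continuity passes through dominated convergence. *)
Definition seq_continuous {R : realType} {d : nat} (g : 'rV[R]_d -> R) : Prop :=
  forall (y : nat -> 'rV[R]_d) (x : 'rV[R]_d), y n @[n --> \oo] --> x -> g (y n) @[n --> \oo] --> g x.

Lemma continuous_seq_continuous {R : realType} {d : nat} (g : 'rV[R]_d -> R) :
  continuous g -> seq_continuous g.
Proof. by move=> cg y x yx; apply: (cvg_comp _ _ yx); exact: cg. Qed.

(** * Smoothing by the heat semigroup at positive times *)

Section heat_semigroup.
Context {d0 : measure_display} {Om : measurableType d0} {R : realType} {d : nat}.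
Variables (P : probability Om R) (Z : Om -> 'rV[R]_d).
Notation N := (@normal_prob R 0 1).
Notation Rpos := (`]0%R, +oo[%classic : set (measurableTypeR R)).
Hypothesis ZG : std_gaussian P Z.

Let mZ : forall i, measurable_fun setT (fun w => Z w 0 i). Proof. by case: ZG. Qed.

Definition heat (s : R) (g : 'rV[R]_d -> R) (x : 'rV[R]_d) : R :=
  \int[P]_w g (x + Num.sqrt s *: Z w).

Lemma measurable_heat (g : 'rV[R]_d -> R) (x : 'rV[R]_d) (s : R) : Rd_mfun g ->
  measurable_fun setT (fun w => g (x + Num.sqrt s *: Z w)).
Proof. by move=> mg; apply: (Rd_mfun_vector (Rd_mfun_affine _ _ mg)). Qed.

Lemma heat_partial (i : 'I_d) (v g : 'rV[R]_d -> R) (s : R) : bddf v -> Rd_mfun v ->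
  bddf g -> has_partial i v g -> has_partial i (heat s v) (heat s g).
Proof.
move=> [Mv vM] mv [Mg gM] Hv x; apply: line_is_derive.
have E (u : 'rV[R]_d -> R) (r : R) : heat s u (x + r *: ei i) =
    \int[P]_w u ((x + Num.sqrt s *: Z w) + r *: ei i).
  by apply: eq_Rintegral => w _; rewrite addrAC.
rewrite (_ : (fun r => _) = (fun r : R => \int[P]_w v ((x + Num.sqrt s *: Z w) + r *: ei i))); last first.
  by apply/funext => r; rewrite E.
have -> : heat s g x = \int[P]_w g ((x + Num.sqrt s *: Z w) + 0 *: ei i).
  by rewrite -E scale0r addr0.
apply: (@is_derive_under_integral _ _ _ P setT
  (fun r w => v ((x + Num.sqrt s *: Z w) + r *: ei i))
  (fun r w => g ((x + Num.sqrt s *: Z w) + r *: ei i)) 0 (-1) 1 (cst Mg)) => //.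
- by rewrite ltrN10 ltr01.
- move=> r _; apply: (@bounded_integrable _ _ _ _ _ _ Mv) => //.
  rewrite (_ : (fun w => _) = (fun w => v ((x + r *: ei i) + Num.sqrt s *: Z w))).
    exact: measurable_heat.
  by apply/funext => w; rewrite addrAC.
- by move=> r w _ _; exact: has_partial_line.
- exact: finite_measure_integrable_cst.
Qed.

Section positive_time.
Variables (i : 'I_d) (g : 'rV[R]_d -> R) (s : R) (M : R).
Hypotheses (s0 : 0 < s) (mg : Rd_mfun g) (gM : forall x, `|g x| <= M).
Let al : R := (Num.sqrt s)^-1.
Let al0 : 0 < al. Proof. by rewrite invr_gt0 sqrtr_gt0. Qed.

(** Moving [x] by [r] along a coordinate amounts to moving [Z] by [al * r]. The associated density
    carries all the dependence on [r], so differentiating in [r] costs nothing on [g]. *)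
Definition cm_density (r z : R) : R := expR (al * r * z - (al * r) ^+ 2 / 2).

Lemma is_derive_cm_density (r z : R) : is_derive r 1 (cm_density ^~ z) ((al * z - al ^+ 2 * r) * cm_density r z).
Proof.
have D : is_derive r 1 (fun r : R => al * r * z - (al * r) ^+ 2 / 2) (al * z - al ^+ 2 * r).
  by apply: is_derive_eq; rewrite /GRing.scale/=; field.
have := @is_derive1_comp _ expR _ r _ _ (is_derive_expR _) D.
by rewrite mulrC.
Qed.

Lemma is_derive2_cm_density (r z : R) : is_derive r 1 (fun r => (al * z - al ^+ 2 * r) * cm_density r z)
  (((al * z - al ^+ 2 * r) ^+ 2 - al ^+ 2) * cm_density r z).
Proof.
have D := is_derive_cm_density r z.
have D' : is_derive r 1 (fun r : R => al * z - al ^+ 2 * r) (- al ^+ 2).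
  by apply: is_derive_eq; rewrite /GRing.scale/=; ring.
have := is_deriveM D' D; rewrite /GRing.scale/= => H.
by apply: is_derive_eq; rewrite /GRing.scale/=; ring.
Qed.

(** Dominating functions valid for all [r] in the window at once: the density costs one factor
    [expR (al * |z|)], and every power of the linear prefactor costs one more by
    [1 + t <= expR t]. *)
Lemma cm_density_bounds (r z : R) : -1 < r < 1 -> [/\ 0 <= cm_density r z <= expR (al * `|z|),
  `|(al * z - al ^+ 2 * r) * cm_density r z| <= (1 + al ^+ 2) * expR (2 * al * `|z|) &
  `|((al * z - al ^+ 2 * r) ^+ 2 - al ^+ 2) * cm_density r z| <=
    ((1 + al ^+ 2) ^+ 2 + al ^+ 2) * expR (3 * al * `|z|)].
Proof.
move=> /andP[r1 r2].
set t := al * `|z|; have t0 : 0 <= t by rewrite mulr_ge0// ltW.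
have e1 : 1 <= expR t by rewrite -expR0 ler_expR.
have et : 1 + t <= expR t by exact: expR_ge1Dx.
have c0 : 0 <= cm_density r z by exact: expR_ge0.
have rz : r * z <= `|z|.
  rewrite (le_trans (ler_norm _))// normrM ler_piMl// ler_norml; lra.
have c1 : cm_density r z <= expR t.
  rewrite ler_expR; have := sqr_ge0 (al * r).
  have : al * (r * z) <= t by rewrite ler_wpM2l// ltW.
  by rewrite mulrA; lra.
have a2 : 0 <= al ^+ 2 by rewrite sqr_ge0.
have l1 : `|al * z - al ^+ 2 * r| <= (1 + al ^+ 2) * expR t.
  have B := ler_normB (al * z) (al ^+ 2 * r).
  have B1 : `|al * z| = t by rewrite normrM (gtr0_norm al0).
  have B2 : `|al ^+ 2 * r| <= al ^+ 2.
    by rewrite normrM (ger0_norm a2) ler_piMr// ler_norml; lra.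
  have : al ^+ 2 * 1 <= al ^+ 2 * expR t by rewrite ler_wpM2l.
  by lra.
have E2 : expR (2 * al * `|z|) = expR t * expR t by rewrite -expRD; congr expR; rewrite /t; ring.
have E3 : expR (3 * al * `|z|) = expR t * expR t * expR t.
  by rewrite -!expRD; congr expR; rewrite /t; ring.
split; first by rewrite c0.
  by rewrite normrM (ger0_norm c0) E2 mulrA ler_pM.
rewrite normrM (ger0_norm c0) E3 mulrA ler_pM//.
rewrite (le_trans (ler_normB _ _))// normrX (ger0_norm a2).
have : `|al * z - al ^+ 2 * r| ^+ 2 <= ((1 + al ^+ 2) * expR t) ^+ 2 by rewrite lerXn2r// nnegrE ?mulr_ge0 ?expR_ge0; lra.
have : al ^+ 2 * 1 <= al ^+ 2 * (expR t * expR t) by rewrite ler_wpM2l// mulr_ege1.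
by rewrite exprMn; set q := expR t; lra.
Qed.

Lemma measurable_cm_density (r : R) (q : R -> R) : measurable_fun setT q ->
  measurable_fun setT (fun w => q (Z w 0 i) * cm_density r (Z w 0 i)).
Proof.
move=> mq; apply: measurable_funM; first exact: (measurableT_comp mq (mZ i)).
rewrite /cm_density; apply: measurableT_comp => //; apply: measurable_funB => //.
by apply: measurable_funM => //; exact: mZ.
Qed.

Lemma heat_shift (x : 'rV[R]_d) (r : R) :
  heat s g (x + r *: ei i) = \int[P]_w (g (x + Num.sqrt s *: Z w) * cm_density r (Z w 0 i)).
Proof.
have -> : heat s g (x + r *: ei i) = \int[P]_w g (x + Num.sqrt s *: (Z w + (al * r) *: ei i)).
  apply: eq_Rintegral => w _; congr g; rewrite scalerDr scalerA mulrA mulfV ?gt_eqF ?sqrtr_gt0//.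
  by rewrite mul1r addrAC addrA.
exact: (cameron_martin ZG i (al * r) (Rd_mfun_affine (Num.sqrt s) x mg)).
Qed.

Let dom (C K q : R) (w : Om) : `|q| <= C * expR (K * `|Z w 0 i|) ->
  forall x, `|g x * q| <= M * C * expR (K * `|Z w 0 i|).
Proof. by move=> H x; rewrite normrM -mulrA ler_pM. Qed.

Let iexp (C K : R) : P.-integrable setT (EFin \o (fun w => C * expR (K * `|Z w 0 i|))).
Proof. by apply: integrable_mulr => //; exact: integrable_gaussian_exp. Qed.

(** The weights of [heat1] and [heat2] are the first two derivatives of [cm_density] at [r = 0]: the
    Hermite polynomials [z] and [z ^ 2 - 1], up to powers of [al]. *)
Definition heat1 (x : 'rV[R]_d) : R := \int[P]_w (g (x + Num.sqrt s *: Z w) * (al * Z w 0 i)).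
Definition heat2 (x : 'rV[R]_d) : R :=
  \int[P]_w (g (x + Num.sqrt s *: Z w) * (al ^+ 2 * (Z w 0 i ^+ 2 - 1))).

Lemma heat_line_derive1 (x : 'rV[R]_d) (a : R) : -1 < a < 1 ->
  is_derive a 1 (fun r : R => heat s g (x + r *: ei i))
    (\int[P]_w (g (x + Num.sqrt s *: Z w) * ((al * Z w 0 i - al ^+ 2 * a) * cm_density a (Z w 0 i)))).
Proof.
move=> a1.
rewrite (_ : (fun r => _) = (fun r : R => \int[P]_w (g (x + Num.sqrt s *: Z w) * cm_density r (Z w 0 i)))); last first.
  by apply/funext => r; exact: heat_shift.
apply: (@is_derive_under_integral _ _ _ P setT
  (fun r w => g (x + Num.sqrt s *: Z w) * cm_density r (Z w 0 i))
  (fun r w => g (x + Num.sqrt s *: Z w) * ((al * Z w 0 i - al ^+ 2 * r) * cm_density r (Z w 0 i)))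
  a (-1) 1 (fun w => M * (1 + al ^+ 2) * expR (2 * al * `|Z w 0 i|))) => //.
- move=> r r1; apply: (le_integrable _ _ _ (iexp (M * 1) al)) => //.
    apply/measurable_EFinP; apply: measurable_funM; first exact: measurable_heat.
    have := @measurable_cm_density r (fun=> 1) (@measurable_cst _ _ _ _ _ _).
    by apply: eq_measurable_fun => w _; rewrite mul1r.
  move=> w _; rewrite /= lee_fin [leRHS]ger0_norm; last first.
    by rewrite mulr_ge0 ?expR_ge0// mulr1 (le_trans _ (gM 0)).
  by apply: dom; have [/andP[c0 c1] _ _] := cm_density_bounds (Z w 0 i) r1; rewrite ger0_norm ?mul1r.
- move=> r w _ _; exact: is_deriveZ (is_derive_cm_density r (Z w 0 i)).
- by move=> r w r1 _; apply: dom; have [_ b _] := cm_density_bounds (Z w 0 i) r1.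
Qed.

Lemma heat_has_partial1 : has_partial i (heat s g) heat1.
Proof.
move=> x; apply: line_is_derive.
have z1 : -1 < (0 : R) < 1 by rewrite ltrN10 ltr01.
have := heat_line_derive1 x z1; congr is_derive.
apply: eq_Rintegral => w _.
by rewrite /cm_density !mulr0 subr0 mul0r expr0n/= mul0r subr0 expR0 mulr1.
Qed.

(** Near [x], uniqueness of the derivative identifies [heat1] along the line with the integral [H]
    against the fixed vector [Z], and [H] can be differentiated once more under the integral. *)
Lemma heat_has_partial2 : has_partial i heat1 heat2.
Proof.
move=> x; apply: line_is_derive.
pose H (a : R) := \int[P]_w (g (x + Num.sqrt s *: Z w) * ((al * Z w 0 i - al ^+ 2 * a) * cm_density a (Z w 0 i))).
have z1 : -1 < (0 : R) < 1 by rewrite ltrN10 ltr01.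
have HE (a : R) : -1 < a < 1 -> H a = heat1 (x + a *: ei i).
  move=> a1; rewrite /H; have [_ <-] := heat_line_derive1 x a1.
  by have [_ ->] := has_partial_line x a heat_has_partial1.
have nH : {near (0 : R), H =1 (fun a : R => heat1 (x + a *: ei i))}.
  near=> a; apply: HE; apply/andP; split; near: a.
  - by apply: lt_nbhsr; rewrite ltrN10.
  - by apply: lt_nbhsl; rewrite ltr01.
apply: (near_eq_is_derive nH) => //.
have -> : heat2 x = \int[P]_w (g (x + Num.sqrt s *: Z w) *
    (((al * Z w 0 i - al ^+ 2 * 0) ^+ 2 - al ^+ 2) * cm_density 0 (Z w 0 i))).
  apply: eq_Rintegral => w _; congr (_ * _).
  by rewrite /cm_density !mulr0 mul0r expr0n/= mul0r !subr0 expR0; ring.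
apply: (@is_derive_under_integral _ _ _ P setT
  (fun r w => g (x + Num.sqrt s *: Z w) * ((al * Z w 0 i - al ^+ 2 * r) * cm_density r (Z w 0 i)))
  (fun r w => g (x + Num.sqrt s *: Z w) * (((al * Z w 0 i - al ^+ 2 * r) ^+ 2 - al ^+ 2) * cm_density r (Z w 0 i)))
  0 (-1) 1 (fun w => M * ((1 + al ^+ 2) ^+ 2 + al ^+ 2) * expR (3 * al * `|Z w 0 i|))) => //.
- move=> r r1; apply: (le_integrable _ _ _ (iexp (M * (1 + al ^+ 2)) (2 * al))) => //.
    apply/measurable_EFinP; apply: measurable_funM; first exact: measurable_heat.
    apply: (@measurable_cm_density r (fun z => al * z - al ^+ 2 * r)).
    by apply: measurable_funB => //; exact: measurable_funM.
  move=> w _; rewrite /= lee_fin [leRHS]ger0_norm; last first.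
    rewrite mulr_ge0 ?expR_ge0// mulr_ge0 ?(le_trans _ (gM 0))//.
    by rewrite addr_ge0 ?sqr_ge0.
  by apply: dom; have [_ b _] := cm_density_bounds (Z w 0 i) r1.
- move=> r w _ _; exact: is_deriveZ (is_derive2_cm_density r (Z w 0 i)).
- by move=> r w r1 _; apply: dom; have [_ _ b] := cm_density_bounds (Z w 0 i) r1.
Unshelve. all: by end_near. Qed.

End positive_time.

End heat_semigroup.

(** * Time averages of the heat semigroup *)

Section heat_average.
Context {d0 : measure_display} {Om : measurableType d0} {R : realType} {d : nat}.
Variables (P : probability Om R) (Z : Om -> 'rV[R]_d).
Notation N := (@normal_prob R 0 1).
Notation Rpos := (`]0%R, +oo[%classic : set (measurableTypeR R)).
Hypothesis ZG : std_gaussian P Z.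
Notation heat := (heat P Z).
Notation gweight := (gweight Z).

Let mZ : forall i, measurable_fun setT (fun w => Z w 0 i). Proof. by case: ZG. Qed.
Let B0 : R := \int[P]_w gweight w.

Lemma gweight_ge1 (w : Om) : 1 <= gweight w.
Proof. by rewrite lerDl; apply: sumr_ge0 => i _; rewrite exprn_even_ge0. Qed.

(** Each power [n ^ k] with [k <= 4] is at most [1 + n ^ 4], so the four terms of
    [(1 + n) (n ^ 2 + 1)] give the constant [4]. The factor [1 + |Z|] makes room for a Hölder
    increment. *)
Lemma gweight_bounds (i : 'I_d) (w : Om) :
  `|Z w 0 i| <= gweight w /\ (1 + `|Z w|) * `|Z w 0 i ^+ 2 - 1| <= 4 * gweight w.
Proof.
have n4 := norm4_le_gweight Z w; have zn := norm_coord_le (Z w) i.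
set n := `|Z w| in n4 zn *; have n0 : 0 <= n by exact: normr_ge0.
have bk k : (k <= 4)%N -> n ^+ k <= 1 + n ^+ 4.
  move=> k4; have [n1|n1] := lerP n 1.
    by apply: (@le_trans _ _ 1); [exact: exprn_ile1|rewrite lerDl exprn_ge0].
  by rewrite (le_trans (ler_weXn2l (ltW n1) k4))// lerDr.
have b1 := bk 1%N isT; have b2 := bk 2%N isT; have b3 := bk 3%N isT; rewrite expr1 in b1.
have n40 : 0 <= n ^+ 4 by rewrite exprn_ge0.
split; first by lra.
have z2 : `|Z w 0 i ^+ 2 - 1| <= n ^+ 2 + 1.
  rewrite (le_trans (ler_normB _ _))// normr1 lerD2r normrX lerXn2r// nnegrE//.
have : (1 + n) * `|Z w 0 i ^+ 2 - 1| <= (1 + n) * (n ^+ 2 + 1) by rewrite ler_wpM2l// addr_ge0.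
by rewrite (_ : (1 + n) * (n ^+ 2 + 1) = 1 + n + n ^+ 2 + n ^+ 3); [lra|ring].
Qed.

Section weighted.
Variables (g : 'rV[R]_d -> R) (p : Om -> R) (M K : R).
Hypotheses (mg : Rd_mfun g) (gM : forall x, `|g x| <= M).
Hypotheses (mp : measurable_fun setT p) (pK : forall w, `|p w| <= K * gweight w).

Let gp_bound (x : 'rV[R]_d) (w : Om) : `|g x * p w| <= M * K * gweight w.
Proof. by rewrite normrM -mulrA ler_pM. Qed.

Let iW (C : R) : P.-integrable setT (EFin \o (fun w => C * gweight w)).
Proof. by apply: integrable_mulr => //; exact: integrable_gweight. Qed.

Lemma weighted_bound (x : 'rV[R]_d) (s : R) :
  P.-integrable setT (EFin \o (fun w => g (x + Num.sqrt s *: Z w) * p w)) /\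
  `|\int[P]_w (g (x + Num.sqrt s *: Z w) * p w)| <= M * K * B0.
Proof.
have [] := @le_normr_Rintegral_dominated _ _ _ P setT
  (fun w => g (x + Num.sqrt s *: Z w) * p w) (fun w => M * K * gweight w) => //.
  by apply: measurable_funM => //; exact: (measurable_heat ZG).
rewrite RintegralZl//; exact: integrable_gweight.
Qed.

Lemma measurable_weighted (c : R) (x : 'rV[R]_d) : continuous g ->
  measurable_fun [set: measurableTypeR R]
    (fun z : measurableTypeR R => \int[P]_w (g (x + Num.sqrt (c * Num.max 0 z) *: Z w) * p w)).
Proof.
move=> cg.
pose F (w : Om) (z : R) := g (x + Num.sqrt (c * Num.max 0 z) *: Z w) * p w.
have jF : measurable_fun [set: Om * measurableTypeR R] (fun q => F q.1 q.2).
  apply: measurable_fun_caratheodory => [z|w z].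
    by apply: measurable_funM => //; exact: (measurable_heat ZG).
  apply: cvgM; last exact: cvg_cst.
  apply: (@continuous_comp _ _ _ (fun z : R => x + Num.sqrt (c * Num.max 0 z) *: Z w) g); last exact: cg.
  apply: cvgD; first exact: cvg_cst.
  apply: cvgZr_tmp.
  apply: (@continuous_comp _ _ _ (fun z : R => c * Num.max 0 z) Num.sqrt); last exact: sqrt_continuous.
  apply: cvgM; first exact: cvg_cst.
  apply/cvgrPdist_lt => e e0; near=> t.
  apply: (le_lt_trans (max0_lipschitz _ _)).
  by near: t; exact: (@cvgr_dist_lt _ _ _ (nbhs z) _ id z cvg_id).
have jF' := measurableT_comp jF (@measurable_swap _ _ (measurableTypeR R) Om).
have [] := @Rintegral_fubini_dominated _ _ (measurableTypeR R) Om R N P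
  (fun z w => F w z) (fun w => M * K * gweight w) setT => //.
by move=> z w _; exact: gp_bound.
Unshelve. all: by end_near. Qed.

Lemma integrable_weighted (c : R) (x : 'rV[R]_d) (q b : R -> R) : continuous g ->
  measurable_fun Rpos q -> N.-integrable Rpos (EFin \o b) ->
  (forall z : R, 0 < z ->
     `|q z * \int[P]_w (g (x + Num.sqrt (c * z) *: Z w) * p w)| <= b z) ->
  N.-integrable Rpos
    (EFin \o (fun z => q z * \int[P]_w (g (x + Num.sqrt (c * z) *: Z w) * p w))).
Proof.
move=> cg mq ib H; apply: (le_integrable _ _ _ ib) => //.
  apply/measurable_EFinP.
  apply: (@eq_measurable_fun _ _ _ _ Rpos (fun z =>
    q z * \int[P]_w (g (x + Num.sqrt (c * Num.max 0 z) *: Z w) * p w))).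
    by move=> z; rewrite inE => z0; rewrite (Rpos_max z0).
  apply: measurable_funM; first exact: mq.
  by apply: measurable_funTS; exact: measurable_weighted.
move=> z /=; rewrite in_itv/= andbT => z0; rewrite lee_fin.
exact: le_trans (H z z0) (ler_norm _).
Qed.

Lemma weighted_seq_continuous (s : R) : continuous g ->
  seq_continuous (fun x => \int[P]_w (g (x + Num.sqrt s *: Z w) * p w)).
Proof.
move=> cg y x yx.
apply: (@Rintegral_dominated_cvg _ _ _ P setT
  (fun n w => g (y n + Num.sqrt s *: Z w) * p w) _ (fun w => M * K * gweight w)) => //.
- by move=> n; apply: measurable_funM => //; exact: (measurable_heat ZG).
- move=> w _; apply: cvgM; last exact: cvg_cst.
  apply: (continuous_seq_continuous cg (y := fun n => y n + Num.sqrt s *: Z w)).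
  by apply: cvgD => //; exact: cvg_cst.
Qed.

End weighted.

Definition heat_avg (c : R) (g : 'rV[R]_d -> R) (x : 'rV[R]_d) : R :=
  \int[N]_(z in Rpos) heat (c * z) g x.

Lemma heat_weight1 (s : R) (g : 'rV[R]_d -> R) (x : 'rV[R]_d) :
  heat s g x = 1 * \int[P]_w (g (x + Num.sqrt s *: Z w) * 1).
Proof. by rewrite mul1r; apply: eq_Rintegral => w _; rewrite mulr1. Qed.

Lemma heat_bound (s : R) (g : 'rV[R]_d -> R) (M : R) (x : 'rV[R]_d) : Rd_mfun g ->
  (forall y, `|g y| <= M) -> `|heat s g x| <= M.
Proof.
move=> mg gM; rewrite -[leRHS](Rintegral_probability_cst P).
apply: (le_normr_Rintegral_dominated _ _ _ _).2 => //; last exact: finite_measure_integrable_cst.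
exact: (measurable_heat ZG).
Qed.

Lemma heat_avg_integrable (c : R) (g : 'rV[R]_d -> R) (x : 'rV[R]_d) : bddf g -> continuous g ->
  N.-integrable Rpos (EFin \o (fun z => heat (c * z) g x)).
Proof.
move=> [M gM] cg; have mg := continuous_Rd_mfun cg.
have -> : EFin \o (fun z => heat (c * z) g x) =
  EFin \o (fun z => 1 * \int[P]_w (g (x + Num.sqrt (c * z) *: Z w) * 1)).
  by apply/funext => z /=; rewrite heat_weight1.
apply: (integrable_weighted mg gM (p := fun=> 1) (K := 1) _ _ _ (b := fun=> M)) => //.
- by move=> w; rewrite normr1 mul1r gweight_ge1.
- by apply: (integrableS measurableT) => //; exact: finite_measure_integrable_cst.
- by move=> z _; rewrite -heat_weight1; exact: heat_bound.
Qed.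

Lemma heat_avg_partial (c : R) (i : 'I_d) (v g : 'rV[R]_d -> R) : bddf v -> continuous v ->
  bddf g -> continuous g -> has_partial i v g -> has_partial i (heat_avg c v) (heat_avg c g).
Proof.
move=> bv cv bg cg Hv x; apply: line_is_derive.
have [Mg gM] := bg.
have -> : heat_avg c g x = \int[N]_(z in Rpos) heat (c * z) g (x + 0 *: ei i).
  by rewrite scale0r addr0.
apply: (@is_derive_under_integral _ _ _ N Rpos
  (fun r z => heat (c * z) v (x + r *: ei i)) (fun r z => heat (c * z) g (x + r *: ei i))
  0 (-1) 1 (cst Mg)) => //.
- by rewrite ltrN10 ltr01.
- by move=> r _; exact: heat_avg_integrable.
- move=> r z _ _; apply: has_partial_line.
  by apply: heat_partial => //; exact: continuous_Rd_mfun.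
- by apply: (integrableS measurableT) => //; exact: finite_measure_integrable_cst.
- by move=> r z _ _; apply: heat_bound => //; exact: continuous_Rd_mfun.
Qed.

Lemma heat_seq_continuous (s : R) (g : 'rV[R]_d -> R) : bddf g -> continuous g ->
  seq_continuous (heat s g).
Proof.
move=> [M gM] cg y x yx; have mg := continuous_Rd_mfun cg.
apply: (@Rintegral_dominated_cvg _ _ _ P setT
  (fun n w => g (y n + Num.sqrt s *: Z w)) _ (cst M)) => //.
- by move=> n; exact: (measurable_heat ZG).
- move=> w _; apply: (continuous_seq_continuous cg (y := fun n => y n + Num.sqrt s *: Z w)).
  by apply: cvgD => //; exact: cvg_cst.
- exact: finite_measure_integrable_cst.
Qed.

Lemma heat_avg_seq_continuous (c : R) (g : 'rV[R]_d -> R) : bddf g -> continuous g ->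
  seq_continuous (heat_avg c g).
Proof.
move=> bg cg y x yx; have [M gM] := bg; have mg := continuous_Rd_mfun cg.
apply: (@Rintegral_dominated_cvg _ _ _ N Rpos (fun n z => heat (c * z) g (y n)) _ (cst M)) => //.
- by move=> n; apply/measurable_EFinP; exact: measurable_int (heat_avg_integrable c (y n) bg cg).
- by move=> z _; exact: heat_seq_continuous.
- by apply: (integrableS measurableT) => //; exact: finite_measure_integrable_cst.
- by move=> n z _; exact: heat_bound.
Qed.

Lemma heat_avg_bddf (c : R) (g : 'rV[R]_d -> R) : bddf g -> continuous g -> bddf (heat_avg c g).
Proof.
move=> bg cg; have [M gM] := bg; exists (\int[N]_(z in Rpos) M) => x.
apply: (le_normr_Rintegral_dominated _ _ _ _).2 => //.
- by apply/measurable_EFinP; exact: measurable_int (heat_avg_integrable c x bg cg).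
- by apply: (integrableS measurableT) => //; exact: finite_measure_integrable_cst.
- by move=> z _; apply: heat_bound => //; exact: continuous_Rd_mfun.
Qed.

Lemma integrable_time_powR (c b K : R) : 0 <= c -> 0 < b <= 1 ->
  N.-integrable Rpos (EFin \o (fun z => K * (c * z) `^ (b - 1))).
Proof.
move=> c0 b01.
have I := integrable_mulr (K * c `^ (b - 1)) (measurable_itv _ : measurable Rpos) (integrable_normal_powR b01).
apply: eq_integrable I => // z; rewrite inE/= in_itv/= andbT => z0.
by rewrite powRM ?(ltW z0)// mulrA.
Qed.

Section singular_kernels.
Variables (i : 'I_d) (g : 'rV[R]_d -> R) (M : R).
Hypotheses (mg : Rd_mfun g) (gM : forall x, `|g x| <= M).

Let p1 (w : Om) : R := Z w 0 i.
Let p2 (w : Om) : R := Z w 0 i ^+ 2 - 1.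
Let mp1 : measurable_fun setT p1. Proof. exact: mZ. Qed.
Let mp2 : measurable_fun setT p2.
Proof. by apply: measurable_funB => //; exact: measurable_funX. Qed.
Let p1W (w : Om) : `|p1 w| <= 1 * gweight w.
Proof. by rewrite mul1r; have [] := gweight_bounds i w. Qed.
Let p2W (w : Om) : `|p2 w| <= 4 * gweight w.
Proof.
have [_] := gweight_bounds i w; apply: le_trans.
by rewrite ler_peMl// lerDl.
Qed.

Lemma heat1E (s : R) (x : 'rV[R]_d) :
  heat1 P Z i g s x = (Num.sqrt s)^-1 * \int[P]_w (g (x + Num.sqrt s *: Z w) * Z w 0 i).
Proof.
rewrite -RintegralZl//; last by have [] := weighted_bound mg gM mp1 p1W x s.
by apply: eq_Rintegral => w _; rewrite mulrCA.
Qed.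

Lemma heat2E (s : R) (x : 'rV[R]_d) :
  heat2 P Z i g s x =
  (Num.sqrt s)^-1 ^+ 2 * \int[P]_w (g (x + Num.sqrt s *: Z w) * (Z w 0 i ^+ 2 - 1)).
Proof.
rewrite -RintegralZl//; last by have [] := weighted_bound mg gM mp2 p2W x s.
by apply: eq_Rintegral => w _; rewrite mulrCA.
Qed.

(** The rate [s ^ (- 1 / 2)] is written with exponent [b - 1], [b = 1 / 2], the form in which
    integrability at [0] is known. *)
Lemma heat1_bound (s : R) (x : 'rV[R]_d) : 0 < s ->
  `|heat1 P Z i g s x| <= M * 1 * B0 * s `^ (2^-1 - 1).
Proof.
move=> s0; rewrite heat1E normrM mulrC ler_pM//.
  by have [] := weighted_bound mg gM mp1 p1W x s.
rewrite (_ : 2^-1 - 1 = - 2^-1 :> R); last by field.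
by rewrite powRN powR12_sqrt ?(ltW s0)// ger0_norm// invr_ge0 sqrtr_ge0.
Qed.

End singular_kernels.

(* Read off from the second derivative formula applied to the constant function 1. *)
Lemma gaussian_variance (i : 'I_d) : \int[P]_w (Z w 0 i ^+ 2 - 1) = 0.
Proof.
pose o (x : 'rV[R]_d) : R := 1.
have mo : Rd_mfun o by exact: cst_Rd_mfun.
have o1 x : `|o x| <= 1 by rewrite normr1.
have h0 : heat 1 o = fun=> 1 by apply/funext => x; exact: Rintegral_probability_cst.
have H1 := heat_has_partial1 ZG i ltr01 mo o1.
have e1 : heat1 P Z i o 1 = fun=> 0.
  apply/funext => x; have [_ <-] := H1 x; rewrite h0; exact: derive_cst.
have H2 := heat_has_partial2 ZG i ltr01 mo o1.
have : heat2 P Z i o 1 0 = 0.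
  by have [_ <-] := H2 0; rewrite e1; exact: derive_cst.
rewrite (heat2E i mo o1) sqrtr1 invr1 expr1n mul1r => <-.
by apply: eq_Rintegral => w _; rewrite mul1r.
Qed.

(** * Two derivatives for the time average of a Hölder function *)

Section holder_average.
Variables (i : 'I_d) (g : 'rV[R]_d -> R) (M C a c : R).
Hypotheses (c0 : 0 < c) (gM : forall x, `|g x| <= M) (a01 : 0 < a <= 1).
Hypothesis gH : forall x y, `|g x - g y| <= C * `|x - y| `^ a.

Let cg : continuous g. Proof. by apply: holder_continuous; exists C, a. Qed.
Let mg : Rd_mfun g. Proof. exact: continuous_Rd_mfun. Qed.

(* As [Z_i ^ 2 - 1] has mean zero, [g] can be centred at [x]; Hölder continuity then gains
   the factor [s ^ (a / 2)] that makes the singularity at [s = 0] integrable. *)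
Lemma heat2_bound (s : R) (x : 'rV[R]_d) : 0 < s ->
  `|heat2 P Z i g s x| <= `|C| * 4 * B0 * s `^ (a / 2 - 1).
Proof.
move=> s0; have st0 : 0 < Num.sqrt s by rewrite sqrtr_gt0.
have [a0 a1] := andP a01.
pose p2 (w : Om) : R := Z w 0 i ^+ 2 - 1.
have mp2 : measurable_fun setT p2 by apply: measurable_funB => //; exact: measurable_funX.
have p2W w : (1 + `|Z w|) * `|p2 w| <= 4 * gweight w by have [] := gweight_bounds i w.
have p2W' w : `|p2 w| <= 4 * gweight w.
  by apply: le_trans (p2W w); rewrite ler_peMl// lerDl.
have [i1 _] := weighted_bound mg gM mp2 p2W' x s.
have [i2 _] := weighted_bound (cst_Rd_mfun (g x)) (fun=> gM x) mp2 p2W' x s.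
have -> : heat2 P Z i g s x =
    (Num.sqrt s)^-1 ^+ 2 * \int[P]_w ((g (x + Num.sqrt s *: Z w) - g x) * p2 w).
  rewrite (heat2E i mg gM); congr (_ * _).
  transitivity (\int[P]_w (g (x + Num.sqrt s *: Z w) * p2 w) - \int[P]_w (g x * p2 w)).
    rewrite RintegralZl ?gaussian_variance ?mulr0 ?subr0//.
    have [i3 _] := weighted_bound (cst_Rd_mfun 1) (fun=> lexx `|1 : R|) mp2 p2W' x s.
    by apply: eq_integrable i3 => // w _ /=; rewrite mul1r.
  rewrite -RintegralB//; by apply: eq_Rintegral => w _; rewrite mulrBl.
rewrite normrM.
have -> : s `^ (a / 2 - 1) = (Num.sqrt s)^-1 ^+ 2 * Num.sqrt s `^ a.
  rewrite exprVn sqr_sqrtr ?ltW// powRB ?(gt_eqF s0) ?implybT// powRr1 ?ltW// mulrC; congr (_ * _).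
  by rewrite -powR12_sqrt ?ltW// -powRrM mulrC.
rewrite (ger0_norm (sqr_ge0 _)) mulrCA ler_wpM2l ?sqr_ge0//.
have K : `|C| * 4 * B0 * Num.sqrt s `^ a = \int[P]_w (`|C| * 4 * Num.sqrt s `^ a * gweight w).
  by rewrite RintegralZl ?mulrA 1?mulrAC//; exact: integrable_gweight.
rewrite K.
have D w : `|(g (x + Num.sqrt s *: Z w) - g x) * p2 w| <= `|C| * 4 * Num.sqrt s `^ a * gweight w.
  rewrite normrM (@le_trans _ _ (`|C| * Num.sqrt s `^ a * (1 + `|Z w|) * `|p2 w|))//.
    rewrite ler_wpM2r// (le_trans (gH _ _))// addrAC subrr add0r normrZ (gtr0_norm st0).
    have -> : (Num.sqrt s * `|Z w|) `^ a = Num.sqrt s `^ a * `|Z w| `^ a by rewrite powRM// ltW.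
    rewrite (@le_trans _ _ (`|C| * (Num.sqrt s `^ a * `|Z w| `^ a)))//.
      by rewrite ler_wpM2r ?ler_norm// mulr_ge0 ?powR_ge0.
    rewrite mulrA ler_wpM2l ?mulr_ge0 ?powR_ge0//.
    (* For [0 < a <= 1] the power [|Z| ^ a] is at most [1 + |Z|]: it is at most [1] on one side of
       [1] and at most [|Z|] on the other. *)
    have [n1|n1] := lerP `|Z w| 1.
      rewrite (@le_trans _ _ (1 `^ a))//; last by rewrite powR1 lerDl.
      by rewrite ge0_ler_powR ?nnegrE// ltW.
    rewrite (@le_trans _ _ (`|Z w| `^ 1))//; last by rewrite powRr1 ?lerDr.
    by rewrite ler_powR// ltW.
  rewrite -mulrA (le_trans (ler_wpM2l _ (p2W w)))//; last by rewrite le_eqVlt; apply/orP; left; apply/eqP; ring.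
apply: (le_normr_Rintegral_dominated _ _ _ _).2 => //.
  apply: measurable_funM => //; apply: measurable_funB => //; exact: (measurable_heat ZG).
by apply: integrable_mulr => //; exact: integrable_gweight.
Qed.

Let k1 (x : 'rV[R]_d) : R := \int[N]_(z in Rpos) heat1 P Z i g (c * z) x.
Let k2 (x : 'rV[R]_d) : R := \int[N]_(z in Rpos) heat2 P Z i g (c * z) x.
Let b1 (z : R) : R := M * 1 * B0 * (c * z) `^ (2^-1 - 1).
Let b2 (z : R) : R := `|C| * 4 * B0 * (c * z) `^ (a / 2 - 1).

Let ib1 : N.-integrable Rpos (EFin \o b1).
Proof. by apply: integrable_time_powR; rewrite ?ltW//; lra. Qed.
Let ib2 : N.-integrable Rpos (EFin \o b2).
Proof.
have [a0 a1] := andP a01.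
by apply: integrable_time_powR; [exact: ltW|apply/andP; split; lra].
Qed.

Let msqrtV (k : nat) : measurable_fun Rpos (fun z : R => (Num.sqrt (c * z))^-1 ^+ k).
Proof.
apply: measurable_funX.
apply: (@eq_measurable_fun _ _ _ _ Rpos (fun z : R => (c * z) `^ (- 2^-1))).
  move=> z; rewrite inE/= in_itv/= andbT => z0.
  by rewrite powRN powR12_sqrt// mulr_ge0 ?ltW.
apply: measurable_funTS.
by apply: (measurableT_comp (measurable_powR _)); exact: mulrl_measurable.
Qed.

Let ik1 (x : 'rV[R]_d) : N.-integrable Rpos (EFin \o (fun z => heat1 P Z i g (c * z) x)).
Proof.
rewrite (_ : (fun z => _) = (fun z => (Num.sqrt (c * z))^-1 ^+ 1 *
  \int[P]_w (g (x + Num.sqrt (c * z) *: Z w) * Z w 0 i))); last first.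
  by apply/funext => z; rewrite expr1 (heat1E i mg gM).
apply: (integrable_weighted mg gM (p := fun w => Z w 0 i) (K := 1) _ _ cg (msqrtV 1) ib1) => //.
- by move=> w; rewrite mul1r; have [] := gweight_bounds i w.
- by move=> z z0; rewrite expr1 -(heat1E i mg gM) heat1_bound// mulr_gt0.
Qed.

Let ik2 (x : 'rV[R]_d) : N.-integrable Rpos (EFin \o (fun z => heat2 P Z i g (c * z) x)).
Proof.
rewrite (_ : (fun z => _) = (fun z => (Num.sqrt (c * z))^-1 ^+ 2 *
  \int[P]_w (g (x + Num.sqrt (c * z) *: Z w) * (Z w 0 i ^+ 2 - 1)))); last first.
  by apply/funext => z; rewrite (heat2E i mg gM).
apply: (integrable_weighted mg gM (p := fun w => Z w 0 i ^+ 2 - 1) (K := 4) _ _ cg (msqrtV 2) ib2) => //.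
- by apply: measurable_funB => //; exact: measurable_funX.
- move=> w; have [_] := gweight_bounds i w; apply: le_trans.
  by rewrite ler_peMl// lerDl.
- by move=> z z0; rewrite -(heat2E i mg gM) heat2_bound// mulr_gt0.
Qed.

Let Rpos_mul (z : R) : Rpos z -> 0 < c * z.
Proof. by rewrite /= in_itv/= andbT => z0; rewrite mulr_gt0. Qed.

Let heat_avg_partial1 : has_partial i (heat_avg c g) k1.
Proof.
move=> x; apply: line_is_derive.
have -> : k1 x = \int[N]_(z in Rpos) heat1 P Z i g (c * z) (x + 0 *: ei i).
  by rewrite scale0r addr0.
apply: (@is_derive_under_integral _ _ _ N Rpos
  (fun r z => heat (c * z) g (x + r *: ei i)) (fun r z => heat1 P Z i g (c * z) (x + r *: ei i))
  0 (-1) 1 b1) => //.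
- by rewrite ltrN10 ltr01.
- by move=> r _; apply: heat_avg_integrable => //; exists M.
- move=> r z _ z0; apply: has_partial_line.
  by apply: (heat_has_partial1 ZG i _ mg gM); exact: Rpos_mul.
- by move=> r z _ z0; apply: heat1_bound => //; exact: Rpos_mul.
Qed.

Let heat_avg_partial2 : has_partial i k1 k2.
Proof.
move=> x; apply: line_is_derive.
have -> : k2 x = \int[N]_(z in Rpos) heat2 P Z i g (c * z) (x + 0 *: ei i).
  by rewrite scale0r addr0.
apply: (@is_derive_under_integral _ _ _ N Rpos
  (fun r z => heat1 P Z i g (c * z) (x + r *: ei i)) (fun r z => heat2 P Z i g (c * z) (x + r *: ei i))
  0 (-1) 1 b2) => //.
- by rewrite ltrN10 ltr01.
- move=> r z _ z0; apply: has_partial_line.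
  by apply: (heat_has_partial2 ZG i _ mg gM); exact: Rpos_mul.
- by move=> r z _ z0; apply: heat2_bound => //; exact: Rpos_mul.
Qed.

(** Both kernels are bounded, uniformly in [x], by the integrable functions [b1] and [b2] of the
    time variable, which justifies both differentiations under the average. The same [b2] dominates
    in the proof of continuity. *)
Lemma heat_avg_C2 : exists k1 k2, [/\ has_partial i (heat_avg c g) k1, has_partial i k1 k2,
  bddf k2 & seq_continuous k2].
Proof.
exists k1, k2; split => //.
  exists (\int[N]_(z in Rpos) b2 z) => x.
  apply: (le_normr_Rintegral_dominated _ _ _ _).2 => //.
    by apply/measurable_EFinP; exact: measurable_int (ik2 x).
  by move=> z z0; apply: heat2_bound => //; exact: Rpos_mul.
move=> y x yx.
apply: (@Rintegral_dominated_cvg _ _ _ N Rpos (fun n z => heat2 P Z i g (c * z) (y n)) _ b2) => //.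
- by move=> n; apply/measurable_EFinP; exact: measurable_int (ik2 (y n)).
(* At a fixed time the singular factor is a constant and is absorbed into the weight. *)
- move=> z z0; apply: (@weighted_seq_continuous g (fun w => (Num.sqrt (c * z))^-1 ^+ 2 * (Z w 0 i ^+ 2 - 1)) M
    ((Num.sqrt (c * z))^-1 ^+ 2 * 4) mg gM _ _ (c * z) cg y x yx).
    apply: measurable_funM => //; apply: measurable_funB => //; exact: measurable_funX.
  move=> w; rewrite normrM -[leRHS]mulrA (ger0_norm (sqr_ge0 _)) ler_wpM2l ?sqr_ge0//.
  have [_] := gweight_bounds i w; apply: le_trans.
  by rewrite ler_peMl// lerDl.
- by move=> n z z0; apply: heat2_bound => //; exact: Rpos_mul.
Qed.

End holder_average.

End heat_average.

(** * The generator of Brownian motion *)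

Lemma cvg_finsum {R : realType} (I : finType) (F : I -> nat -> R) (l : I -> R) :
  (forall j, F j n @[n --> \oo] --> l j) -> \sum_j F j n @[n --> \oo] --> \sum_j l j.
Proof.
move=> H; rewrite (_ : (fun n => \sum_j F j n) = \sum_j F j); last first.
  by apply/funext => n; rewrite fct_sumE.
by elim/big_ind2 : _ => [|f1 l1 f2 l2 H1 H2|j _]; [exact: cvg_cst|exact: cvgD|exact: H].
Qed.

Section second_order_class.
Context {R : realType} {d : nat}.
Implicit Types (v : 'rV[R]_d -> R) (g h : 'I_d -> 'rV[R]_d -> R).

(** Only pure second derivatives are recorded: this is what the coordinatewise Taylor expansion
    consumes and what the smoothing argument delivers. *)
Definition C2b v g h : Prop := forall i,
  [/\ has_partial i v (g i), has_partial i (g i) (h i), bddf (h i) & seq_continuous (h i)].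

Lemma C2b_lap v g h : C2b v g h -> lap v = fun x => \sum_(i < d) h i x.
Proof.
move=> H; apply/funext => x; apply: eq_bigr => i _; have [H1 H2 _ _] := H i.
by rewrite -(has_partial_derive H2) -(has_partial_derive H1).
Qed.

Lemma C2b_derivable v g h (i : 'I_d) y : C2b v g h ->
  derivable v y (ei i) /\ derivable ('D_(ei i) v) y (ei i).
Proof.
move=> /(_ i)[H1 H2 _ _]; rewrite (has_partial_derive H1).
by split; [exact: has_partial_derivable H1|exact: has_partial_derivable H2].
Qed.

Lemma has_partialZ (k : R) (i : 'I_d) v (g : 'rV[R]_d -> R) : has_partial i v g ->
  has_partial i (fun x => k * v x) (fun x => k * g x).
Proof. by move=> H x; exact: is_deriveZ (H x). Qed.

Lemma has_partial_sum (I : finType) (i : 'I_d) (v g : I -> 'rV[R]_d -> R) :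
  (forall j, has_partial i (v j) (g j)) ->
  has_partial i (fun x => \sum_j v j x) (fun x => \sum_j g j x).
Proof.
move=> H x; rewrite (_ : (fun x => \sum_j v j x) = \sum_j v j); last first.
  by apply/funext => y; rewrite fct_sumE.
elim/big_ind2 : _ => [|f1 l1 f2 l2 H1 H2|j _]; [exact: is_derive_cst|exact: is_deriveD|exact: H].
Qed.

Lemma C2bZ (k : R) v g h : C2b v g h ->
  C2b (fun x => k * v x) (fun i x => k * g i x) (fun i x => k * h i x).
Proof.
move=> H i; have [H1 H2 H3 H4] := H i; split; [exact: has_partialZ|exact: has_partialZ|exact: bddfZ|].
by move=> y x yx; apply: cvgM; [exact: cvg_cst|exact: H4].
Qed.

Lemma C2b_sum (I : finType) (v : I -> 'rV[R]_d -> R) (g h : I -> 'I_d -> 'rV[R]_d -> R) :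
  (forall j, C2b (v j) (g j) (h j)) ->
  C2b (fun x => \sum_j v j x) (fun i x => \sum_j g j i x) (fun i x => \sum_j h j i x).
Proof.
move=> H i; split.
- by apply: has_partial_sum => j; have [] := H j i.
- by apply: has_partial_sum => j; have [] := H j i.
- have /choice[M hM] : forall j, exists M, forall x, `|h j i x| <= M by move=> j; have [] := H j i.
  exists (\sum_j M j) => x; rewrite (le_trans (ler_norm_sum _ _ _))//.
  by apply: ler_sum => j _; exact: hM.
- move=> y x yx.
  by apply: cvg_finsum => j; have [_ _ _] := H j i; exact.
Qed.

End second_order_class.

Lemma Rd_mfun_comp {R : realType} {d : nat} (g : 'rV[R]_d -> R) (L : 'rV[R]_d -> 'rV[R]_d) :
  Rd_mfun g -> (forall j, Rd_mfun (fun v => L v 0 j)) -> Rd_mfun (fun v => g (L v)).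
Proof.
move=> mg mL; apply/Rd_mfunP; apply: (Rd_mfun_vector (T := borelRd) mg) => j.
exact/Rd_mfunP.
Qed.

(** * Small-time behaviour of the heat semigroup *)

Section heat_generator.
Context {d0 : measure_display} {Om : measurableType d0} {R : realType} {d : nat}.
Variables (P : probability Om R) (Z : Om -> 'rV[R]_d).
Hypothesis ZG : std_gaussian P Z.

Let mZ : forall i, measurable_fun setT (fun w => Z w 0 i). Proof. by case: ZG. Qed.

Variables (v : 'rV[R]_d -> R) (g h : 'I_d -> 'rV[R]_d -> R).
Hypotheses (bv : bddf v) (mv : Rd_mfun v) (vC : C2b v g h).

Let part (k : nat) (e : R) (x z : 'rV[R]_d) : R := v (x + trunc k (e *: z)).

Let mpart (k : nat) (e : R) (x : 'rV[R]_d) : Rd_mfun (part k e x).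
Proof.
apply: (Rd_mfun_comp (L := fun z => x + trunc k (e *: z)) mv) => j.
rewrite (_ : (fun z : 'rV[R]_d => _) =
  (fun z : 'rV[R]_d => x 0 j + (if (j < k)%N then e * z 0 j else 0))); last first.
  by apply/funext => z; rewrite !mxE; case: ifP => _; rewrite ?mxE.
apply: Rd_mfunD; first exact: cst_Rd_mfun.
by case: (j < k)%N; [apply: Rd_mfunZ; exact: Rd_mfun_coord|exact: cst_Rd_mfun].
Qed.

Let mpartZ (k : nat) (e : R) (x : 'rV[R]_d) : measurable_fun setT (fun w => part k e x (Z w)).
Proof. exact: (Rd_mfun_vector (mpart k e x)). Qed.

Let ipart (k : nat) (e : R) (x : 'rV[R]_d) :
  P.-integrable setT (EFin \o (fun w => part k e x (Z w))).
Proof. by have [M vM] := bv; apply: (@bounded_integrable _ _ _ _ _ _ M) => // w; exact: vM. Qed.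

Let sdiff (i : 'I_d) (e : R) (x : 'rV[R]_d) (w : Om) : R :=
  let y := x + trunc i (e *: Z w) in
  v (y + (e * Z w 0 i) *: ei i) + v (y - (e * Z w 0 i) *: ei i) - 2 * v y.

(* Flipping the sign of the i-th coordinate of Z symmetrises the increment in that direction. *)
Let sdiff_integral (i : 'I_d) (e : R) (x : 'rV[R]_d) :
  \int[P]_w (part i.+1 e x (Z w) - part i e x (Z w)) = 2^-1 * \int[P]_w sdiff i e x w /\
  measurable_fun setT (sdiff i e x).
Proof.
have mF : Rd_mfun (fun z => part i.+1 e x (flipc i z)).
  apply: (Rd_mfun_comp (mpart i.+1 e x)) => j.
  rewrite (_ : (fun z : 'rV[R]_d => _) = (fun z => if j == i then -1 * z 0 j else z 0 j)); last first.
    by apply/funext => z; rewrite mxE mulN1r.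
  by case: (j == i); [apply: Rd_mfunZ|]; exact: Rd_mfun_coord.
have mFZ := Rd_mfun_vector mF mZ.
have iF : P.-integrable setT (EFin \o (fun w => part i.+1 e x (flipc i (Z w)))).
  by have [M vM] := bv; apply: (@bounded_integrable _ _ _ _ _ _ M) => // w; exact: vM.
have E1 w : part i.+1 e x (Z w) = v (x + trunc i (e *: Z w) + (e * Z w 0 i) *: ei i).
  by rewrite /part truncS mxE addrA.
have E2 w : part i.+1 e x (flipc i (Z w)) = v (x + trunc i (e *: Z w) - (e * Z w 0 i) *: ei i).
  rewrite /part truncS addrA !mxE eqxx mulrN scaleNr; congr (v (_ + _ - _)).
  (* [trunc i] keeps the coordinates strictly below [i], so it does not see the flip. *)
  apply/rowP => j; rewrite !mxE; case: ifP => // ji.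
  by case: eqVneq ji => // ->; rewrite ltnn.
have sE w : sdiff i e x w = part i.+1 e x (Z w) + part i.+1 e x (flipc i (Z w)) - 2 * part i e x (Z w).
  by rewrite E1 E2.
split; last first.
  rewrite (_ : sdiff i e x = fun w => part i.+1 e x (Z w) + part i.+1 e x (flipc i (Z w)) - 2 * part i e x (Z w)).
    apply: measurable_funB; first exact: measurable_funD.
    by apply: measurable_funM.
  by apply/funext.
have i2 : P.-integrable setT (EFin \o (fun w => 2 * part i e x (Z w))) by exact: integrable_mulr.
have i12 : P.-integrable setT (EFin \o (fun w => part i.+1 e x (Z w) + part i.+1 e x (flipc i (Z w)))).
  rewrite (_ : EFin \o _ = (fun w => ((part i.+1 e x (Z w))%:E + (part i.+1 e x (flipc i (Z w)))%:E)%E)).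
    by apply: integrableD => //; exact: ipart.
  by apply/funext => w /=; rewrite EFinD.
rewrite (eq_Rintegral _ (g := fun w => part i.+1 e x (Z w) + part i.+1 e x (flipc i (Z w)) - 2 * part i e x (Z w)) (fun w _ => sE w)).
rewrite !RintegralB// RintegralD// RintegralZl//.
rewrite (gaussian_flip ZG i (mpart i.+1 e x)).
by field.
Qed.

Let e (n : nat) : R := Num.sqrt n.+1%:R^-1.

Let e_cvg : e n @[n --> \oo] --> (0 : R).
Proof.
rewrite -[X in _ --> X](@sqrtr0 R).
by apply: (cvg_comp _ _ (@cvg_harmonic R)); exact: sqrt_continuous.
Qed.

(** As [(n + 1) * e n ^ 2 = 1], the scaled symmetric difference is [Z_i ^ 2] times [h i] at a point
    tending to [x]. Dominated convergence yields the mean of [Z_i ^ 2 * h i x], and the variance is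
    one. *)
Let sdiff_cvg (i : 'I_d) (x : 'rV[R]_d) :
  n.+1%:R * \int[P]_w sdiff i (e n) x w @[n --> \oo] --> h i x.
Proof.
have [H1 H2 [K hK] hc] := vC i.
have gwz' w : `|Z w 0 i ^+ 2 - 1| <= 4 * gweight Z w.
  have [_] := gweight_bounds Z i w; apply: le_trans; by rewrite ler_peMl// lerDl.
have gwz w : Z w 0 i ^+ 2 <= 4 * gweight Z w + 1.
  by have := gwz' w; have := ler_norm (Z w 0 i ^+ 2 - 1); lra.
have iW : P.-integrable setT (EFin \o (fun w => 4 * gweight Z w)).
  by apply: integrable_mulr => //; exact: integrable_gweight.
have iz : P.-integrable setT (EFin \o (fun w => Z w 0 i ^+ 2 - 1)).
  apply: (le_normr_Rintegral_dominated _ _ iW _).1 => //.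
  by apply: measurable_funB => //; exact: measurable_funX.
have -> : h i x = \int[P]_w (Z w 0 i ^+ 2 * h i x).
  transitivity (\int[P]_w (h i x * (Z w 0 i ^+ 2 - 1) + h i x)); last first.
    by apply: eq_Rintegral => w _; ring.
  rewrite RintegralD//; [|exact: integrable_mulr|exact: finite_measure_integrable_cst].
  by rewrite RintegralZl// (gaussian_variance ZG) mulr0 add0r Rintegral_probability_cst.
have S n w : exists2 c : R, `|c| <= 3 * `|e n * Z w 0 i| &
    n.+1%:R * sdiff i (e n) x w = Z w 0 i ^+ 2 * h i (x + trunc i (e n *: Z w) + c *: ei i).
  have [c ca E] := symmetric_difference (x + trunc i (e n *: Z w)) (e n * Z w 0 i) H1 H2.
  exists c => //; rewrite /sdiff E exprMn sqr_sqrtr ?invr_ge0//.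
  by rewrite !mulrA mulfV ?pnatr_eq0// mul1r.
rewrite (_ : (fun n => _) = (fun n => \int[P]_w (n.+1%:R * sdiff i (e n) x w))); last first.
  apply/funext => n; rewrite RintegralZl//.
  have [M vM] := bv.
  apply: (@bounded_integrable _ _ _ _ _ _ (4 * M)) => //; first by have [] := sdiff_integral i (e n) x.
  move=> w; rewrite /sdiff.
  set y := x + _; set y1 := y + _; set y2 := y - _.
  have := ler_normB (v y1 + v y2) (2 * v y); have := ler_normD (v y1) (v y2).
  have := vM y; have := vM y1; have := vM y2; have : `|2 * v y| = 2 * `|v y| by rewrite normrM ger0_norm.
  by lra.
apply: (@Rintegral_dominated_cvg _ _ _ P setT (fun n w => n.+1%:R * sdiff i (e n) x w) _
  (fun w => K * (4 * gweight Z w + 1))) => //.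
- by move=> n; apply: measurable_funM => //; have [] := sdiff_integral i (e n) x.
- move=> w _.
  (* The intermediate points are chosen for one fixed outcome, so their measurability in [w] is not
     at stake. *)
  have /choice[c cP] : forall n, exists c : R, `|c| <= 3 * `|e n * Z w 0 i| /\
      n.+1%:R * sdiff i (e n) x w = Z w 0 i ^+ 2 * h i (x + trunc i (e n *: Z w) + c *: ei i).
    by move=> n; have [c] := S n w; exists c.
  rewrite (_ : (fun n => _) = (fun n => Z w 0 i ^+ 2 * h i (x + trunc i (e n *: Z w) + c n *: ei i))); last first.
    by apply/funext => n; have [] := cP n.
  apply: cvgM; first exact: cvg_cst.
  apply: hc.
  apply/cvgrPdist_lt => eps eps0.
  (* The displacement is at most [|e n| * |Z|] from the truncation plus three times as much from the
     intermediate point; the added [1] avoids a zero denominator. *)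
  have /cvgrPdist_lt/(_ (eps / (1 + 4 * `|Z w|))) := e_cvg.
  have q0 : 0 < 1 + 4 * `|Z w| by rewrite ltr_wpDr// mulr_ge0.
  rewrite divr_gt0// => /(_ isT); apply: filterS => n.
  rewrite sub0r normrN ltr_pdivlMr// => en.
  rewrite -addrA opprD addrA subrr sub0r normrN.
  apply: le_lt_trans en; rewrite (le_trans (ler_normD _ _))//.
  have t1 : `|trunc i (e n *: Z w)| <= `|e n| * `|Z w| by rewrite (le_trans (norm_trunc_le _ _))// normrZ.
  have t2 : `|c n *: ei i : 'rV[R]_d| <= 3 * (`|e n| * `|Z w|).
    have [cn _] := cP n; rewrite normrZ (le_trans (ler_pM _ _ cn (norm_ei i)))// mulr1 normrM.
    by rewrite ler_wpM2l// ler_wpM2l// norm_coord_le.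
  by have := normr_ge0 (e n); lra.
- apply: integrable_mulr => //.
  rewrite (_ : EFin \o _ = (fun w => ((4 * gweight Z w)%:E + (1 : R)%:E)%E)); last by apply/funext => w.
  by apply: integrableD => //; exact: finite_measure_integrable_cst.
- move=> n w _; have [c _ ->] := S n w.
  by rewrite normrM (ger0_norm (sqr_ge0 _)) mulrC ler_pM// sqr_ge0.
Qed.

(** The increment of [v] telescopes over the coordinates. Each term moves a single coordinate, so
    mixed derivatives never occur. *)
Lemma heat_generator (x : 'rV[R]_d) :
  n.+1%:R * (heat P Z n.+1%:R^-1 v x - v x) @[n --> \oo] --> 2^-1 * \sum_(i < d) h i x.
Proof.
have E n : n.+1%:R * (heat P Z n.+1%:R^-1 v x - v x) =
    2^-1 * \sum_(i < d) (n.+1%:R * \int[P]_w sdiff i (e n) x w).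
  have -> : heat P Z n.+1%:R^-1 v x - v x =
      \sum_(i < d) \int[P]_w (part i.+1 (e n) x (Z w) - part i (e n) x (Z w)).
    have p0 w : part 0 (e n) x (Z w) = v x.
      by rewrite /part (_ : trunc 0 _ = 0) ?addr0//; apply/rowP => j; rewrite !mxE.
    have pd w : part d (e n) x (Z w) = v (x + e n *: Z w).
      by rewrite /part; congr (v (_ + _)); apply/rowP => j; rewrite !mxE ltn_ord.
    transitivity (\int[P]_w part d (e n) x (Z w) - \int[P]_w part 0 (e n) x (Z w)).
      congr (_ - _); first by apply: eq_Rintegral => w _; rewrite pd.
      by rewrite -[LHS](Rintegral_probability_cst P); apply: eq_Rintegral => w _; rewrite p0.
    rewrite -(telescope_sumr (fun k => \int[P]_w part k (e n) x (Z w)))// big_mkord.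
    by apply: eq_bigr => i _; rewrite RintegralB.
  rewrite !mulr_sumr; apply: eq_bigr => i _.
  by have [-> _] := sdiff_integral i (e n) x; rewrite mulrCA.
rewrite (_ : (fun n => _) = (fun n => 2^-1 * \sum_(i < d) (n.+1%:R * \int[P]_w sdiff i (e n) x w))); last exact/funext.
apply: cvgM; first exact: cvg_cst.
by apply: cvg_finsum => i; exact: sdiff_cvg.
Qed.

End heat_generator.

(** * Identification of the generator of Brownian motion *)

Section brownian_family.
Context {d0 : measure_display} {Om : measurableType d0} {R : realType} {d : nat}.
Variables (P : probability Om R) (X : 'rV[R]_d -> R -> Om -> 'rV[R]_d).
Hypotheses (MX : markov_family P X) (BX : bm_family P X).
Notation N := (@normal_prob R 0 1).
Notation Z := (X 0 1).

Lemma bm_box (x : 'rV[R]_d) (s : R) (A : 'I_d -> set R) : 0 < s -> (forall i, measurable (A i)) ->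
  P (X x s @^-1` box A) =
  (\prod_(i < d) N ((fun z : R => (Num.sqrt s * z + x 0 i)%R) @^-1` A i))%E.
Proof.
move=> s0 mA; have [[_ IG] BR] := BX x.
pose A' (i : 'I_d) (_ : R) : set R := (fun z : R => z + x 0 i) @^-1` A i.
have mA' i r : measurable (A' i r).
  rewrite /A' -[X in measurable X]setTI.
  have mt : measurable_fun setT (fun z : R => z + x 0 i) by exact: measurable_funD.
  exact: mt.
have cE i : cyl_event (fun (i : 'I_d) (t : R) w => X x t w 0 i - x 0 i) (fun=> [:: s]) A' i =
    (fun w => X x s w 0 i - x 0 i) @^-1` A' i 0.
  apply/seteqP; split => w; first by apply; left.
  by move=> H r [<-|].
have := IG (enum 'I_d) (enum_uniq _) (fun=> [:: s]) A' mA'.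
rewrite (_ : \bigcap_(k in _) _ = X x s @^-1` box A); last first.
  apply/seteqP; split => w H.
    move=> i; have := H i; rewrite cE /A' /= subrK; apply.
    by rewrite /= mem_enum.
  by move=> i _; rewrite cE /A' /= subrK; exact: H.
move=> ->; rewrite big_enum/=; apply: eq_bigr => i _; rewrite cE.
have [B0 _ _ gB] := BR i.
have [+ _] := gB 0 s (lexx 0) s0 => /(_ _ (mA' i 0)).
rewrite subr0 (_ : (fun w => _ - _) = (fun w => X x s w 0 i - x 0 i)); last first.
  by apply/funext => w; rewrite B0 subr0.
by move=> ->; rewrite normal_prob_scale ?sqrtr_gt0.
Qed.

Lemma bm_std_gaussian : std_gaussian P Z.
Proof.
split; first by move=> i; have [_ _ m _ _] := MX; exact: m.
move=> A mA; rewrite bm_box ?ltr01//; apply: eq_bigr => i _; congr (N _).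
by apply/seteqP; split => z /=; rewrite sqrtr1 mul1r mxE addr0.
Qed.

(** By translation and scaling of the normal law, the one vector [X 0 1] represents the semigroup at
    all times and from all starting points. Time [0] is separate, the law being degenerate there. *)
Lemma bm_semig (s : R) (g : 'rV[R]_d -> R) (x : 'rV[R]_d) : 0 <= s -> Rd_mfun g ->
  semig P X s g x = heat P Z s g x.
Proof.
rewrite le_eqVlt => /predU1P[<- mg|s0 mg].
  rewrite (semig0 MX) /heat sqrtr0.
  by under eq_Rintegral do rewrite scale0r addr0; rewrite Rintegral_probability_cst.
have [_ _ mX _ _] := MX; have [mZ LZ] := bm_std_gaussian.
apply: integral_same_law => //.
  move=> i; rewrite (_ : (fun w => _) = (fun w => x 0 i + Num.sqrt s * Z w 0 i)); last first.
    by apply/funext => w; rewrite !mxE.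
  by apply: measurable_funD => //; exact: measurable_funM.
move=> A mA; rewrite bm_box//.
pose A' (i : 'I_d) : set R := (fun z : R => Num.sqrt s * z + x 0 i) @^-1` A i.
have mA' i : measurable (A' i).
  rewrite /A' -[X in measurable X]setTI.
  by have := @measurable_fun_affine R (Num.sqrt s) (x 0 i) measurableT _ (mA i).
rewrite -(LZ A' mA'); congr (P _); apply/seteqP; split => w H i; have := H i.
  by rewrite /A' /= !mxE addrC.
by rewrite /A' /= !mxE addrC.
Qed.

(** Existence of the limit defining the generator is part of the hypothesis, so it can be identified
    along the times [1 / (n + 1)]. *)
Lemma gen_laplacian (v hh : 'rV[R]_d -> R) (g h : 'I_d -> 'rV[R]_d -> R) :
  gen P X v hh -> C2b v g h -> forall x, hh x = lap v x / 2.
Proof.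
move=> [bv mv _ _ G] vC x; rewrite (C2b_lap vC) mulrC.
have C1 : n.+1%:R * (heat P Z n.+1%:R^-1 v x - v x) @[n --> \oo] --> 2^-1 * \sum_(i < d) h i x.
  exact: (heat_generator bm_std_gaussian bv mv vC).
suff C2 : n.+1%:R * (heat P Z n.+1%:R^-1 v x - v x) @[n --> \oo] --> hh x by exact: (cvg_unique _ C2 C1).
apply/cvgrPdist_lt => e e0; have [del del0 H] := G e e0.
have /cvgrPdist_lt/(_ _ del0) := @cvg_harmonic R.
apply: filterS => n; rewrite sub0r normrN ger0_norm ?invr_ge0// => nd.
have n0 : 0 < (n.+1%:R^-1 : R) < del by rewrite invr_gt0 ltr0n.
have := H _ n0 x; rewrite bm_semig ?invr_ge0// invrK distrC mulrC.
by [].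
Qed.

Lemma btavg_heat_avg (c : R) (g : 'rV[R]_d -> R) (x : 'rV[R]_d) : 0 < c -> Rd_mfun g ->
  btavg P X c (fun=> 1) g x = heat_avg P Z c g x.
Proof.
move=> c0 mg; apply: eq_Rintegral => z; rewrite inE/= in_itv/= andbT => z0.
by rewrite mul1r bm_semig// mulr_ge0 ?ltW.
Qed.

End brownian_family.

(** * Regularity of the initial datum and of its averages *)

Section regularity.
Context {R : realType} {d : nat}.
Variable f : 'rV[R]_d -> R.
Hypothesis bf : bddf f.
Hypothesis Df : forall i j x, derivable f x (ei j) /\ derivable ('D_(ei j) f) x (ei i).
Hypothesis D2f : forall i j, bddf (D2 f i j) /\ holder (D2 f i j).

Lemma derivable_has_partial1 (i : 'I_d) : has_partial i f ('D_(ei i) f).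
Proof. by move=> x; have [H _] := Df i i x; exact: derivableP. Qed.

Lemma derivable_has_partial2 (i j : 'I_d) : has_partial i ('D_(ei j) f) (D2 f i j).
Proof. by move=> x; have [_ H] := Df i j x; exact: derivableP. Qed.

Lemma bddf_partial (i : 'I_d) : bddf ('D_(ei i) f).
Proof.
have [M fM] := bf; have [[M2 M2P] _] := D2f i i.
exists (2 * M + M2) => x.
exact: (bounded_partial (derivable_has_partial1 i) (derivable_has_partial2 i i) fM M2P).
Qed.

Lemma bounded_family_holder (v : 'rV[R]_d -> R) (g : 'I_d -> 'rV[R]_d -> R) :
  (forall i, has_partial i v (g i)) -> (forall i, bddf (g i)) -> holder v.
Proof.
move=> Hv /choice[M gM]; apply: (bounded_partials_holder (M := \sum_i `|M i|) Hv) => i x.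
rewrite (le_trans (gM i x))// (le_trans (ler_norm _))// (bigD1 i)//= lerDl.
exact: sumr_ge0.
Qed.

(** Bounds on [f] and on its pure second derivatives bound the first derivatives, so [f] is
    Lipschitz. The excursion representation relies on this continuity. *)
Lemma D2_holder_continuous : continuous f.
Proof.
apply: holder_continuous; apply: bounded_family_holder; first exact: derivable_has_partial1.
exact: bddf_partial.
Qed.

Lemma continuous_partial (i : 'I_d) : continuous ('D_(ei i) f).
Proof.
apply: holder_continuous; apply: (bounded_family_holder (g := fun j => D2 f j i)) => j.
  exact: derivable_has_partial2.
by have [] := D2f j i.
Qed.

Lemma continuous_D2 (i j : 'I_d) : continuous (D2 f i j).
Proof. by apply: holder_continuous; have [] := D2f i j. Qed.

Lemma C2b_of_D2_holder : C2b f (fun i => 'D_(ei i) f) (fun i => D2 f i i).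
Proof.
move=> i; split; [exact: derivable_has_partial1|exact: derivable_has_partial2|by have [] := D2f i i|].
by apply: continuous_seq_continuous; exact: continuous_D2.
Qed.

Context {d0 : measure_display} {Om : measurableType d0}.
Variables (P : probability Om R) (Z : Om -> 'rV[R]_d).
Hypothesis ZG : std_gaussian P Z.

Lemma C2b_heat_avg (c : R) : C2b (fun x => 2 * heat_avg P Z c f x)
  (fun i x => 2 * heat_avg P Z c ('D_(ei i) f) x) (fun i x => 2 * heat_avg P Z c (D2 f i i) x).
Proof.
apply: C2bZ => i; have [b2 _] := D2f i i; split.
- by apply: (heat_avg_partial ZG) => //; [exact: D2_holder_continuous|exact: bddf_partial|
    exact: continuous_partial|exact: derivable_has_partial1].
- by apply: (heat_avg_partial ZG) => //; [exact: bddf_partial|exact: continuous_partial|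
    exact: continuous_D2|exact: derivable_has_partial2].
- by apply: (heat_avg_bddf ZG) => //; exact: continuous_D2.
- by apply: (heat_avg_seq_continuous ZG) => //; exact: continuous_D2.
Qed.

(** The Laplacian of the average is the sum of the averages of the [D2 f j j], each of which is
    Hölder and hence smoothed by the average; each may have its own exponent and constant. *)
Lemma C2b_lap_heat_avg (c : R) : 0 < c ->
  exists g h, C2b (lap (fun x => 2 * heat_avg P Z c f x)) g h.
Proof.
move=> c0; rewrite (C2b_lap (C2b_heat_avg c)).
have H j i : exists kk : ('rV[R]_d -> R) * ('rV[R]_d -> R),
    [/\ has_partial i (heat_avg P Z c (D2 f j j)) kk.1, has_partial i kk.1 kk.2, bddf kk.2 & seq_continuous kk.2].
  have [[M DM] [C [a [a01 DH]]]] := D2f j j.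
  by have [k1 [k2 ?]] := heat_avg_C2 ZG i c0 DM a01 DH; exists (k1, k2).
have /choice[kk kkP] : forall j, exists kk : 'I_d -> ('rV[R]_d -> R) * ('rV[R]_d -> R), forall i,
    [/\ has_partial i (heat_avg P Z c (D2 f j j)) (kk i).1, has_partial i (kk i).1 (kk i).2,
     bddf (kk i).2 & seq_continuous (kk i).2].
  by move=> j; have /choice[k kP] := H j; exists k.
exists (fun i x => \sum_j (2 * (kk j i).1 x)), (fun i x => \sum_j (2 * (kk j i).2 x)).
apply: (C2b_sum (v := fun j x => 2 * heat_avg P Z c (D2 f j j) x)
  (g := fun j i x => 2 * (kk j i).1 x) (h := fun j i x => 2 * (kk j i).2 x)) => j.
by apply: (@C2bZ _ _ 2 _ (fun i => (kk j i).1) (fun i => (kk j i).2)) => i; exact: kkP.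
Qed.

End regularity.

Theorem theorem0p1 (R : realType) (d : nat) (d0 : measure_display)
  (Om : measurableType d0) (P : probability Om R)
  (X : 'rV[R]_d -> R -> Om -> 'rV[R]_d)
  (Xc : nat -> 'rV[R]_d -> R -> Om -> 'rV[R]_d)
  (B : R -> Om -> R) (m : ebtp_mode) (sel : nat -> Om -> nat)
  (f Af : 'rV[R]_d -> R) :
  markov_family P X ->
  (forall i, markov_family P (Xc i)) ->
  (forall i x, same_law P (coords (Xc i x)) (coords (X x))) ->
  brownian P B ->
  sel_ok P m sel ->
  (forall x, ebtp_indep P Xc B sel x) ->
  (forall i j x, derivable f x (ei j) /\ derivable ('D_(ei j) f) x (ei i)) ->
  (forall i j, bddf (D2 f i j) /\ holder (D2 f i j)) ->
  gen P X f Af ->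
  let u := fun (t : R) (x : 'rV[R]_d) =>
             Ex P (fun w => f (ebtp Xc B sel x t w)) in
  [/\ (forall x, u 0 x = f x),
      (forall t, 0 < t -> exists h1 h2,
         [/\ gen P X (u t) h1, gen P X h1 h2 &
             forall x, is_derive t 1 (fun s => u s x)
               (Af x / Num.sqrt (2 * pi * t) + h2 x / 2)]) &
      (bm_family P X -> m = kEBTP 1 ->
       forall t, 0 < t -> forall x,
         (forall y i,
            [/\ derivable (u t) y (ei i),
                derivable ('D_(ei i) (u t)) y (ei i),
                derivable (lap (u t)) y (ei i) &
                derivable ('D_(ei i) (lap (u t))) y (ei i)]) /\
         is_derive t 1 (fun s => u s x)
           (lap f x / Num.sqrt (8 * pi * t) + lap (lap (u t)) x / 8))].

Proof.
move=> MX MXc SL BM _ IND Df D2f G u.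
have [bf mf _ _ _] := G.
have cf : continuous f by exact: (D2_holder_continuous bf Df D2f).
have sf : strongly_cont P X f by exact: gen_strongly_cont G.
have uE t x : 0 < t -> u t x = 2 * btavg P X (Num.sqrt t) (fun=> 1) f x.
  by move=> t0; exact: (ebtp_btavg MX MXc SL BM IND bf cf sf).
split.
- move=> x; rewrite -[RHS](Rintegral_probability_cst P) /u /Ex /Rintegral; congr fine.
  apply: eq_integral => w _; congr ((f _)%:E); rewrite /ebtp.
  have [-> _ _ _] := BM; rewrite normr0.
  by have [-> _ _ _ _] := MXc (sel (exc_label B w 0) w).
- move=> t t0; have [h2 [G1 G2 D]] := brownian_time_evolution MX t0 G uE.
  by exists (fun x => 2 * btavg P X (Num.sqrt t) (fun=> 1) Af x), h2.
- move=> BX _ t t0 x.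
  have c0 : 0 < Num.sqrt t by rewrite sqrtr_gt0.
  have ZG := bm_std_gaussian MX BX.
  have [h2 [G1 G2 D]] := brownian_time_evolution MX t0 G uE.
  have utE : u t = fun y => 2 * heat_avg P (X 0 1) (Num.sqrt t) f y.
    by apply/funext => y; rewrite uE// (btavg_heat_avg MX BX).
  have Cu := C2b_heat_avg bf Df D2f ZG (Num.sqrt t); rewrite -utE in Cu.
  have [gl [hl Cl]] := C2b_lap_heat_avg bf Df D2f ZG c0; rewrite -utE in Cl.
  split=> [y i|].
    by have [? ?] := C2b_derivable i y Cu; have [? ?] := C2b_derivable i y Cl; split.
  have AfE := gen_laplacian MX BX G (C2b_of_D2_holder Df D2f) x.
  (* The generator is identified on [u t], then on half the Laplacian of [u t]; the second use is
     the reason why that Laplacian has to be twice differentiable itself. *)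
  have h1E : (fun y => 2 * btavg P X (Num.sqrt t) (fun=> 1) Af y) = fun y => 2^-1 * lap (u t) y.
    by apply/funext => y; rewrite (gen_laplacian MX BX G1 Cu y) mulrC.
  rewrite h1E in G2.
  have h2E : h2 x = 2^-1 * lap (lap (u t)) x / 2.
    rewrite (gen_laplacian MX BX G2 (C2bZ 2^-1 Cl) x); congr (_ / 2).
    by rewrite (C2b_lap (C2bZ 2^-1 Cl)) (C2b_lap Cl) mulr_sumr.
  apply: is_derive_eq (D x) _; rewrite AfE h2E.
  (* The factor [2] in the root matches the [1 / 2] in [A f = lap f / 2]. *)
  have -> : Num.sqrt (8 * pi * t) = 2 * Num.sqrt (2 * pi * t).
    rewrite (_ : 8 * pi * t = 2 ^+ 2 * (2 * pi * t)); last by ring.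
    by rewrite sqrtrM ?sqr_ge0// sqrtr_sqr ger0_norm.
  have s0 : Num.sqrt (2 * pi * t) != 0 by rewrite gt_eqF// sqrtr_gt0 !mulr_gt0// pi_gt0.
  move: s0; move: (Num.sqrt _) (lap f x) (lap (lap (u t)) x) => q a b q0.
  by field.
Qed.
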